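(* Consider AR-Lasso with R-Lasso as initial estimator and weights computed from the SCAD penalty with parameter $a>2$ (see the context). Assume $\lambda_n$ is of exact order $\sqrt{s(\log p)(\log\log n)/n}$, $\log p=o(\sqrt n)$, $\min_{1\le j\le s}|\beta_j^*|\ge 2a\lambda_n$, and $\kappa_n=o(n^{1/4}s^{-1/2}(\log n)^{-3/2}(\log p)^{1/2})$. Further assume that $\|n^{-1}Q^THS\|_{2,\infty}<C_4\sqrt{(\log p)(\log\log n)/\log n}$ with $C_4$ some positive constant. Then, under Conditions 1 and 2 (stated in the context), and provided the initial estimator satisfies, with probability tending to one, $\|\hat\beta^{\mathrm{ini}}-\beta^*\|_2\le C_2\sqrt{s(\log p)/n}$ for some constant $C_2>0$, with probability tending to one there exists a global minimizer $\hat\beta=(\hat\beta_1^T,\hat\beta_2^T)^T$ of $\widehat L_n(\beta)$ over $\mathbf R^p$ (with $\hat\beta_1\in\mathbf R^s$) such that $$\|\hat\beta_1-\beta_1^*\|_2\le O\big(\sqrt{s(\log n)/n}\big),\qquad \operatorname{sgn}(\hat\beta_1)=\operatorname{sgn}(\beta_1^* ),\qquad \hat\beta_2=\mathbf 0.$$ If in addition $\max_i f_i(0)^{1/2}\|Z_{ni}\|_2=o(s^{-7/2}(\log s)^{-1})$, then also $$\mathbf c^T(Z_n^TZ_n)^{-1/2}V_n^{-1}(\hat\beta_1-\beta_1^* )\ \xrightarrow{\ \mathscr D\ }\ N\big(0,\tau(1-\tau)\big),$$ where $\mathbf c$ is an arbitrary $s$-dimensional vector satisfying $\mathbf c^T\mathbf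 c=1$.
   Context: Setting. All limits are as $n\to\infty$; $p,s,X,\beta^*,\lambda_n$ and the error distributions may depend on $n$. The model is $\mathbf y=X\beta^*+\varepsilon$, where $X=(x_{ij})$ is a fixed (nonrandom) $n\times p$ design matrix with rows $\mathbf x_i^T$ and each column having $L_2$-norm $\sqrt n$, and $\varepsilon_1,\dots,\varepsilon_n$ are independent with $P(\varepsilon_i\le 0)=\tau$ for a known constant $\tau\in(0,1)$. The error $\varepsilon_i$ has density $f_i$ and distribution function $F_i$. The true coefficient vector is $\beta^*=(\beta_1^{*T},\mathbf 0^T)^T$, where $\beta_1^*\in\mathbf R^s$ has all entries nonzero and $s=s_n=o(n)$. $S$ and $Q$ denote the submatrices of the first $s$ and the last $p-s$ columns of $X$. $H=\operatorname{diag}\{f_1(0),\dots,f_n(0)\}$. Define $V_n=(S^THS)^{-1/2}$ and $Z_n=(Z_{n1},\dots,Z_{nn})^T=SV_n$ with $Z_{nj}\in\mathbf R^s$. For a matrix $A$, $\|A\|_{2,\infty}=\sup_{\mathbf x\ne 0}\|A\mathbf x\|_\infty/\|\mathbf x\|_2$. The sign function is applied componentwise. AR-Lasso. Let $\rho_\tau(u)=u(\tau-1\{u\le 0\})$. The R-Lasso estimator $\hat\beta^{\mathrm{ini}}$ is a minimizer of $\sum_{i=1}^n\rho_\tau(y_i-\mathbf x_i^T\beta)+n\lambda\|\beta\|_1$ (for its own regularization parameter $\lambda$). The SCAD penalty with parameter $a>2$ has derivative, for $\beta\ge 0$, $$p'_{\lambda_n}(\beta)=1\{\beta\le\lambda_n\}+\frac{(a\lambda_n-\beta)_+}{(a-1)\lambda_n}1\{\beta>\lambda_n\}.$$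 The stochastic weights are $\hat d_j=p'_{\lambda_n}(|\hat\beta_j^{\mathrm{ini}}|)$, $j=1,\dots,p$, and $$\widehat L_n(\beta)=\sum_{i=1}^n\rho_\tau(y_i-\mathbf x_i^T\beta)+n\lambda_n\sum_{j=1}^p\hat d_j|\beta_j|.$$ Condition 1: there exist universal constants $c_1,c_2>0$ such that for any $u$ with $|u|\le c_1$, the $f_i(u)$ are uniformly (in $i$) bounded away from $0$ and $\infty$ and $|F_i(u)-F_i(0)-uf_i(0)|\le c_2u^2$. Condition 2: the eigenvalues of $\frac1n S^THS$ are bounded from below and above by positive constants $c_0$ and $1/c_0$, respectively, and $\kappa_n:=\max_{i,j}|x_{ij}|=o(\sqrt n\,s^{-1})$. *)

(* Defs.v *)
From HB Require Import structures.
From mathcomp Require Import all_boot all_order all_algebra.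
From mathcomp Require Import all_classical all_reals all_analysis.

Set Implicit Arguments.
Unset Strict Implicit.
Unset Printing Implicit Defensive.
Import Order.TTheory GRing.Theory Num.Theory.
Import numFieldNormedType.Exports.
Local Open Scope classical_set_scope.
Local Open Scope ring_scope.

Definition norm2 (R : realType) (m : nat) (v : 'cV[R]_m) : R :=
  Num.sqrt (\sum_(i < m) v i 0 ^+ 2).

Definition norm_inf (R : realType) (m : nat) (v : 'cV[R]_m) : R :=
  \big[Num.max/0]_(i < m) `|v i 0|.

Definition norm2inf (R : realType) (m k : nat) (A : 'M[R]_(m, k)) : R :=
  sup [set r | exists2 x : 'cV[R]_k, x != 0 & r = norm_inf (A *m x) / norm2 x].

Definition max_entry (R : realType) (m k : nat) (A : 'M[R]_(m, k)) : R :=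
  \big[Num.max/0]_(i < m) \big[Num.max/0]_(j < k) `|A i j|.

Definition is_psd (R : realType) (m : nat) (B : 'M[R]_m) : Prop :=
  B^T = B /\ forall x : 'cV[R]_m, 0 <= (x^T *m B *m x) 0 0.

(* The positive semidefinite square root; 0 when A has none. *)
Definition sqrtmx (R : realType) (m : nat) (A : 'M[R]_m) : 'M[R]_m :=
  xget 0 [set B | is_psd B /\ B *m B = A].

Definition invsqrtmx (R : realType) (m : nat) (A : 'M[R]_m) : 'M[R]_m :=
  invmx (sqrtmx A).

(* The design matrix has s + q = p columns: S (signal) is [lsubmx X] and
   Q (noise) is [rsubmx X]; likewise beta_1 is [usubmx b], beta_2 is [dsubmx b]. *)
Definition Hmx (R : realType) (n : nat) (f : 'I_n -> R -> R) : 'M[R]_n :=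
  diag_mx (\row_i f i 0).

Definition SHS (R : realType) (n s q : nat) (X : 'M[R]_(n, s + q))
    (f : 'I_n -> R -> R) : 'M[R]_s :=
  (lsubmx X)^T *m Hmx f *m lsubmx X.

Definition QHS (R : realType) (n s q : nat) (X : 'M[R]_(n, s + q))
    (f : 'I_n -> R -> R) : 'M[R]_(q, s) :=
  (rsubmx X)^T *m Hmx f *m lsubmx X.

Definition Vmx (R : realType) (n s q : nat) (X : 'M[R]_(n, s + q))
    (f : 'I_n -> R -> R) : 'M[R]_s :=
  invsqrtmx (SHS X f).

Definition Zmx (R : realType) (n s q : nat) (X : 'M[R]_(n, s + q))
    (f : 'I_n -> R -> R) : 'M[R]_(n, s) :=
  lsubmx X *m Vmx X f.

(* The rate max_fZ = o(s^(-7/2) (log s)^(-1)) is to be stated as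
   max_fZ * s^(7/2) * log s --> 0: at s = 1 the bound is +oo, whereas
   (ln 1)^-1 = 0 here. *)
Definition max_fZ (R : realType) (n s q : nat) (X : 'M[R]_(n, s + q))
    (f : 'I_n -> R -> R) : R :=
  \big[Num.max/0]_(i < n) (Num.sqrt (f i 0) * norm2 (row i (Zmx X f))^T).

Definition rho (R : realType) (tau u : R) : R := u * (tau - (u <= 0)%R%:R).

Definition check_loss (R : realType) (n p : nat) (tau : R) (X : 'M[R]_(n, p))
    (y : 'cV[R]_n) (b : 'cV[R]_p) : R :=
  \sum_(i < n) rho tau ((y - X *m b) i 0).

Definition rlasso_obj (R : realType) (n p : nat) (tau : R) (X : 'M[R]_(n, p))
    (y : 'cV[R]_n) (lam : R) (b : 'cV[R]_p) : R :=
  check_loss tau X y b + n%:R * lam * \sum_(j < p) `|b j 0|.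

Definition arlasso_obj (R : realType) (n p : nat) (tau : R) (X : 'M[R]_(n, p))
    (y : 'cV[R]_n) (lam : R) (dhat : 'cV[R]_p) (b : 'cV[R]_p) : R :=
  check_loss tau X y b + n%:R * lam * \sum_(j < p) dhat j 0 * `|b j 0|.

Definition scad_deriv (R : realType) (a lam b : R) : R :=
  (b <= lam)%R%:R + Num.max (a * lam - b) 0 / ((a - 1) * lam) * (lam < b)%R%:R.

Definition scad_weights (R : realType) (p : nat) (a lam : R) (bini : 'cV[R]_p) :
    'cV[R]_p :=
  \col_j scad_deriv a lam `|bini j 0|.

Definition global_minimizer (R : realType) (p : nat) (L : 'cV[R]_p -> R)
    (b : 'cV[R]_p) : Prop :=
  forall b' : 'cV[R]_p, L b <= L b'.

Definition response (R : realType) (n p : nat) (T : Type) (X : 'M[R]_(n, p))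
    (b : 'cV[R]_p) (eps : 'I_n -> T -> R) (w : T) : 'cV[R]_n :=
  X *m b + \col_i eps i w.

Definition measurable_vector (d : measure_display) (T : measurableType d)
    (R : realType) (p : nat) (b : T -> 'cV[R]_p) : Prop :=
  forall j : 'I_p, measurable_fun [set: T] (fun w => b w j 0).

Definition mutually_independent (d : measure_display) (T : measurableType d)
    (R : realType) (P : probability T R) (I : finType)
    (X : I -> {RV P >-> R}) : Prop :=
  forall (J : {set I}) (B : I -> set R), (forall i, measurable (B i)) ->
    P (\bigcap_(i in [set` J]) (X i @^-1` B i)) =
    (\prod_(i in J) P (X i @^-1` B i))%E.

Definition has_density (d : measure_display) (T : measurableType d)
    (R : realType) (P : probability T R) (X : {RV P >-> R}) (f : R -> R) : Prop :=
  [/\ measurable_fun [set: R] f, (forall x, 0 <= f x) &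
    forall A : set R, measurable A ->
      distribution P X A = (\int[lebesgue_measure]_(x in A) (f x)%:E)%E].

Definition distr_fun (d : measure_display) (T : measurableType d)
    (R : realType) (P : probability T R) (X : {RV P >-> R}) (u : R) : R :=
  fine (cdf X u).

(* The events E n are not required to be measurable: it is enough that they
   contain measurable events of probability tending to one. *)
Definition with_prob_to_one (R : realType) (d : nat -> measure_display)
    (T : forall n, measurableType (d n)) (P : forall n, probability (T n) R)
    (E : forall n, set (T n)) : Prop :=
  exists A : forall n, set (T n),
    [/\ (forall n, measurable (A n)), (forall n, A n `<=` E n) &
      P n (A n) @[n --> \oo] --> 1%E].

Definition cvg_in_distribution (R : realType) (d : nat -> measure_display)
    (T : forall n, measurableType (d n)) (P : forall n, probability (T n) R)
    (Y : forall n, T n -> R) (mu : set R -> \bar R) : Prop :=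
  (forall n, measurable_fun [set: T n] (Y n)) /\
  forall x : R, {for x, continuous (fun t : R => mu `]-oo, t]%classic)} ->
    P n [set w | Y n w <= x] @[n --> \oo] --> mu `]-oo, x]%classic.

(* "Universal" constants: they depend neither on i nor on n. *)
Definition condition1 (R : realType) (f F : forall n, 'I_n -> R -> R) : Prop :=
  exists c1 c2 : R, [/\ 0 < c1, 0 < c2,
    (exists m M : R, 0 < m /\ forall n (i : 'I_n) (u : R),
       `|u| <= c1 -> m <= f n i u <= M) &
    forall n (i : 'I_n) (u : R), `|u| <= c1 ->
      `|F n i u - F n i 0 - u * f n i 0| <= c2 * u ^+ 2].

Definition condition2 (R : realType) (s q : nat -> nat)
    (X : forall n, 'M[R]_(n, s n + q n)) (f : forall n, 'I_n -> R -> R) : Prop :=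
  (exists c0 : R, 0 < c0 /\ \forall n \near \oo, forall a : R,
     eigenvalue (n%:R^-1 *: SHS (X n) (f n)) a -> c0 <= a <= c0^-1) /\
  (fun n => max_entry (X n)) =o_\oo (fun n => Num.sqrt n%:R / (s n)%:R : R).

(* Main.v *)
(** Idea. When the initial estimator is within [lam] of the truth, the SCAD
    weights are 0 on the signal and 1 on the noise coordinates. Restricted to
    [beta_2 = 0] the objective is then the plain check loss, and its minimizer,
    the oracle estimator, is the candidate. Knight's identity splits an increment
    of the loss into a linear term and a remainder. Symmetrization and contraction
    control both uniformly on a ball of radius of order [sqrt (s / n)], also after
    a small step along any noise column. This confines the oracle estimator to the
    ball, shows by convexity that it minimizes the objective over all of [R^p],
    and compares it with the minimizer of a quadratic form, which is linear in the
    indicators of [eps_i <= 0]. The resulting weighted sum of centred Bernoulli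
    variables is asymptotically normal by Lindeberg's replacement argument. *)

(* Two numbers carry the quantitative content: [K], the radius of the ball in units of
   [sqrt (s / n)], and [b], a bound on the entries of [S x] over the ball of twice that radius. On
   the sphere the curvature grows like [K ^+ 2 * s] and the fluctuations like [K * s], so a large
   constant [K] makes failure unlikely; it depends on the tolerated probability, while the estimator
   does not. The remainder only feels errors of size [O(b)], so it fluctuates by [s * sqrt b]. A
   constant [b] suffices for the rate; for normality [b] has to be a small multiple of [s ^- 2],
   which the condition on [max_fZ] provides when [s > 1]. The factor [log log n] lets [lam] exceed
   [sqrt (s log p / n)] by any constant factor: this brings the initial estimator within [lam] of
   the truth and makes the fluctuation along all noise columns, of order [sqrt (n log p)] per unit
   step, negligible against [n * lam]. Suprema over balls need not be measurable, so each uniform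
   bound takes the form of a measurable event with an explicit lower bound on its probability. *)
Require Import Defs.
From HB Require Import structures.
From mathcomp Require Import all_boot all_order all_algebra.
From mathcomp Require Import all_classical all_reals all_analysis.
From mathcomp Require Import measurable_realfun.
From mathcomp Require Import ring lra.
From mathcomp Require Import spectral sesquilinear.
From mathcomp.real_closed Require Import complex.
Set Implicit Arguments.
Unset Strict Implicit.
Unset Printing Implicit Defensive.
Import Order.TTheory GRing.Theory Num.Theory.
Import numFieldNormedType.Exports.
Local Open Scope classical_set_scope.
Local Open Scope ring_scope.

(** * Euclidean norms *)

Lemma le_of_eq (d : Order.disp_t) (T : porderType d) (x y : T) : x = y -> (x <= y)%O.
Proof. by move=> ->. Qed.

(** Lagrange's identity: the double sum of squares is twice the difference of the two sides. *)
Lemma CauchySchwarz_sum (R : realType) (I : finType) (a b : I -> R) :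
  (\sum_i a i * b i) ^+ 2 <= (\sum_i a i ^+ 2) * (\sum_i b i ^+ 2).
Proof.
have : 0 <= \sum_i \sum_j (a i * b j - a j * b i) ^+ 2.
  by apply: sumr_ge0 => i _; apply: sumr_ge0 => j _; exact: sqr_ge0.
rewrite (eq_bigr (fun i => (a i ^+ 2 * (\sum_j b j ^+ 2) +
  b i ^+ 2 * (\sum_j a j ^+ 2)) - 2 * (a i * b i) * (\sum_j a j * b j))); last first.
  move=> i _; rewrite !mulr_sumr -big_split -sumrB /=.
  by apply: eq_bigr => j _; ring.
rewrite sumrB big_split /= -!mulr_suml -mulr_sumr; nra.
Qed.

Section Norm2.
Variable R : realType.

Lemma norm2_ge0 m (v : 'cV[R]_m) : 0 <= norm2 v.
Proof. exact: sqrtr_ge0. Qed.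

Lemma norm2_sqr m (v : 'cV[R]_m) : norm2 v ^+ 2 = \sum_i v i 0 ^+ 2.
Proof. by rewrite sqr_sqrtr // sumr_ge0 // => i _; exact: sqr_ge0. Qed.

Lemma norm2_le m (v : 'cV[R]_m) (c : R) : 0 <= c ->
  \sum_i v i 0 ^+ 2 <= c ^+ 2 -> norm2 v <= c.
Proof.
by move=> c0 h; rewrite -(ler_pXn2r (n := 2)) ?nnegrE ?norm2_ge0 // norm2_sqr.
Qed.

Lemma dot_le m (u v : 'cV[R]_m) :
  `|\sum_i u i 0 * v i 0| <= norm2 u * norm2 v.
Proof.
rewrite -(ler_pXn2r (n := 2)) ?nnegrE ?mulr_ge0 ?norm2_ge0 //.
by rewrite real_normK ?num_real // exprMn !norm2_sqr CauchySchwarz_sum.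
Qed.

Lemma dotE m (u v : 'cV[R]_m) : (u^T *m v) 0 0 = \sum_i u i 0 * v i 0.
Proof. by rewrite mxE; apply: eq_bigr => i _; rewrite mxE. Qed.

Lemma dot_sqr m (u : 'cV[R]_m) : (u^T *m u) 0 0 = norm2 u ^+ 2.
Proof. by rewrite dotE norm2_sqr; apply: eq_bigr => i _; rewrite expr2. Qed.

Lemma dotmx_le m (u v : 'cV[R]_m) : `|(u^T *m v) 0 0| <= norm2 u * norm2 v.
Proof. by rewrite dotE dot_le. Qed.

Lemma norm2D m (u v : 'cV[R]_m) : norm2 (u + v) <= norm2 u + norm2 v.
Proof.
apply: norm2_le; first by rewrite addr_ge0 ?norm2_ge0.
rewrite (eq_bigr (fun i => u i 0 ^+ 2 + v i 0 ^+ 2 + 2 * (u i 0 * v i 0))); last first.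
  by move=> i _; rewrite mxE; ring.
rewrite !big_split /= -mulr_sumr -!norm2_sqr.
have := le_trans (ler_norm _) (dot_le u v); nra.
Qed.

Lemma norm2Z m (c : R) (u : 'cV[R]_m) : norm2 (c *: u) = `|c| * norm2 u.
Proof.
rewrite /norm2 (eq_bigr (fun i => c ^+ 2 * u i 0 ^+ 2)).
  by rewrite -mulr_sumr sqrtrM ?sqr_ge0 // sqrtr_sqr.
by move=> i _; rewrite mxE exprMn.
Qed.

Lemma norm20 m : norm2 (0 : 'cV[R]_m) = 0.
Proof. by rewrite -(scale0r (0 : 'cV[R]_m)) norm2Z normr0 mul0r. Qed.

Lemma norm2_eq0 m (v : 'cV[R]_m) : norm2 v = 0 -> v = 0.
Proof.
move=> v0; have /eqP : \sum_i v i 0 ^+ 2 = 0 by rewrite -norm2_sqr v0 expr0n.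
rewrite psumr_eq0 => [/allP h|i _]; last exact: sqr_ge0.
apply/matrixP => i j; rewrite ord1 mxE; apply/eqP.
by rewrite -sqrf_eq0 (eqP (h i _)) // mem_index_enum.
Qed.

Lemma norm2_gt0 m (v : 'cV[R]_m) : v != 0 -> 0 < norm2 v.
Proof.
move=> v0; rewrite lt_neqAle norm2_ge0 andbT eq_sym.
by apply: contra v0 => /eqP /norm2_eq0 ->.
Qed.

Lemma entry_le_norm2 m (v : 'cV[R]_m) i : `|v i 0| <= norm2 v.
Proof.
rewrite -(ler_pXn2r (n := 2)) ?nnegrE ?norm2_ge0 // norm2_sqr.
rewrite real_normK ?num_real // (bigD1 i) //= lerDl.
by apply: sumr_ge0 => j _; exact: sqr_ge0.
Qed.

Lemma norm2_entries_le m (v : 'cV[R]_m) (c : R) : 0 <= c ->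
  (forall i, `|v i 0| <= c) -> norm2 v <= Num.sqrt m%:R * c.
Proof.
move=> c0 h; apply: norm2_le; first by rewrite mulr_ge0 ?sqrtr_ge0.
rewrite exprMn sqr_sqrtr // mulr_natl -[X in c ^+ 2 *+ X]card_ord -sumr_const.
by apply: ler_sum => i _; rewrite -real_normK ?num_real // lerXn2r ?nnegrE.
Qed.

Lemma mulmx_row_le n s (S : 'M[R]_(n, s)) (x : 'cV[R]_s) i :
  `|(S *m x) i 0| <= norm2 (row i S)^T * norm2 x.
Proof.
rewrite mxE (eq_bigr (fun j => (row i S)^T j 0 * x j 0)) ?dot_le //.
by move=> j _; rewrite !mxE.
Qed.

Lemma sum_norm2_rows n s (S : 'M[R]_(n, s)) :
  \sum_i norm2 (row i S)^T ^+ 2 = \sum_j norm2 (col j S) ^+ 2.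
Proof.
under eq_bigr do rewrite norm2_sqr.
rewrite exchange_big; apply: eq_bigr => j _.
by rewrite norm2_sqr; apply: eq_bigr => i _; rewrite !mxE.
Qed.

End Norm2.

(** * Finite product spaces and symmetrization *)

Definition pw (R : realType) (I G : finType) (p : I -> G -> R)
  (x : {ffun I -> G}) : R := \prod_i p i (x i).

Definition Ex (R : realType) (I G : finType) (p : I -> G -> R)
  (F : {ffun I -> G} -> R) : R := \sum_x pw p x * F x.

Definition is_pmf (R : realType) (I G : finType) (p : I -> G -> R) : Prop :=
  (forall i g, 0 <= p i g) /\ forall i, \sum_g p i g = 1.

(** The fold starts at [F t0] instead of 0, so the maximum is exact for functions of any sign. *)
Definition maxf (R : realType) (T : finType) (t0 : T) (F : T -> R) : R :=
  \big[Num.max/F t0]_t F t.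

Section MaxF.
Variables (R : realType) (T : finType) (t0 : T).
Implicit Types (F : T -> R).

Lemma le_maxf F t : F t <= maxf t0 F.
Proof. exact: le_bigmax. Qed.

Lemma maxf_le F c : (forall t, F t <= c) -> maxf t0 F <= c.
Proof. by move=> h; apply: bigmax_le => // t _; exact: h. Qed.

Lemma maxf_ex F : exists t, maxf t0 F = F t.
Proof.
rewrite /maxf; apply: (big_ind (fun z => exists t, z = F t)).
- by exists t0.
- by move=> x y [t ->] [u ->]; case: (leP (F t) (F u)) => _; [exists u|exists t].
- by move=> t _; exists t.
Qed.

Lemma le_maxf2 F F' : (forall t, F t <= F' t) -> maxf t0 F <= maxf t0 F'.
Proof. by move=> h; apply: maxf_le => t; apply: le_trans (h t) (le_maxf _ _). Qed.

Lemma eq_maxf F F' : F =1 F' -> maxf t0 F = maxf t0 F'.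
Proof. by move=> h; rewrite /maxf h; apply: eq_bigr. Qed.

Lemma maxfD F F' : maxf t0 (fun t => F t + F' t) <= maxf t0 F + maxf t0 F'.
Proof. by apply: maxf_le => t; apply: lerD; exact: le_maxf. Qed.

(** Contraction for a single sign. At maximizers [t] and [u] of the two left-hand terms, [h t - h u]
    is at most [l t - l u] or [l u - l t]; in the second case the right-hand maxima are tested at
    [u] and [t] with exchanged roles. *)
Lemma contraction1 (A h l : T -> R) :
  (forall t u, `|h t - h u| <= `|l t - l u|) ->
  maxf t0 (fun t => A t + h t) + maxf t0 (fun t => A t - h t) <=
  maxf t0 (fun t => A t + l t) + maxf t0 (fun t => A t - l t).
Proof.
move=> hl.
have [t ->] := maxf_ex (fun t => A t + h t).
have [u ->] := maxf_ex (fun t => A t - h t).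
set M1 := maxf _ _; set M2 := maxf _ _.
have P1 v : A v + l v <= M1 := le_maxf (fun t => A t + l t) v.
have P2 v : A v - l v <= M2 := le_maxf (fun t => A t - l t) v.
have h3 := le_trans (ler_norm _) (hl t u).
have p1 := P1 t; have p2 := P1 u; have p3 := P2 t; have p4 := P2 u.
have [q|q] := lerP 0 (l t - l u).
  by rewrite ger0_norm // in h3; lra.
by rewrite ltr0_norm // in h3; lra.
Qed.

End MaxF.

Section FinProb.
Variables (R : realType) (I G : finType) (p : I -> G -> R).
Hypothesis pp : is_pmf p.
Implicit Types (F : {ffun I -> G} -> R).

Let p0 i g : 0 <= p i g. Proof. exact: pp.1. Qed.

Lemma pw_ge0 x : 0 <= pw p x.
Proof. by apply: prodr_ge0 => i _; exact: p0. Qed.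

Lemma Ex_prod (f : I -> G -> R) :
  Ex p (fun x => \prod_i f i (x i)) = \prod_i \sum_g p i g * f i g.
Proof.
rewrite /Ex /pw bigA_distr_bigA /=; apply: eq_bigr => x _.
by rewrite -big_split.
Qed.

Lemma Ex_cst c : Ex p (fun=> c) = c.
Proof.
rewrite /Ex -big_distrl /= /pw.
have <- : \prod_i \sum_g p i g = \sum_(x : {ffun I -> G}) \prod_i p i (x i).
  by rewrite bigA_distr_bigA.
by rewrite big1 ?mul1r // => i _; exact: pp.2.
Qed.

Lemma eq_Ex F F' : F =1 F' -> Ex p F = Ex p F'.
Proof. by move=> h; apply: eq_bigr => x _; rewrite h. Qed.

Lemma le_Ex F F' : (forall x, F x <= F' x) -> Ex p F <= Ex p F'.
Proof. by move=> h; apply: ler_sum => x _; rewrite ler_wpM2l ?pw_ge0. Qed.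

Lemma Ex_ge0 F : (forall x, 0 <= F x) -> 0 <= Ex p F.
Proof. by move=> h; apply: sumr_ge0 => x _; rewrite mulr_ge0 ?pw_ge0. Qed.

Lemma ExD F F' : Ex p (fun x => F x + F' x) = Ex p F + Ex p F'.
Proof. by rewrite /Ex -big_split; apply: eq_bigr => x _; rewrite mulrDr. Qed.

Lemma ExZ c F : Ex p (fun x => c * F x) = c * Ex p F.
Proof. by rewrite /Ex big_distrr; apply: eq_bigr => x _; rewrite mulrCA. Qed.

Lemma ExN F : Ex p (fun x => - F x) = - Ex p F.
Proof. by rewrite -mulN1r -ExZ; apply: eq_Ex => x; rewrite mulN1r. Qed.

Lemma ExB F F' : Ex p (fun x => F x - F' x) = Ex p F - Ex p F'.
Proof. by rewrite ExD ExN. Qed.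

Lemma Ex_sum (J : Type) (s : seq J) (P : pred J) (F : J -> {ffun I -> G} -> R) :
  Ex p (fun x => \sum_(j <- s | P j) F j x) = \sum_(j <- s | P j) Ex p (F j).
Proof.
rewrite /Ex exchange_big; apply: eq_bigr => x _.
by rewrite big_distrr.
Qed.

Lemma Ex_coord i (f : G -> R) : Ex p (fun x => f (x i)) = \sum_g p i g * f g.
Proof.
have := Ex_prod (fun j g => if j == i then f g else 1).
rewrite (bigD1 i) //= eqxx [X in _ * X]big1 => [|j /negbTE ->]; last first.
  by under eq_bigr do rewrite mulr1; exact: pp.2.
rewrite mulr1 => <-; apply: eq_Ex => x.
by rewrite (bigD1 i) //= eqxx big1 ?mulr1 // => j /negbTE ->.
Qed.

Lemma Ex_coord2 i j (f h : G -> R) : i != j ->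
  Ex p (fun x => f (x i) * h (x j)) =
  (\sum_g p i g * f g) * (\sum_g p j g * h g).
Proof.
move=> ij; have ji : (j == i) = false by rewrite eq_sym (negbTE ij).
have := Ex_prod (fun k g => if k == i then f g else if k == j then h g else 1).
rewrite (bigD1 i) //= eqxx (bigD1 j) ?eqxx ?ji //= ?(negbTE ij) ?ji //.
rewrite [\prod_(_ | _) _]big1 => [|k /andP[/negbTE -> /negbTE ->]]; last first.
  by under eq_bigr do rewrite mulr1; exact: pp.2.
rewrite mulr1 => <-; apply: eq_Ex => x.
rewrite (bigD1 i) //= eqxx (bigD1 j) ?ji //= eqxx big1 ?mulr1 //.
by move=> k /andP[/negbTE -> /negbTE ->].
Qed.

Lemma Ex_sqr F : Ex p F ^+ 2 <= Ex p (fun x => F x ^+ 2).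
Proof.
have : 0 <= Ex p (fun x => (F x - Ex p F) ^+ 2).
  by apply: Ex_ge0 => x; exact: sqr_ge0.
rewrite (eq_Ex (_ : _ =1 fun x => F x ^+ 2 + (- (2 * Ex p F) * F x + Ex p F ^+ 2))); last first.
  by move=> x; ring.
by rewrite ExD ExD ExZ Ex_cst; lra.
Qed.

Lemma Ex_sqrt F : (forall x, 0 <= F x) ->
  Ex p (fun x => Num.sqrt (F x)) <= Num.sqrt (Ex p F).
Proof.
move=> F0; rewrite -(ler_pXn2r (n := 2)) ?nnegrE ?sqrtr_ge0 ?Ex_ge0 //.
apply: le_trans (Ex_sqr _) _; rewrite sqr_sqrtr ?Ex_ge0 //.
by apply: le_Ex => x; rewrite sqr_sqrtr.
Qed.

(** Jensen's inequality, from the tangent of the exponential at the mean. *)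
Lemma Ex_expR F : expR (Ex p F) <= Ex p (fun x => expR (F x)).
Proof.
set m := Ex p F.
apply: (@le_trans _ _ (Ex p (fun x => expR m * (1 + (F x - m))))).
  by rewrite ExZ ExD ExD !Ex_cst subrr addr0 mulr1.
apply: le_Ex => x.
rewrite -[X in _ <= expR X](subrKC m) expRD.
rewrite ler_wpM2l ?expR_ge0 //.
exact: expR_ge1Dx.
Qed.

Lemma Ex_markov F t : 0 < t -> (forall x, 0 <= F x) ->
  Ex p (fun x => (t <= F x)%R%:R) <= Ex p F / t.
Proof.
move=> t0 F0; rewrite mulrC -ExZ; apply: le_Ex => x.
have [h|_] := lerP t (F x); last by rewrite mulr_ge0 ?invr_ge0 ?(ltW t0) // F0.
by rewrite mulrC ler_pdivlMr // mul1r.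
Qed.

Lemma maxf_Ex (T : finType) (t0 : T) (F : T -> {ffun I -> G} -> R) :
  maxf t0 (fun t => Ex p (F t)) <= Ex p (fun x => maxf t0 (F^~ x)).
Proof. by apply: maxf_le => t; apply: le_Ex => x; exact: (le_maxf _ (F^~ x)). Qed.

End FinProb.

Definition rade (R : realType) (I : finType) : I -> bool -> R := fun _ _ => 2^-1.

Lemma rade_pmf (R : realType) (I : finType) : is_pmf (@rade R I).
Proof.
split=> [i g|i]; first by rewrite invr_ge0.
by rewrite big_bool /rade /=; field.
Qed.

Definition mixf (I G : finType) (e : {ffun I -> bool}) (x y : {ffun I -> G}) :
  {ffun I -> G} := [ffun i => if e i then y i else x i].

Section Symmetrization.
Variables (R : realType) (I G : finType) (p : I -> G -> R).
Hypothesis pp : is_pmf p.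
Local Notation Er := (Ex (@rade R I)).
Local Notation sg e i := ((-1) ^+ (e i : bool) : R).

(** Exchanging two independent copies on a set of coordinates is an involution that preserves the
    product weight. *)
Lemma Ex_swap (F : {ffun I -> G} -> {ffun I -> G} -> R) e :
  Ex p (fun x => Ex p (fun y => F (mixf e x y) (mixf e y x))) =
  Ex p (fun x => Ex p (fun y => F x y)).
Proof.
have dbl (H : {ffun I -> G} -> {ffun I -> G} -> R) :
    Ex p (fun x => Ex p (fun y => H x y)) =
    \sum_(z : {ffun I -> G} * {ffun I -> G}) pw p z.1 * pw p z.2 * H z.1 z.2.
  rewrite /Ex; under eq_bigr do rewrite big_distrr /=.
  by rewrite pair_bigA; apply: eq_bigr => z _; rewrite mulrA.
rewrite !dbl.
pose h (z : {ffun I -> G} * {ffun I -> G}) := (mixf e z.1 z.2, mixf e z.2 z.1).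
have hK : involutive h.
  move=> [x y]; rewrite /h /=; congr pair; apply/ffunP => i; rewrite !ffunE;
  by case: (e i).
rewrite [RHS](reindex_inj (inv_inj hK)); apply: eq_bigr => z _ /=.
congr (_ * _); rewrite /pw -!big_split; apply: eq_bigr => i _ /=.
by rewrite !ffunE; case: (e i); rewrite // mulrC.
Qed.

Lemma Er_flip (F : {ffun I -> bool} -> R) (A : pred I) :
  Er F = Er (fun e => F [ffun i => e i (+) A i]).
Proof.
rewrite /Ex.
pose h (e : {ffun I -> bool}) := [ffun i => e i (+) A i].
have hK : involutive h.
  by move=> e; apply/ffunP => i; rewrite !ffunE -addbA addbb addbF.
rewrite [LHS](reindex_inj (inv_inj hK)); apply: eq_bigr => e _ /=.
by congr (_ * _); apply: eq_bigr.
Qed.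

(** The means are replaced by an independent copy [y], with the maximum moved inside its
    expectation. Random exchanges of [x] and [y] leave the law unchanged and introduce the signs;
    the factor 2 arises because the copy contributes the same Rademacher average, with all signs
    flipped. *)
Lemma symmetrization (T : finType) (t0 : T) (phi : I -> G -> T -> R) :
  Ex p (fun x => maxf t0 (fun t =>
     \sum_i (phi i (x i) t - \sum_g p i g * phi i g t))) <=
  2 * Ex p (fun x => Er (fun e => maxf t0 (fun t =>
     \sum_i sg e i * phi i (x i) t))).
Proof.
pose H (x y : {ffun I -> G}) := maxf t0 (fun t => \sum_i (phi i (x i) t - phi i (y i) t)).
have step1 : Ex p (fun x => maxf t0 (fun t =>
     \sum_i (phi i (x i) t - \sum_g p i g * phi i g t))) <=
     Ex p (fun x => Ex p (fun y => H x y)).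
  apply: le_Ex => // x; apply: le_trans (maxf_Ex pp _ _).
  apply: le_maxf2 => t; rewrite Ex_sum; apply: ler_sum => i _.
  by rewrite ExB // Ex_cst // (Ex_coord pp i (fun g => phi i g t)).
apply: (le_trans step1).
have -> : Ex p (fun x => Ex p (fun y => H x y)) =
    Er (fun e => Ex p (fun x => Ex p (fun y => H (mixf e x y) (mixf e y x)))).
  rewrite -[LHS](Ex_cst (@rade_pmf R I)); apply: eq_Ex => e.
  by rewrite Ex_swap.
pose K (e : {ffun I -> bool}) (x : {ffun I -> G}) := maxf t0 (fun t => \sum_i sg e i * phi i (x i) t).
have split1 e x y : H (mixf e x y) (mixf e y x) <=
    K e x + K [ffun i => e i (+) true] y.
  rewrite /K; apply: le_trans (maxfD _ _ _); apply: le_maxf2 => t.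
  rewrite -big_split; apply: ler_sum => i _ /=; rewrite !ffunE.
  by case: (e i) => /=; rewrite ?expr0 ?expr1; lra.
have exch F : Ex p (fun x => Er (fun e => F e x)) = Er (fun e => Ex p (F e)).
  rewrite /Ex; under eq_bigr do rewrite big_distrr /=.
  rewrite exchange_big; apply: eq_bigr => e _; rewrite big_distrr /=.
  by apply: eq_bigr => x _; rewrite mulrCA.
rewrite exch -[2]/(1 + 1) mulrDl !mul1r.
rewrite [X in _ <= _ + X](Er_flip _ predT) -ExD.
apply: (le_Ex (@rade_pmf _ _)) => e.
apply: (@le_trans _ _ (Ex p (fun x => K e x + Ex p (K [ffun i => e i (+) true])))).
  apply: (le_Ex pp) => x; rewrite -[X in _ <= X + _](Ex_cst pp) -ExD.
  by apply: (le_Ex pp) => y.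
by rewrite ExD (Ex_cst pp).
Qed.

(** Indices are switched from [h] to [l] one at a time: [X s] uses [l] on the list [s] and [h]
    elsewhere. Pairing every sign vector with the one that differs from it only at [j] reduces a
    switch to [contraction1]. *)
Lemma contraction (T : finType) (t0 : T) (h l : I -> T -> R) :
  (forall i t u, `|h i t - h i u| <= `|l i t - l i u|) ->
  Er (fun e => maxf t0 (fun t => \sum_i sg e i * h i t)) <=
  Er (fun e => maxf t0 (fun t => \sum_i sg e i * l i t)).
Proof.
move=> hl.
pose X (s : seq I) i t := if i \in s then l i t else h i t.
suff S s : Er (fun e => maxf t0 (fun t => \sum_i sg e i * h i t)) <=
  Er (fun e => maxf t0 (fun t => \sum_i sg e i * X s i t)).
  apply: le_trans (S (enum I)) _; apply: le_of_eq.
  apply: eq_Ex => e; apply: eq_maxf => t; apply: eq_bigr => i _.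
  by rewrite /X mem_enum.
elim: s => [|j s IH]; first by [].
apply: le_trans IH _.
have [js|js] := boolP (j \in s).
  apply: le_of_eq.
  apply: eq_Ex => e; apply: eq_maxf => t; apply: eq_bigr => i _.
  by rewrite /X inE; case: eqP => //= ->; rewrite js.
pose A (e : {ffun I -> bool}) t := \sum_(i | i != j) sg e i * X s i t.
pose ej (e : {ffun I -> bool}) := [ffun i => e i (+) (pred1 j) i].
have Aj e t : A (ej e) t = A e t.
  by apply: eq_bigr => i ij; rewrite ffunE /= (negbTE ij) addbF.
have spl (Y : I -> T -> R) : (forall i t, i != j -> Y i t = X s i t) ->
   2 * Er (fun e => maxf t0 (fun t => \sum_i sg e i * Y i t)) =
   Er (fun e => maxf t0 (fun t => A e t + Y j t) + maxf t0 (fun t => A e t - Y j t)).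
  move=> YX.
  have eqA (e : {ffun I -> bool}) t : \sum_i sg e i * Y i t = A e t + sg e j * Y j t.
    rewrite (bigD1 j) //= addrC; congr (_ + _).
    by apply: eq_bigr => i ij; rewrite YX.
  rewrite -[2]/(1 + 1) mulrDl mul1r [X in _ + X](Er_flip _ (pred1 j)) -ExD.
  apply: eq_Ex => e.
  rewrite (eq_maxf _ (eqA e)) (eq_maxf _ (eqA (ej e))).
  under [X in _ + X]eq_maxf do rewrite Aj.
  rewrite ffunE /= eqxx addbT; case: (e j) => /=; last first.
    by congr (_ + _); apply: eq_maxf => t; rewrite ?expr0 ?expr1 ?mul1r ?mulN1r.
  by rewrite addrC; congr (_ + _); apply: eq_maxf => t;
    rewrite ?expr0 ?expr1 ?mul1r ?mulN1r.
rewrite -(ler_pM2l (ltr0Sn _ 1)) spl; last by [].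
rewrite spl => [|i t ij]; last by rewrite /X inE (negbTE ij).
apply: (le_Ex (@rade_pmf _ _)) => e; apply: contraction1 => t u.
by rewrite /X inE eqxx /= (negbTE js).
Qed.

Lemma Er_sqr_sum (w : I -> R) :
  Er (fun e => (\sum_i sg e i * w i) ^+ 2) = \sum_i w i ^+ 2.
Proof.
have pr := @rade_pmf R I.
rewrite (eq_Ex _ (_ : _ =1 fun e : {ffun I -> bool} => \sum_i \sum_j w i * w j * (sg e i * sg e j))); last first.
  move=> e; rewrite expr2 mulr_suml; apply: eq_bigr => i _.
  by rewrite mulr_sumr; apply: eq_bigr => j _; ring.
rewrite Ex_sum; apply: eq_bigr => i _; rewrite Ex_sum (bigD1 i) //= big1 => [|j ji].
  rewrite addr0 ExZ (eq_Ex _ (_ : _ =1 fun=> 1)) ?Ex_cst ?mulr1 ?expr2 //.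
  by move=> e; rewrite -expr2 sqrr_sign.
rewrite ExZ (Ex_coord2 pr (fun b : bool => (-1) ^+ b : R) (fun b : bool => (-1) ^+ b)) 1?eq_sym //.
by rewrite !big_bool /rade /= expr0 expr1 mulrN mulr1 addNr mul0r mulr0.
Qed.

(** Sub-Gaussian bound with the generous constant 2 in place of 1/2. Near 0 it follows from
    [expR y <= (1 - y)^-1], and it passes from [z] to [2 z] because [cosh (2 z) = 2 (cosh z)^2 - 1]
    and [2 c^2 - 1 <= c^4]; the induction on [n] counts the doublings. *)
Lemma cosh_le (x : R) : (expR x + expR (- x)) / 2 <= expR (2 * x ^+ 2).
Proof.
suff H (n : nat) (y : R) : `|y| <= 2 ^+ n / 2 -> (expR y + expR (- y)) / 2 <= expR (2 * y ^+ 2).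
  have [n hn] : exists n : nat, `|x| * 2 <= n%:R.
    by exists (Num.bound (`|x| * 2)); rewrite ltW // archi_boundP // mulr_ge0.
  apply: (H n); rewrite ler_pdivlMr //; apply: le_trans hn _.
  by rewrite -natrX ler_nat ltnW // ltn_expl.
elim: n y => [|n IH] y hy.
  rewrite expr0 mul1r in hy.
  have hy2 : y ^+ 2 <= 2^-1 ^+ 2 by rewrite -real_normK ?num_real // lerXn2r ?nnegrE.
  have /ler_normlP [hy3 hy4] := hy.
  have p1 : 0 < 1 - y by lra.
  have p2 : 0 < 1 + y by lra.
  have e1 : expR y <= (1 - y)^-1.
    rewrite -[X in _ <= X]mul1r ler_pdivlMr //.
    have := expR_ge1Dx (- y); have := expRxMexpNx_1 y; have := expR_gt0 y; nra.
  have e2 : expR (- y) <= (1 + y)^-1.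
    rewrite -[X in _ <= X]mul1r ler_pdivlMr //.
    have := expR_ge1Dx y; have := expRxMexpNx_1 y; have := expR_gt0 (- y); nra.
  apply: (@le_trans _ _ (1 + 2 * y ^+ 2)); last exact: expR_ge1Dx.
  apply: (@le_trans _ _ (((1 - y)^-1 + (1 + y)^-1) / 2)); first by lra.
  have -> : ((1 - y)^-1 + (1 + y)^-1) / 2 = (1 - y ^+ 2)^-1.
    by field; rewrite ?gt_eqF //=; nra.
  rewrite -[X in X <= _]mul1r ler_pdivrMr; nra.
have -> : y = y / 2 + y / 2 by lra.
set z := y / 2.
have /IH : `|z| <= 2 ^+ n / 2.
  by rewrite normrM [X in _ * X]ger0_norm // ler_pM2r // (le_trans hy) // exprS; lra.
rewrite opprD !expRD.
have -> : 2 * (z + z) ^+ 2 = 2 * z ^+ 2 + 2 * z ^+ 2 + (2 * z ^+ 2 + 2 * z ^+ 2) by ring.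
rewrite !expRD.
have := expRxMexpNx_1 z.
have := expR_gt0 z; have := expR_gt0 (- z).
move: (expR z) (expR (- z)) (expR (2 * _)) => a b c hb ha hab habc.
have hs : (a + b) ^+ 2 <= (2 * c) ^+ 2.
  by rewrite lerXn2r ?nnegrE; lra.
have := sqr_ge0 (c ^+ 2 - 1).
rewrite !expr2 in hs *; nra.
Qed.

(** Massart's finite class argument: the exponential of a maximum is at most the sum of the
    exponentials. The parameter [th] stays free here and is balanced once the family [w] is
    known. *)
Lemma rademacher_max (J : finType) (j0 : J) (w : I -> J -> R) (v th : R) :
  0 < th -> (forall j, \sum_i w i j ^+ 2 <= v) ->
  Er (fun e => maxf j0 (fun j => \sum_i sg e i * w i j)) <=
  ln #|J|%:R / th + 2 * th * v.
Proof.
move=> th0 wv; have pr := @rade_pmf R I.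
have J0 : (0 < #|J|)%N by apply/card_gt0P; exists j0.
have J0' : 0 < (#|J|%:R : R) by rewrite ltr0n.
set E := Er _.
suff : expR (th * E) <= #|J|%:R * expR (2 * th ^+ 2 * v).
  have e0 : #|J|%:R = expR (ln #|J|%:R) :> R by rewrite lnK ?posrE.
  rewrite [in X in _ <= X -> _]e0 -expRD ler_expR => h.
  rewrite -(ler_pM2l th0) (le_trans h) // le_eqVlt; apply/orP; left; apply/eqP.
  by field; rewrite gt_eqF.
rewrite -ExZ; apply: le_trans (Ex_expR pr _) _.
apply: (@le_trans _ _ (Er (fun e => \sum_j expR (\sum_i sg e i * (th * w i j))))).
  apply: (le_Ex pr) => e.
  have [j ->] := maxf_ex j0 (fun j => \sum_i sg e i * w i j).
  rewrite (bigD1 j) //= mulr_sumr (eq_bigr (fun i => sg e i * (th * w i j))).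
    by rewrite lerDl sumr_ge0 // => k _; exact: expR_ge0.
  by move=> i _; ring.
rewrite Ex_sum mulr_natl -sumr_const; apply: ler_sum => j _.
rewrite (eq_Ex _ (_ : _ =1 fun e : {ffun I -> bool} =>
    \prod_i expR ((-1) ^+ e i * (th * w i j)))); last by move=> e; rewrite expR_sum.
rewrite (Ex_prod _ (fun i (b : bool) => expR ((-1) ^+ b * (th * w i j)))).
apply: (@le_trans _ _ (\prod_i expR (2 * (th * w i j) ^+ 2))).
  apply: ler_prod => i _; rewrite big_bool /rade /= expr0 expr1 mul1r mulN1r.
  rewrite -mulrDr mulrC addrC cosh_le andbT.
  by rewrite mulr_ge0 ?invr_ge0 ?addr_ge0 ?expR_ge0.
rewrite -expR_sum ler_expR.
under eq_bigr do rewrite exprMn mulrA.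
by rewrite -mulr_sumr ler_wpM2l ?wv // mulr_ge0 ?sqr_ge0.
Qed.

End Symmetrization.

Section SupBound.
Variables (R : realType) (n s : nat) (G : finType) (p : 'I_n -> G -> R).
Hypothesis pp : is_pmf p.
Local Notation Er := (Ex (@rade R 'I_n)).

(** After symmetrization and contraction the process is linear, so its two arguments separate: the
    ball is handled by Cauchy-Schwarz and a second moment, at no cost in the size of [D], and the
    finite family [J] by [rademacher_max]. The Lipschitz factor [xi] survives the contraction, and
    its mean appears under the square root as the gain from localization. *)
Lemma sup_bound (D J : finType) (d0 : D) (j0 : J) (del : D -> 'cV[R]_s)
    (S : 'M[R]_(n, s)) (w : J -> 'I_n -> R) (rad v th : R)
    (xi : 'I_n -> G -> R) (phi : 'I_n -> G -> D * J -> R) :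
  0 <= rad -> (forall t, norm2 (del t) <= rad) ->
  0 < th -> (forall j, \sum_i w j i ^+ 2 <= v) ->
  (forall i g, 0 <= xi i g <= 1) ->
  (forall i g t u, `|phi i g t - phi i g u| <=
     xi i g * `|(S *m del t.1) i 0 + w t.2 i - ((S *m del u.1) i 0 + w u.2 i)|) ->
  Ex p (fun x => maxf (d0, j0) (fun t =>
     \sum_i (phi i (x i) t - \sum_g p i g * phi i g t))) <=
  2 * (rad * Num.sqrt (\sum_i norm2 (row i S)^T ^+ 2 * (\sum_g p i g * xi i g))
       + (ln #|J|%:R / th + 2 * th * v)).
Proof.
move=> rad0 drad th0 wv xi01 lip; have pr := @rade_pmf R 'I_n.
apply: le_trans (symmetrization pp _ _) _.
rewrite ler_pM2l //.
pose q (x : {ffun 'I_n -> G}) : R := \sum_i norm2 (row i S)^T ^+ 2 * xi i (x i).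
have q0 x : 0 <= q x.
  by apply: sumr_ge0 => i _; rewrite mulr_ge0 ?sqr_ge0 // (andP (xi01 _ _)).1.
apply: (@le_trans _ _ (Ex p (fun x => rad * Num.sqrt (q x) + (ln #|J|%:R / th + 2 * th * v)))); last first.
  rewrite ExD (Ex_cst pp) lerD2r ExZ ler_wpM2l //.
  apply: le_trans (Ex_sqrt pp q0) _; rewrite ler_wsqrtr // le_eqVlt; apply/orP; left.
  rewrite /q Ex_sum; apply/eqP; apply: eq_bigr => i _.
  by rewrite ExZ (Ex_coord pp i (xi i)).
apply: (le_Ex pp) => x.
pose a i := xi i (x i).
have a01 i : 0 <= a i <= 1 by exact: xi01.
apply: (@le_trans _ _ (Er (fun e => maxf (d0, j0) (fun t =>
   \sum_i (-1) ^+ (e i : bool) * (a i * ((S *m del t.1) i 0 + w t.2 i)))))).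
  apply: contraction => i t u; rewrite -mulrBr normrM.
  by rewrite (ger0_norm (andP (a01 i)).1); exact: lip.
pose U (e : {ffun 'I_n -> bool}) : 'cV[R]_s :=
  \col_j \sum_i (-1) ^+ (e i : bool) * (a i * S i j).
apply: (@le_trans _ _ (Er (fun e => rad * norm2 (U e) + maxf j0 (fun j =>
   \sum_i (-1) ^+ (e i : bool) * (a i * w j i))))).
  apply: (le_Ex pr) => e; apply: maxf_le => -[t j] /=.
  under eq_bigr do rewrite mulrDr mulrDr.
  rewrite big_split /=; apply: lerD; last first.
    exact: (le_maxf _ (fun j => \sum_i (-1) ^+ (e i : bool) * (a i * w j i))).
  have -> : \sum_i (-1) ^+ (e i : bool) * (a i * (S *m del t) i 0) =
      \sum_k U e k 0 * del t k 0.
    under eq_bigr do rewrite mxE mulr_sumr mulr_sumr.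
    rewrite exchange_big; apply: eq_bigr => k _; rewrite mxE mulr_suml.
    by apply: eq_bigr => i _; ring.
  apply: le_trans (ler_norm _) _; apply: le_trans (dot_le _ _) _.
  by rewrite mulrC ler_wpM2r ?norm2_ge0.
rewrite ExD; apply: lerD; last first.
  apply: (@rademacher_max _ _ _ j0 (fun i j => a i * w j i)) => // j.
  apply: le_trans (wv j); apply: ler_sum => i _; rewrite exprMn.
  by rewrite ler_piMl ?sqr_ge0 // exprn_ile1 ?(andP (a01 i)).1 ?(andP (a01 i)).2.
rewrite ExZ ler_wpM2l //; apply: le_trans (Ex_sqrt pr _) _.
  by move=> e; apply: sumr_ge0 => k _; exact: sqr_ge0.
rewrite ler_wsqrtr // Ex_sum.
have -> : \sum_(i < s) Er (fun e : {ffun 'I_n -> bool} => U e i 0 ^+ 2) =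
   \sum_(k < s) \sum_i (a i * S i k) ^+ 2.
  apply: eq_bigr => k _; rewrite -Er_sqr_sum; apply: eq_Ex => e.
  by rewrite mxE.
rewrite exchange_big /=; apply: ler_sum => i _.
under eq_bigr do rewrite exprMn.
rewrite -mulr_sumr mulrC norm2_sqr.
have -> : \sum_k (row i S)^T k 0 ^+ 2 = \sum_k S i k ^+ 2.
  by apply: eq_bigr => k _; rewrite !mxE.
rewrite ler_wpM2l ?sumr_ge0 // => [k _|]; first exact: sqr_ge0.
by rewrite expr2 ler_piMr ?(andP (a01 i)).1 ?(andP (a01 i)).2.
Qed.

End SupBound.

(** * From independent random variables to finite product spaces *)

Section Transfer.
Context (d : measure_display) (T : measurableType d) (R : realType)
  (P : probability T R) (n : nat) (eps : 'I_n -> {RV P >-> R}) (G : finType)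
  (c : 'I_n -> R -> G).
Hypothesis indep : mutually_independent eps.
Hypothesis mc : forall i g, measurable (c i @^-1` [set g]).

Definition cell_prob (i : 'I_n) (g : G) : R :=
  fine (P (eps i @^-1` (c i @^-1` [set g]))).

Let mE i g : measurable (eps i @^-1` (c i @^-1` [set g])).
Proof. by rewrite -[X in measurable X]setTI; apply: measurable_funPT => //; exact: mc. Qed.

Let sum_cell i (A : pred G) :
  P (eps i @^-1` [set u | A (c i u)]) = (\sum_(g | A g) cell_prob i g)%:E.
Proof.
have -> : eps i @^-1` [set u | A (c i u)] =
   \bigcup_(g in [set` [seq g <- index_enum G | A g]])
     (eps i @^-1` (c i @^-1` [set g])).
  apply/seteqP; split=> [w /= Aw|w [g /=]].
    by exists (c i (eps i w)) => //=; rewrite mem_filter Aw mem_index_enum.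
  by rewrite mem_filter => /andP[Ag _] /= ->.
rewrite measure_fin_bigcup //=.
- rewrite -fsbig_seq ?filter_uniq ?index_enum_uniq //= big_filter -sumEFin.
  by apply: eq_bigr => g _; rewrite /cell_prob fineK // fin_num_measure.
- by move=> g h _ _ [w [/= <- <-]].
Qed.

Lemma cell_prob_sum i (A : pred G) :
  \sum_(g | A g) cell_prob i g = fine (P (eps i @^-1` [set u | A (c i u)])).
Proof. by rewrite sum_cell. Qed.

Lemma cell_pmf : is_pmf cell_prob.
Proof.
split=> [i g|i]; first by rewrite fine_ge0.
rewrite (cell_prob_sum i predT); rewrite [X in P X](_ : _ = setT) ?probability_setT //.
by apply/seteqP.
Qed.

Let mEx (x : {ffun 'I_n -> G}) :
  measurable [set w | [ffun i => c i (eps i w)] = x].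
Proof.
have -> : [set w | [ffun i => c i (eps i w)] = x] =
   \bigcap_(i in [set: 'I_n]) (eps i @^-1` (c i @^-1` [set x i])).
  apply/seteqP; split=> [w /= <- i _ /=|w h /=]; first by rewrite ffunE.
  by apply/ffunP => i; rewrite ffunE; exact: (h i).
by apply: fin_bigcap_measurable => //; exact: finite_finset.
Qed.

(** By independence the vector of cells has the product law with marginals [cell_prob], so an event
    that depends on the cells only has a finite sum as its probability. *)
Lemma transfer (A : pred {ffun 'I_n -> G}) :
  measurable [set w | A [ffun i => c i (eps i w)]] /\
  fine (P [set w | A [ffun i => c i (eps i w)]]) =
  Ex cell_prob (fun x => (A x)%:R).
Proof.
have EA : [set w | A [ffun i => c i (eps i w)]] =
   \bigcup_(x in [set` [seq x <- index_enum _ | A x]])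
     [set w | [ffun i => c i (eps i w)] = x].
  apply/seteqP; split=> [w /= Aw|w [x /=]].
    by exists [ffun i => c i (eps i w)] => //=; rewrite mem_filter Aw mem_index_enum.
  by rewrite mem_filter => /andP[Ax _] /= ->.
split.
  rewrite EA; apply: fin_bigcup_measurable => //.
rewrite EA measure_fin_bigcup //=; last by move=> x y _ _ [w [/= -> ->]].
rewrite -fsbig_seq ?filter_uniq ?index_enum_uniq //= big_filter.
rewrite (eq_bigr (fun x => (pw cell_prob x)%:E)).
  rewrite sumEFin /= /Ex [RHS](bigID A) /= [X in _ = _ + X]big1 ?addr0 => [|x /negbTE ->].
    by apply: eq_bigr => x ->; rewrite mulr1.
  by rewrite mulr0.
move=> x _.
have := indep [set: 'I_n]%SET (fun i => mc i (x i)).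
rewrite [X in P X](_ : _ = [set w | [ffun i => c i (eps i w)] = x]).
  move=> ->; rewrite /pw -prodEFin; apply: eq_big => [i|i _]; first by rewrite inE.
  by rewrite /cell_prob fineK // fin_num_measure.
apply/seteqP; split=> [w h /=|w /= <- i _ /=]; last by rewrite ffunE.
by apply/ffunP => i; rewrite ffunE; apply: (h i); rewrite /= inE.
Qed.

Lemma transfer_markov (F : {ffun 'I_n -> G} -> R) (t : R) : 0 < t ->
  (forall x, 0 <= F x) ->
  measurable [set w | F [ffun i => c i (eps i w)] < t] /\
  1 - Ex cell_prob F / t <= fine (P [set w | F [ffun i => c i (eps i w)] < t]).
Proof.
move=> t0 F0; have [mA eA] := transfer (fun x => F x < t).
split=> //; rewrite eA.
have := Ex_markov cell_pmf t0 F0.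
rewrite (eq_Ex _ (_ : _ =1 fun x => 1 - (F x < t)%R%:R)).
  by rewrite ExB (Ex_cst cell_pmf); lra.
by move=> x; rewrite leNgt; case: (F x < t); rewrite /= ?subrr ?subr0.
Qed.

End Transfer.

(** * Expectations of bounded random variables *)

Section BoundedExpectation.
Context (d : measure_display) (T : measurableType d) (R : realType)
  (P : probability T R).
Implicit Types X Y : T -> R.

Definition bmf X := measurable_fun setT X /\ exists c : R, forall w, `|X w| <= c.

Definition EP X : R := \int[P]_w X w.

Lemma bmf_integrable X : bmf X -> P.-integrable setT (EFin \o X).
Proof.
move=> [mX [c hc]].
apply: (le_integrable _ _ _ (finite_measure_integrable_cst P `|c| _)) => //.
- exact/measurable_EFinP.
- by move=> w _ /=; rewrite lee_fin normr_id (le_trans (hc w)) // ler_norm.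
Qed.

Lemma bmf_cst c : bmf (fun=> c).
Proof. by split; [exact: measurable_cst|exists `|c|]. Qed.

Lemma bmfD X Y : bmf X -> bmf Y -> bmf (fun w => X w + Y w).
Proof.
move=> [mX [c hc]] [mY [e he]]; split; first exact: measurable_funD.
by exists (c + e) => w; rewrite (le_trans (ler_normD _ _)) // lerD.
Qed.

Lemma bmfZ c X : bmf X -> bmf (fun w => c * X w).
Proof.
move=> [mX [b hb]]; split; first by apply: measurable_funM.
by exists (`|c| * b) => w; rewrite normrM ler_wpM2l.
Qed.

Lemma bmf_pred (A : T -> bool) : measurable [set w | A w] ->
  bmf (fun w => (A w)%:R).
Proof.
move=> mA; split.
  rewrite (_ : (fun w => (A w)%:R) = \1_[set w | A w]); first exact: measurable_indic.
  by apply/funext => w; rewrite indicE; congr (nat_of_bool _)%:R;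
    apply/idP/idP; rewrite inE.
by exists 1 => w; case: (A w); rewrite ?normr0 ?normr1.
Qed.

Lemma EP_le X Y : bmf X -> bmf Y -> (forall w, X w <= Y w) -> EP X <= EP Y.
Proof. by move=> bX bY h; apply: le_Rintegral => //; exact: bmf_integrable. Qed.

Lemma EP_cst c : EP (fun=> c) = c.
Proof. rewrite /EP Rintegral_cst // (_ : fine _ = 1) ?mulr1 //.
have e : P setT = 1%E by exact: probability_setT.
by rewrite -[RHS]/(fine 1%E) -e. Qed.

Lemma EPD X Y : bmf X -> bmf Y -> EP (fun w => X w + Y w) = EP X + EP Y.
Proof. by move=> bX bY; rewrite /EP RintegralD //; exact: bmf_integrable. Qed.

Lemma EPZ c X : bmf X -> EP (fun w => c * X w) = c * EP X.
Proof. by move=> bX; rewrite /EP RintegralZl //; exact: bmf_integrable. Qed.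

Lemma EP_pred (A : T -> bool) : measurable [set w | A w] ->
  EP (fun w => (A w)%:R) = fine (P [set w | A w]).
Proof.
move=> mA; rewrite /EP /Rintegral; congr fine.
rewrite -[in RHS](setIT [set w | A w]) -integral_indic //.
apply: eq_integral => w _; rewrite indicE; congr (nat_of_bool _)%:R%:E.
by apply/idP/idP; rewrite inE.
Qed.

Lemma EP_close X Y c : bmf X -> bmf Y -> (forall w, `|X w - Y w| <= c) ->
  `|EP X - EP Y| <= c.
Proof.
move=> bX bY h.
have h1 : EP X <= EP (fun w => Y w + c).
  apply: EP_le => //; first by apply: bmfD => //; exact: bmf_cst.
  by move=> w; have /ler_normlP [] := h w; lra.
have h2 : EP Y <= EP (fun w => X w + c).
  apply: EP_le => //; first by apply: bmfD => //; exact: bmf_cst.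
  by move=> w; have /ler_normlP [] := h w; lra.
move: h1 h2; rewrite !EPD ?EP_cst //; try exact: bmf_cst.
by move=> ? ?; apply/ler_normlP; split; lra.
Qed.

Lemma EP_sum (G : finType) (X : G -> T -> R) : (forall g, bmf (X g)) ->
  bmf (fun w => \sum_g X g w) /\ EP (fun w => \sum_g X g w) = \sum_g EP (X g).
Proof.
move=> h; elim: (index_enum G) => [|g s [IH1 IH2]].
  rewrite big_nil (_ : (fun w => _) = fun=> 0); last first.
    by apply/funext => w; rewrite big_nil.
  by split; [exact: bmf_cst|exact: EP_cst].
rewrite big_cons (_ : (fun w => _) = fun w => X g w + \sum_(g <- s) X g w); last first.
  by apply/funext => w; rewrite big_cons.
by split; [exact: bmfD|rewrite EPD // IH2].
Qed.

End BoundedExpectation.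

(* Knight's remainder: the integral of [1{e <= v} - 1{e <= 0}] over [v] from
   [0] to [u]. *)
Definition kn (R : realType) (e u : R) : R :=
  if e <= 0 then Num.max 0 (e - u) else Num.max 0 (u - e).

Definition lin0 (R : realType) (e u : R) : R := u * (e <= 0)%R%:R.

(* Two errors in the same cell have the same sign and are either [h]-close or
   beyond the same end of the grid, so [kn] and [lin0] factor through finitely
   many cells up to [h]: symmetrization is needed on finite spaces only. *)
Definition cell (R : realType) (N : nat) (h e : R) : {ffun 'I_(2 * N).+1 -> bool} :=
  [ffun k : 'I_(2 * N).+1 => (k%:R - N%:R) * h < e].

Section Knight.
Variable R : realType.
Implicit Types e u v h b tau : R.

Lemma max0l x : 0 <= x -> Num.max 0 x = x :> R.
Proof. exact: max_r. Qed.

Lemma max0r x : x <= 0 -> Num.max 0 x = 0 :> R.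
Proof. exact: max_l. Qed.

Lemma knight tau e u :
  rho tau (e - u) - rho tau e = - (u * tau) + lin0 e u + kn e u.
Proof.
rewrite /rho /kn /lin0; have [e0|e0] := lerP e 0.
  by have [eu|eu] := lerP (e - u) 0; rewrite /=; ring.
have [eu|eu] := lerP (e - u) 0; first by rewrite max0l //=; [ring|lra].
by rewrite max0r //=; [ring|lra].
Qed.

Lemma kn0 e : kn e 0 = 0.
Proof. by rewrite /kn; case: lerP => e0; rewrite max0r //; lra. Qed.

Lemma lin00 e : lin0 e 0 = 0. Proof. by rewrite /lin0 mul0r. Qed.

(** The integrand that defines [kn] is nondecreasing, so an increment lies between the length of the
    interval times the integrand at either end. *)
Lemma kn_incr e u v : u <= v ->
  (v - u) * ((e <= u)%R%:R - (e <= 0)%R%:R) <= kn e v - kn e u <=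
  (v - u) * ((e <= v)%R%:R - (e <= 0)%R%:R).
Proof.
move=> uv; rewrite /kn; have [e0|e0] := lerP e 0;
have [eu|eu] := lerP e u; have [ev|ev] := lerP e v => /=; rewrite ?subrr ?subr0 ?mulr0 ?mulr1.
- by rewrite !max0r ?subrr ?lexx //; lra.
- by exfalso; lra.
- by rewrite (max0l (x := e - u)) ?(max0r (x := e - v)) //; lra.
- by rewrite !max0l //; lra.
- by rewrite !max0l //; lra.
- by exfalso; lra.
- by rewrite (max0r (x := u - e)) ?(max0l (x := v - e)) //; lra.
- by rewrite !max0r ?subrr ?lexx //; lra.
Qed.

(** For [|e| > b] the integrand vanishes on [[-b, b]], so [kn e] is constant there; this indicator
    is the source of the localization. *)
Lemma kn_lip e u v b : `|u| <= b -> `|v| <= b ->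
  `|kn e u - kn e v| <= (`|e| <= b)%R%:R * `|u - v|.
Proof.
wlog uv : u v / u <= v.
  move=> H hu hv; have [uv|vu] := leP u v; first exact: H.
  by rewrite distrC [`|u - v|]distrC; apply: H => //; exact: ltW.
move=> /ler_normlP [u1 u2] /ler_normlP [v1 v2].
have := kn_incr e uv; rewrite distrC [`|u - v|]distrC (ger0_norm (x := v - u)); last by lra.
case: (lerP `|e| b) => [_|]; rewrite /=.
  case: (e <= u); case: (e <= v); case: (e <= 0) => /= h; apply/ler_normlP; split; lra.
rewrite ltr_normr => /orP [eb|eb] _; rewrite mul0r /kn.
  have -> : (e <= 0) = false by apply/negbTE; rewrite -ltNge; lra.
  by rewrite !max0r ?subrr ?normr0 //; lra.
have -> : (e <= 0) by lra.
by rewrite !max0r ?subrr ?normr0 //; lra.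
Qed.

Lemma lin0_lip e u v : `|lin0 e u - lin0 e v| <= `|u - v|.
Proof.
by rewrite /lin0 -mulrBl normrM; case: (e <= 0); rewrite /= ?normr1 ?normr0 ?mulr1 ?mulr0.
Qed.

Lemma grid_point (N : nat) h x : 0 < h -> `|x| < N%:R * h ->
  exists k : 'I_(2 * N).+1, x <= (k%:R - N%:R) * h < x + h.
Proof.
move=> h0 /ltr_normlP [x1 x2].
have hz : 0 <= (x + N%:R * h) / h by rewrite divr_ge0 ?(ltW h0) //; lra.
pose m := Num.truncn ((x + N%:R * h) / h).
have /andP [m1 m2] := truncn_itv hz.
rewrite -/m in m1 m2.
rewrite ler_pdivlMr // in m1; rewrite ltr_pdivrMr // in m2.
have mN : (m < 2 * N)%N.
  rewrite -(ltr_nat R) natrM -(ltr_pM2r h0); lra.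
(* A grid point is its own answer, anything else is rounded up: [cell] records strict inequalities,
   so the point sought may equal [x] but not [x + h]. *)
have [eq|ne] := eqVneq (x + N%:R * h) (m%:R * h).
  by exists (Ordinal (ltnW mN : (m < (2 * N).+1)%N)) => /=; apply/andP; split; lra.
exists (Ordinal (mN : (m.+1 < (2 * N).+1)%N)) => /=.
rewrite -[m.+1%:R]natr1 in m2 *.
have : m%:R * h < x + N%:R * h by rewrite lt_neqAle m1 eq_sym ne.
by move=> ?; apply/andP; split; lra.
Qed.

Lemma cell_le0 (N : nat) h e e' : cell N h e = cell N h e' -> (e <= 0) = (e' <= 0).
Proof.
move=> E; have hN : (N < (2 * N).+1)%N by rewrite ltnS mul2n -addnn leq_addr.
move/ffunP : E => /(_ (Ordinal hN)); rewrite !ffunE /= subrr mul0r => E.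
by rewrite !leNgt E.
Qed.

(** The grid point that [grid_point] puts in [[e, e + h)] is not strictly below [e], hence not
    strictly below [e'] either. *)
Lemma cell_close (N : nat) h e e' : 0 < h -> cell N h e = cell N h e' ->
  `|e| < N%:R * h -> e' < e + h.
Proof.
move=> h0 /ffunP E eN; have [k /andP [k1 k2]] := grid_point h0 eN.
move: (E k); rewrite !ffunE [LHS]ltNge k1 /= => /esym/negbT; rewrite -leNgt; lra.
Qed.

Lemma cell_loc (N : nat) h b e e' : 0 < h -> b + h < N%:R * h ->
  cell N h e = cell N h e' -> `|e'| <= b -> `|e| <= b + h.
Proof.
move=> h0 bN E e'b; have /ler_normlP [e1 e2] := e'b.
have h1 : e < e' + h.
  by apply: cell_close (esym E) _ => //; rewrite (le_lt_trans e'b) //; lra.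
suff h2 : e' - h <= e by apply/ler_normlP; split; lra.
rewrite leNgt; apply/negP => eh.
have : `|e' - h| < N%:R * h by apply/ltr_normlP; split; lra.
move=> /(grid_point h0) [k /andP [k1 k2]].
move/ffunP : E => /(_ k); rewrite !ffunE.
have -> : (k%:R - N%:R) * h < e' by lra.
by have -> : ((k%:R - N%:R) * h < e) = false by apply/negbTE; rewrite -leNgt; lra.
Qed.

(** With its sign fixed, [kn] is 1-Lipschitz in the error. Where it is nonzero the error lies
    between 0 and [u], well inside the grid, so there the cell determines the error up to [h]. *)
Lemma cell_kn (N : nat) h e e' u : 0 < h -> `|u| + h < N%:R * h ->
  cell N h e = cell N h e' -> `|kn e u - kn e' u| <= h.
Proof.
move=> h0 uN; wlog ee : e e' / e <= e'.
  move=> H E; have [ee|ee] := leP e e'; first exact: H.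
  by rewrite distrC; apply: H => //; exact: ltW.
move=> E; have z := cell_le0 E.
have [u1 u2] : - u <= `|u| /\ u <= `|u| by rewrite ler_norm -normrN ler_norm.
have nu := normr_ge0 u.
rewrite /kn -z; case: ifP => e0.
  have e0' : e' <= 0 by rewrite -z.
  have [e'u|ue'] := leP e' u.
    by rewrite !max0r ?subrr ?normr0 ?(ltW h0) //; lra.
  suff : e' - h <= e.
    move=> ?; rewrite (max0l (x := e' - u)); last by lra.
    by have [eu|eu] := leP (e - u) 0; apply/ler_normlP; split; lra.
  rewrite leNgt; apply/negP => eh.
  have : `|e' - h| < N%:R * h by apply/ltr_normlP; split; lra.
  move=> /(grid_point h0) [k /andP [k1 k2]].
  move/ffunP : E => /(_ k); rewrite !ffunE.
  have -> : (k%:R - N%:R) * h < e' by lra.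
  by have -> : ((k%:R - N%:R) * h < e) = false by apply/negbTE; rewrite -leNgt; lra.
move/negbT: e0; rewrite -ltNge => e0.
have [ue|eu] := leP u e.
  by rewrite !max0r ?subrr ?normr0 ?(ltW h0) //; lra.
have : e' < e + h.
  by apply: (cell_close h0 E); apply/ltr_normlP; split; lra.
move=> ?; rewrite (max0l (x := u - e)); last by lra.
by have [e'u|e'u] := leP (u - e') 0; apply/ler_normlP; split; lra.
Qed.

Lemma measurable_cell (N : nat) h (g : {ffun 'I_(2 * N).+1 -> bool}) :
  measurable (cell N h @^-1` [set g]).
Proof.
have -> : cell N h @^-1` [set g] = \bigcap_(k in [set: 'I_(2 * N).+1])
   [set e | ((k%:R - N%:R) * h < e) = g k].
  apply/seteqP; split=> [e /= <- k _ /=|e H /=]; first by rewrite ffunE.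
  by apply/ffunP => k; rewrite ffunE; exact: (H k).
apply: fin_bigcap_measurable => [|k _]; first exact: finite_finset.
case: (g k).
  have -> : [set e | ((k%:R - N%:R) * h < e) = true] = `](k%:R - N%:R) * h, +oo[%classic.
    by apply/seteqP; split=> e /=; rewrite in_itv /= andbT.
  exact: measurable_itv.
have -> : [set e | ((k%:R - N%:R) * h < e) = false] = `]-oo, (k%:R - N%:R) * h]%classic.
  apply/seteqP; split=> e /=; rewrite in_itv /= ltNge; first by move=> /negbFE.
  by move=> ->.
exact: measurable_itv.
Qed.

Lemma measurable_kn u : measurable_fun setT (kn (R := R) ^~ u).
Proof.
rewrite /kn; apply: measurable_fun_if => //=.
- exact: measurable_fun_ler.
- by apply: measurable_funTS; apply: measurable_maxr => //; apply: measurable_funB.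
- by apply: measurable_funTS; apply: measurable_maxr => //; apply: measurable_funB.
Qed.

Lemma measurable_lin0 u : measurable_fun setT (lin0 (R := R) ^~ u).
Proof.
rewrite /lin0; apply: measurable_funM => //.
have -> : (fun x : R => (x <= 0)%R%:R : R) = \1_`]-oo, 0]%classic.
  apply/funext => x; rewrite indicE; congr (nat_of_bool _)%:R.
  by apply/idP/idP; rewrite inE /= in_itv.
by apply: measurable_indic; exact: measurable_itv.
Qed.

End Knight.

(** * Finite nets and uniform deviations over a ball *)

Lemma finite_net (R : realType) (s : nat) (rad mu : R) : 0 <= rad -> 0 < mu ->
  exists (D : finType) (d0 : D) (del : D -> 'cV[R]_s),
    [/\ forall t, norm2 (del t) <= rad, del d0 = 0 &
      forall v : 'cV[R]_s, norm2 v <= rad ->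
        exists t, forall j, `|v j 0 - del t j 0| <= mu].
Proof.
move=> rad0 mu0.
have [M hM] : exists M : nat, rad < M%:R * mu.
  exists (Num.bound (rad / mu)); rewrite -ltr_pdivrMr //.
  by rewrite archi_boundP // divr_ge0 // ltW.
pose cl (v : 'cV[R]_s) := [ffun j : 'I_s => cell M mu (v j 0)].
(* Each nonempty pattern of cells is represented by a point inside the ball. [None] is sent to the
   exact centre, where the process will vanish. *)
pose del (t : option {ffun 'I_s -> {ffun 'I_(2 * M).+1 -> bool}}) : 'cV[R]_s :=
  if t is Some g then xget 0 [set v | norm2 v <= rad /\ cl v = g] else 0.
exists (option {ffun 'I_s -> {ffun 'I_(2 * M).+1 -> bool}} : finType), None, del.
split=> //.
  case=> [g|] /=; last by rewrite norm20.
  by case: xgetP => [v -> [] //|_]; rewrite norm20.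
move=> v hv; exists (Some (cl v)) => j /=.
case: xgetP => [u -> [hu E]|/(_ v)]; last by case.
have small (z : 'cV[R]_s) : norm2 z <= rad -> `|z j 0| < M%:R * mu.
  by move=> hz; rewrite (le_lt_trans (entry_le_norm2 z j)) // (le_lt_trans hz).
move/ffunP : E => /(_ j); rewrite !ffunE => E.
have h1 := cell_close mu0 E (small _ hu).
have h2 := cell_close mu0 (esym E) (small _ hv).
by apply/ler_normlP; split; lra.
Qed.

Lemma RV_preimage (d : measure_display) (T : measurableType d) (R : realType)
  (P : probability T R) (X : {RV P >-> R}) (A : set R) :
  measurable A -> measurable (X @^-1` A).
Proof.
by move=> mA; rewrite -[X in measurable X]setTI; apply: measurable_funPT.
Qed.

Section Uniform.
Context (d : measure_display) (T : measurableType d) (R : realType)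
  (P : probability T R) (n s : nat) (eps : 'I_n -> {RV P >-> R}).
Hypothesis indep : mutually_independent eps.
Variables (K : R -> R -> R) (b : R) (xi xi1 : R -> bool).
Hypothesis b0 : 0 < b.
Hypothesis K0 : forall e, K e 0 = 0.
Hypothesis mK : forall u, measurable_fun setT (K^~ u).
Hypothesis Klip : forall e u v, `|u| <= b -> `|v| <= b ->
  `|K e u - K e v| <= (xi e)%:R * `|u - v|.
Hypothesis Kcell : forall (N : nat) h e e' u, 0 < h -> `|u| + h < N%:R * h ->
  cell N h e = cell N h e' -> `|K e u - K e' u| <= h.
Hypothesis xicell : forall (N : nat) h e e', 0 < h -> h <= b -> b + h < N%:R * h ->
  cell N h e = cell N h e' -> xi e' -> xi1 e.
Hypothesis mxi1 : measurable [set e | xi1 e].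

Let xi01 e : 0 <= ((xi e)%:R : R) <= 1.
Proof. by case: (xi e); rewrite /= ?lexx ?ler01. Qed.

Lemma K_lip1 e u v : `|u| <= b -> `|v| <= b -> `|K e u - K e v| <= `|u - v|.
Proof.
move=> ub vb; apply: le_trans (Klip e ub vb) _.
by rewrite ler_piMl // (andP (xi01 e)).2.
Qed.

Lemma K_bmf i u : `|u| <= b -> bmf (fun w => K (eps i w) u).
Proof.
move=> ub; split; first by apply: (measurableT_comp (mK u)).
exists b => w; have := @K_lip1 (eps i w) u 0 ub.
by rewrite K0 !subr0 normr0 => /(_ (ltW b0)) h; rewrite (le_trans h).
Qed.

Definition meanK i u : R := EP P (fun w => K (eps i w) u).

Lemma meanK_lip i u v : `|u| <= b -> `|v| <= b ->
  `|meanK i u - meanK i v| <= `|u - v|.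
Proof.
by move=> ub vb; apply: EP_close; [exact: K_bmf|exact: K_bmf|move=> w; exact: K_lip1].
Qed.

(* [xi] localizes: only errors of size [O(b)] feel a perturbation of size [b].
   The finite family [w] of extra directions costs only [ln #|J|]; it is what
   controls all noise columns at once. *)
Lemma uniform_ball (J : finType) (j0 : J) (S : 'M[R]_(n, s))
    (w : J -> 'I_n -> R) (rad v th t : R) :
  0 <= rad -> 0 < th -> 0 < t ->
  (forall j, \sum_i w j i ^+ 2 <= v) -> (forall i, w j0 i = 0) ->
  (forall (x : 'cV[R]_s) j i, norm2 x <= rad -> `|(S *m x) i 0 + w j i| <= b) ->
  exists A : set T, [/\ measurable A,
    1 - 8 / t * (rad * Num.sqrt (\sum_i norm2 (row i S)^T ^+ 2 *
           fine (P [set om | xi1 (eps i om)])) + (ln #|J|%:R / th + 2 * th * v))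
      <= fine (P A) &
    forall om, A om -> forall (x : 'cV[R]_s) j, norm2 x <= rad ->
      `|\sum_i (K (eps i om) ((S *m x) i 0 + w j i) -
                meanK i ((S *m x) i 0 + w j i))| <= t].
Proof.
move=> rad0 th0 t0 wv w0 Ub.
(* Half of [t] is reserved for the maximum over the net and half for discretization, made of
   [2 * L * mu] for the net and [2 * n * h] for the cells, each at most [t / 4]. The bound [h <= b]
   meets the requirement of [xicell]. *)
pose L := \sum_i norm2 (row i S)^T * Num.sqrt s%:R.
have L0 : 0 <= L by apply: sumr_ge0 => i _; rewrite mulr_ge0 ?norm2_ge0 ?sqrtr_ge0.
pose mu := t / (8 * (L + 1)).
have mu0 : 0 < mu by rewrite divr_gt0 // mulr_gt0 //; lra.
have Lmu : L * mu <= t / 8.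
  by rewrite /mu mulrA ler_pdivrMr ?mulr_gt0 //; nra.
have [D [d0 [del [dr dd0 dnet]]]] := finite_net s rad0 mu0.
pose h := Num.min b (t / (8 * (n%:R + 1))).
have n0 : 0 <= n%:R :> R by [].
have h0 : 0 < h by rewrite lt_min b0 divr_gt0 // mulr_gt0 //; lra.
have hb : h <= b by rewrite ge_min lexx.
have nh : n%:R * h <= t / 8.
  have : h <= t / (8 * (n%:R + 1)) by rewrite ge_min lexx orbT.
  rewrite ler_pdivlMr; last by rewrite mulr_gt0 //; lra.
  nra.
have [N hN] : exists N : nat, b + h < N%:R * h.
  exists (Num.bound ((b + h) / h)); rewrite -ltr_pdivrMr //.
  by rewrite archi_boundP // divr_ge0 // ?ltW // ?addr_gt0.
pose G := {ffun 'I_(2 * N).+1 -> bool} : finType.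
pose c (i : 'I_n) e : G := cell N h e.
have mc i g : measurable (c i @^-1` [set g]) by exact: measurable_cell.
pose rep (g : G) : R := xget 0 [set e | cell N h e = g].
have repE e : cell N h (rep (cell N h e)) = cell N h e.
  by rewrite /rep; case: xgetP => [e' -> //|/(_ e)] [].
pose p := cell_prob eps c.
have pp : is_pmf p by exact: cell_pmf.
pose U (z : D * J) i := (S *m del z.1) i 0 + w z.2 i.
have Ubb z i : `|U z i| <= b by exact: Ub.
have UhN z i : `|U z i| + h < N%:R * h by rewrite (le_lt_trans _ hN) // lerD2r.
pose phi i (g : G) z := K (rep g) (U z i).
pose m i z := \sum_g p i g * phi i g z.
pose X := rad * Num.sqrt (\sum_i norm2 (row i S)^T ^+ 2 *
   fine (P [set om | xi1 (eps i om)])) + (ln #|J|%:R / th + 2 * th * v).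
(* When the representative of a cell satisfies [xi], the errors in that cell are only known to
   satisfy the larger [xi1]. *)
have xiP i : \sum_g p i g * (xi (rep g))%:R <= fine (P [set om | xi1 (eps i om)]).
  rewrite (eq_bigr (fun g => if xi (rep g) then p i g else 0)); last first.
    by move=> g _; case: (xi _); rewrite ?mulr1 ?mulr0.
  rewrite -big_mkcond (cell_prob_sum eps mc i (fun g => xi (rep g))).
  have m1 : measurable [set om | xi1 (eps i om)].
    exact: RV_preimage mxi1.
  have m2 : measurable (eps i @^-1` [set u | xi (rep (c i u))]).
    apply: RV_preimage.
    have -> : [set u | xi (rep (c i u))] =
        \bigcup_(g in [set g : G | xi (rep g)]) (c i @^-1` [set g]).
      by apply/seteqP; split=> [u hu|u [g hg /= ->]] //; exists (c i u).
    by apply: fin_bigcup_measurable => //; exact: finite_finset.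
  apply: fine_le; rewrite ?fin_num_measure //.
  apply: le_measure; rewrite ?inE // => om /= /(xicell h0 hb hN); apply.
  by rewrite repE.
have bound (sg : R) : `|sg| = 1 ->
  Ex p (fun x => maxf (d0, j0) (fun z =>
     \sum_i (sg * phi i (x i) z - \sum_g p i g * (sg * phi i g z)))) <= 2 * X.
  move=> sg1; apply: le_trans
    (@sup_bound _ _ _ _ p pp D J d0 j0 del S w rad v th (fun _ g => (xi (rep g))%:R)
       (fun i g z => sg * phi i g z) rad0 dr th0 wv _ _) _ => //.
    by move=> i g z z'; rewrite -mulrBr normrM sg1 mul1r; apply: Klip; exact: Ubb.
  rewrite ler_pM2l // lerD2r ler_wpM2l // ler_wsqrtr // ler_sum // => i _.
  by rewrite ler_wpM2l ?sqr_ge0.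
pose F (sg : R) (x : {ffun 'I_n -> G}) := maxf (d0, j0) (fun z =>
     \sum_i (sg * phi i (x i) z - \sum_g p i g * (sg * phi i g z))).
(* The index [(d0, j0)] stands for the zero perturbation, where every term vanishes; so the maximum
   is nonnegative, as Markov's inequality demands. *)
have F0 sg x : 0 <= F sg x.
  apply: le_trans (le_maxf _ _ (d0, j0)); rewrite big1 // => i _.
  have e0 g : phi i g (d0, j0) = 0.
    by rewrite /phi /U /= dd0 mulmx0 mxE w0 addr0 K0.
  by rewrite e0 big1 ?mulr0 ?subrr // => g _; rewrite e0 !mulr0.
have t20 : 0 < t / 2 by lra.
have [mA1 pA1] := transfer_markov indep mc t20 (F0 1).
have [mA2 pA2] := transfer_markov indep mc t20 (F0 (-1)).
set A1 := [set _ | _] in mA1 pA1; set A2 := [set _ | _] in mA2 pA2.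
exists (A1 `&` A2); split; first exact: measurableI.
  have b1 : Ex p (F 1) / (t / 2) <= 4 / t * X.
    rewrite ler_pdivrMr // (le_trans (bound 1 _)) ?normr1 //.
    by apply: le_of_eq; field; rewrite gt_eqF.
  have b2 : Ex p (F (-1)) / (t / 2) <= 4 / t * X.
    rewrite ler_pdivrMr // (le_trans (bound (-1) _)) ?normrN1 //.
    by apply: le_of_eq; field; rewrite gt_eqF.
  have pU : fine (P A1) + fine (P A2) <= 1 + fine (P (A1 `&` A2)).
    have e1 : P A2 = (P (A2 `&` A1) + P (A2 `\` A1))%E by rewrite addeC -measureDI.
    have mD : measurable (A2 `\` A1) by exact: measurableD.
    have mI : measurable (A2 `&` A1) by exact: measurableI.
    have mU : measurable (A1 `|` (A2 `\` A1)) by exact: measurableU.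
    have e2 : (P (A1 `|` (A2 `\` A1)) = P A1 + P (A2 `\` A1))%E.
      by rewrite measureU //; apply/seteqP; split=> // om [? []].
    have e3 : (P (A1 `|` (A2 `\` A1)) <= 1)%E by exact: probability_le1.
    move: e1 e2 e3; rewrite setIC => -> ->.
    rewrite -(fineK (fin_num_measure P _ mA1)) -(fineK (fin_num_measure P _ mD)).
    rewrite setIC -(fineK (fin_num_measure P _ mI)) -!EFinD lee_fin /=; lra.
  rewrite -/X; lra.
move=> om [in1 in2] x j hx.
have [z1 hz1] := dnet x hx.
pose z := (z1, j).
have cl : `|\sum_i (phi i (c i (eps i om)) z - m i z)| <= t / 2.
  have e sg : \sum_i (sg * phi i (c i (eps i om)) z - \sum_g p i g * (sg * phi i g z)) =
     sg * \sum_i (phi i (c i (eps i om)) z - m i z).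
    rewrite mulr_sumr; apply: eq_bigr => i _; rewrite mulrBr /m mulr_sumr.
    by congr (_ - _); apply: eq_bigr => g _; ring.
  have ff sg : F sg [ffun i => c i (eps i om)] < t / 2 ->
     sg * \sum_i (phi i (c i (eps i om)) z - m i z) < t / 2.
    move=> lt; apply: le_lt_trans lt; rewrite -e.
    apply: le_trans (le_maxf _ _ z); apply: le_of_eq.
    by apply: eq_bigr => i _; rewrite ffunE.
  move: (ff 1 in1) (ff (-1) in2); rewrite mul1r mulN1r => ? ?.
  by apply/ler_normlP; split; exact: ltW.
set u := fun i => (S *m x) i 0 + w j i.
have ub i : `|u i| <= b by exact: Ub.
have uU i : `|u i - U z i| <= norm2 (row i S)^T * Num.sqrt s%:R * mu.
  rewrite /u /U /= opprD addrACA subrr addr0.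
  have -> : (S *m x) i 0 - (S *m del z1) i 0 = (S *m (x - del z1)) i 0.
    by rewrite mulmxBr !mxE.
  apply: le_trans (mulmx_row_le _ _ _) _; rewrite -mulrA ler_wpM2l ?norm2_ge0 //.
  by apply: norm2_entries_le => [|k]; [exact: ltW|rewrite !mxE; exact: hz1].
have step i : `|K (eps i om) (u i) - meanK i (u i) - (phi i (c i (eps i om)) z - m i z)|
    <= 2 * h + 2 * (norm2 (row i S)^T * Num.sqrt s%:R * mu).
  have s1 : `|K (eps i om) (u i) - K (eps i om) (U z i)| <= _ :=
    le_trans (K_lip1 _ (ub i) (Ubb z i)) (uU i).
  have s2 : `|meanK i (u i) - meanK i (U z i)| <= _ :=
    le_trans (meanK_lip _ (ub i) (Ubb z i)) (uU i).
  have s3 : `|K (eps i om) (U z i) - phi i (c i (eps i om)) z| <= h.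
    by apply: (Kcell h0 (UhN z i)); rewrite repE.
  have s4 : `|meanK i (U z i) - m i z| <= h.
    have mcell g : measurable [set om | c i (eps i om) == g].
      have -> : [set om | c i (eps i om) == g] = eps i @^-1` (c i @^-1` [set g]).
        by apply/seteqP; split=> q /eqP.
      exact: RV_preimage.
    have [bs es] := EP_sum P (X := fun g om => phi i g z * (c i (eps i om) == g)%:R)
      (fun g => bmfZ (phi i g z) (bmf_pred R (mcell g))).
    have em : m i z = EP P (fun om => \sum_g phi i g z * (c i (eps i om) == g)%:R).
      rewrite es; apply: eq_bigr => g _; rewrite EPZ; last exact: bmf_pred.
      rewrite EP_pred // mulrC; congr (_ * fine (P _)).
      by apply/seteqP; split=> q /eqP.
    rewrite em; apply: EP_close => //; first exact: K_bmf.
    move=> q; rewrite (bigD1 (c i (eps i q))) //= eqxx mulr1 big1 ?addr0; last first.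
      by move=> g gn; rewrite eq_sym (negbTE gn) mulr0.
    by apply: (Kcell h0 (UhN z i)); rewrite repE.
  move: s1 s2 s3 s4 => /ler_normlP [? ?] /ler_normlP [? ?] /ler_normlP [? ?] /ler_normlP [? ?].
  by apply/ler_normlP; split; lra.
have tot : `|\sum_i (K (eps i om) (u i) - meanK i (u i)) -
    \sum_i (phi i (c i (eps i om)) z - m i z)| <= t / 2.
  rewrite -sumrB; apply: le_trans (ler_norm_sum _ _ _) _.
  apply: le_trans (ler_sum _ (fun i _ => step i)) _.
  rewrite big_split /= sumr_const card_ord -mulr_natl -mulr_sumr -mulr_suml -/L; lra.
move: cl tot => /ler_normlP [? ?] /ler_normlP [? ?].
by apply/ler_normlP; split; lra.
Qed.

End Uniform.

(** * The mean of the Knight remainder *)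

Lemma distr_funE (d : measure_display) (T : measurableType d) (R : realType)
  (P : probability T R) (X : {RV P >-> R}) u :
  distr_fun X u = fine (P [set w | X w <= u]).
Proof.
by rewrite /distr_fun /cdf /distribution /pushforward; congr (fine (P _)).
Qed.

(** Over [N] equal pieces the quadratic errors add up to [B * u ^+ 2 / N], which tends to 0. It acts
    as a mean value inequality for functions known only through their increments. *)
Lemma telescope_bound (R : realType) (Psi : R -> R) (A B u : R) : 0 <= B ->
  (forall a b, `|a| <= `|u| -> `|b| <= `|u| -> a <= b ->
     `|Psi b - Psi a| <= A * (b - a) + B * (b - a) ^+ 2) ->
  `|Psi u - Psi 0| <= A * `|u|.
Proof.
move=> B0 H.
have H' a b : `|a| <= `|u| -> `|b| <= `|u| ->
    `|Psi b - Psi a| <= A * `|b - a| + B * (b - a) ^+ 2.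
  move=> ha hb; have [ab|ba] := leP a b.
    by rewrite [`|b - a|]ger0_norm ?subr_ge0 //; exact: H.
  rewrite distrC [`|b - a|]distrC -[(b - a) ^+ 2]sqrrN opprB.
  by rewrite (ger0_norm (x := a - b)) ?subr_ge0 ?(ltW ba) //; apply: H => //; exact: ltW.
have step N : (0 < N)%N -> `|Psi u - Psi 0| <= A * `|u| + B * u ^+ 2 / N%:R.
  move=> N0; have N0' : 0 < N%:R :> R by rewrite ltr0n.
  pose x k := u * k%:R / N%:R.
  have xN : x N = u by rewrite /x mulfK // gt_eqF.
  have x0 : x 0%N = 0 by rewrite /x mulr0 mul0r.
  have xle k : (k <= N)%N -> `|x k| <= `|u|.
    move=> kN; rewrite /x -mulrA normrM ler_piMr // ger0_norm ?divr_ge0 //.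
    by rewrite ler_pdivrMr // mul1r ler_nat.
  suff S k : (k <= N)%N -> `|Psi (x k) - Psi 0| <=
      k%:R * (A * `|u / N%:R| + B * (u / N%:R) ^+ 2).
    have := S N (leqnn N); rewrite xN => h; apply: le_trans h _.
    rewrite normrM (ger0_norm (x := N%:R^-1)) ?invr_ge0 // le_eqVlt; apply/orP; left.
    by apply/eqP; field; rewrite gt_eqF.
  elim: k => [|k IH] kN; first by rewrite x0 subrr normr0 mul0r.
  have xS : x k.+1 - x k = u / N%:R by rewrite /x -natr1; field; rewrite gt_eqF.
  have := H' _ _ (xle k (ltnW kN)) (xle _ kN); rewrite xS.
  have := IH (ltnW kN); rewrite -[k.+1%:R]natr1 => h1 h2.
  rewrite -(subrKA (Psi (x k))) (le_trans (ler_normD _ _)) //; lra.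
apply/ler_addgt0Pr => e e0.
have q0 : 0 <= B * u ^+ 2 / e.
  by apply: divr_ge0; [apply: mulr_ge0 => //; exact: sqr_ge0|exact: ltW].
have [N hN] : exists N : nat, B * u ^+ 2 / e < N%:R.
  exists (Num.bound (B * u ^+ 2 / e)).
  by rewrite archi_boundP.
have N0 : (0 < N)%N.
  by rewrite -(ltr_nat R) (le_lt_trans _ hN).
apply: le_trans (step N N0) _; rewrite lerD2l ler_pdivrMr ?ltr0n //.
by move: hN; rewrite ltr_pdivrMr // [e * _]mulrC => /ltW.
Qed.

Section KnightMean.
Context (d : measure_display) (T : measurableType d) (R : realType)
  (P : probability T R) (X : {RV P >-> R}).
Variables (m M c1 c2 f0 : R).
Hypothesis m0 : 0 < m.
Hypothesis c10 : 0 < c1.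
Hypothesis c20 : 0 < c2.
Hypothesis f0b : m <= f0 <= M.
Hypothesis FE : forall x, `|x| <= c1 ->
  `|distr_fun X x - distr_fun X 0 - x * f0| <= c2 * x ^+ 2.
Local Notation F := (distr_fun X).

(* With this constant the expansion of [F] at 0, assumed for [|x| <= c1], holds
   for every [x]. *)
Definition cub : R := c2 + c1 ^- 2 + M / c1.
Local Notation c3 := cub.
Definition gmean (u : R) : R := EP P (fun w => kn (X w) u).
Local Notation G := gmean.

Let M0 : 0 < M. Proof. by have := m0; case/andP: f0b => h1 h2 h3; lra. Qed.

Lemma cub_gt0 : 0 < c3.
Proof.
rewrite /cub; have := exprn_gt0 2 c10; rewrite -invr_gt0 => ?.
have := c20; have := divr_gt0 M0 c10; lra.
Qed.

Lemma distr_fun01 x : 0 <= F x <= 1.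
Proof.
rewrite distr_funE fine_ge0 //= -[leRHS]/(fine 1%E) fine_le ?fin_num_measure //.
  by rewrite -[X in measurable X]/(X @^-1` [set y | y <= x]); apply: RV_preimage;
    rewrite (_ : [set y | _] = `]-oo, x]%classic) //;
    apply/seteqP; split=> y /=; rewrite in_itv.
apply: probability_le1.
by rewrite -[X in measurable X]/(X @^-1` [set y | y <= x]); apply: RV_preimage;
  rewrite (_ : [set y | _] = `]-oo, x]%classic) //;
  apply/seteqP; split=> y /=; rewrite in_itv.
Qed.

Lemma distr_fun_quad x : `|F x - F 0 - x * f0| <= c3 * x ^+ 2.
Proof.
have x2 := sqr_ge0 x.
have i0 : 0 < c1 ^- 2 by rewrite invr_gt0 exprn_gt0.
have j0 : 0 < M / c1 := divr_gt0 M0 c10.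
have [xc|xc] := lerP `|x| c1.
  by apply: le_trans (FE xc) _; rewrite /cub; nra.
have /andP [a1 a2] := distr_fun01 x; have /andP [b1 b2] := distr_fun01 0.
have h1 : 1 <= c1 ^- 2 * x ^+ 2.
  rewrite mulrC ler_pdivlMr ?exprn_gt0 // mul1r -[x ^+ 2]real_normK ?num_real //.
  by rewrite lerXn2r ?nnegrE // ltW.
have h2 : M * `|x| <= M / c1 * x ^+ 2.
  rewrite -mulrA ler_pM2l // mulrC ler_pdivlMr // -[x ^+ 2]real_normK ?num_real //.
  by rewrite expr2 ler_wpM2l // ltW.
apply: le_trans (ler_normB _ _) _.
have h3 : `|F x - F 0| <= 1 by apply/ler_normlP; split; lra.
have h4 : `|x * f0| <= M * `|x|.
  rewrite normrM mulrC ler_wpM2r // ger0_norm; first by case/andP: f0b.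
  by have := m0; case/andP: f0b => ? ? ?; lra.
have h5 : 0 <= c2 * x ^+ 2 by rewrite mulr_ge0 ?(ltW c20).
by rewrite /cub !mulrDl; lra.
Qed.

Lemma mpred_le x : measurable [set w | X w <= x].
Proof.
rewrite -[Y in measurable Y]/(X @^-1` [set y | y <= x]); apply: RV_preimage.
by rewrite (_ : [set y | _] = `]-oo, x]%classic).
Qed.

Lemma bmf_kn u : bmf (fun w => kn (X w) u).
Proof.
split; first by apply: (measurableT_comp (@measurable_kn R u)).
exists `|u| => w.
have h : `|u| <= `|u| by [].
have := kn_lip (X w) h (_ : `|0| <= `|u|).
rewrite kn0 !subr0 normr0 => /(_ (normr_ge0 _)) h1; apply: le_trans h1 _.
by case: (lerP `|X w| `|u|) => _; rewrite /= ?mul1r ?mul0r.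
Qed.

Lemma gmean_incr u v : u <= v ->
  (v - u) * (F u - F 0) <= G v - G u <= (v - u) * (F v - F 0).
Proof.
move=> uv.
have bp x := bmf_pred R (mpred_le x).
have bd x := bmfD (bp x) (bmfZ (-1) (bp 0)).
have E x : EP P (fun w => (v - u) * ((X w <= x)%R%:R + -1 * (X w <= 0)%R%:R)) =
    (v - u) * (F x - F 0).
  rewrite EPZ // EPD //; last exact: bmfZ.
  by rewrite EPZ // !EP_pred ?mulN1r -?distr_funE //; exact: mpred_le.
have E2 : G v - G u = EP P (fun w => kn (X w) v + -1 * kn (X w) u).
  rewrite EPD ?EPZ ?mulN1r //; try exact: bmf_kn.
  by apply: bmfZ; exact: bmf_kn.
have b2 : bmf (fun w => kn (X w) v + -1 * kn (X w) u).
  by apply: bmfD; [|apply: bmfZ]; exact: bmf_kn.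
apply/andP; rewrite E2 -!E; split; apply: EP_le => //; try exact: bmfZ.
- by move=> w; rewrite !mulN1r; have /andP [] := kn_incr (X w) uv.
- by move=> w; rewrite !mulN1r; have /andP [] := kn_incr (X w) uv.
Qed.

Lemma gmean0 : G 0 = 0.
Proof.
rewrite /gmean (_ : (fun w => kn (X w) 0) = fun=> 0) ?EP_cst //.
by apply/funext => w; rewrite kn0.
Qed.

(** Integrates the expansion of [F]. On [[a, b]] the bounds of [gmean_incr] use [F] at an end where
    the quadratic term calls for the midpoint, a mismatch of at most [M / 2 * (b - a) ^+ 2] that
    [telescope_bound] removes. *)
Lemma gmean_quad u : `|G u - f0 * u ^+ 2 / 2| <= c3 * `|u| ^+ 3.
Proof.
have := @telescope_bound R (fun u => G u - f0 * u ^+ 2 / 2) (c3 * u ^+ 2) (M / 2) u.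
rewrite gmean0 expr0n /= mulr0 mul0r subr0 subr0.
have -> : c3 * u ^+ 2 * `|u| = c3 * `|u| ^+ 3.
  by rewrite -[u ^+ 2]real_normK ?num_real // -mulrA -exprSr.
move=> H; apply: H => [|a b]; first by rewrite divr_ge0 // ltW // M0.
move=> au bu ab.
have sq x : `|x| <= `|u| -> c3 * x ^+ 2 <= c3 * u ^+ 2.
  move=> xu; rewrite ler_pM2l ?cub_gt0 // -[x ^+ 2]real_normK ?num_real //.
  by rewrite -[u ^+ 2]real_normK ?num_real // lerXn2r ?nnegrE.
have /andP [g1 g2] := gmean_incr ab.
have /ler_normlP [qa1 qa2] := distr_fun_quad a.
have /ler_normlP [qb1 qb2] := distr_fun_quad b.
have sa := sq _ au; have sb := sq _ bu.
have ba : 0 <= b - a by lra.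
have /andP [fm fM] := f0b.
have k1 : (b - a) * (F b - F 0) <= (b - a) * (b * f0 + c3 * u ^+ 2).
  by rewrite ler_wpM2l //; lra.
have k2 : (b - a) * (a * f0 - c3 * u ^+ 2) <= (b - a) * (F a - F 0).
  by rewrite ler_wpM2l //; lra.
have k3 : f0 * (b - a) ^+ 2 <= M * (b - a) ^+ 2 by rewrite ler_wpM2r ?sqr_ge0.
by rewrite !expr2 in k3 *; apply/ler_normlP; split; nra.
Qed.

(** Effect on the mean of a further step [v], meant for a step along a noise column. The first term
    is kept exact, since its sum over the sample is controlled through [QHS]. The 1 in the constant
    serves [|v| > 1], where the increment is at most [|v| <= v ^+ 2]. *)
Lemma gmean_diff u v : `|u| <= 1 ->
  G (u + v) - G u <= v * f0 * u + (1 + M + 2 * c3) * v ^+ 2 + 2 * c3 * `|v| * u ^+ 2.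
Proof.
move=> u1.
have c30 := cub_gt0; have /andP [fm fM] := f0b.
have h1 : G (u + v) - G u <= v * (F (u + v) - F 0).
  have [v0|v0] := lerP 0 v.
    have uv : u <= u + v by rewrite lerDl.
    by have /andP [_] := gmean_incr uv; rewrite addrAC subrr add0r.
  have uv : u + v <= u by rewrite gerDl ltW.
  by have /andP [h _] := gmean_incr uv; lra.
apply: le_trans h1 _.
have v2 := sqr_ge0 v; have nv := normr_ge0 v; have u2 := sqr_ge0 u.
have vE : v ^+ 2 = `|v| ^+ 2 by rewrite real_normK ?num_real.
have [v1|v1] := lerP `|v| 1.
  have /ler_normlP [q1 q2] := distr_fun_quad (u + v).
  have h2 : v * (F (u + v) - F 0) <= v * ((u + v) * f0) + `|v| * (c3 * (u + v) ^+ 2).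
    rewrite -lerBlDl -mulrBr; apply: le_trans (ler_norm _) _.
    by rewrite normrM ler_wpM2l //; apply/ler_normlP; split; lra.
  have h3 : `|v| * (c3 * (u + v) ^+ 2) <= `|v| * (c3 * (2 * u ^+ 2 + 2 * v ^+ 2)).
    rewrite ler_wpM2l // ler_pM2l //; have := sqr_ge0 (u - v); nra.
  have h4 : `|v| * (c3 * (2 * v ^+ 2)) <= c3 * (2 * v ^+ 2).
    by rewrite ler_piMl // mulr_ge0 ?(ltW c30) // mulr_ge0.
  have h5 : v ^+ 2 * f0 <= v ^+ 2 * M by rewrite ler_wpM2l.
  rewrite !expr2 in h2 h3 h4 h5 v2 *; nra.
have h2 : v * (F (u + v) - F 0) <= `|v|.
  apply: le_trans (ler_norm _) _; rewrite normrM ler_piMr //.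
  have /andP [? ?] := distr_fun01 (u + v); have /andP [? ?] := distr_fun01 0.
  by apply/ler_normlP; split; lra.
have h3 : `|v| <= v ^+ 2 by rewrite vE expr2 ler_peMl // ltW.
have h4 : - (v * f0 * u) <= M * v ^+ 2.
  rewrite -mulNr; apply: le_trans (ler_norm _) _; rewrite normrM normrN normrM.
  have h5 : `|v| * `|f0| <= v ^+ 2 * M.
    by have m0' := m0; apply: ler_pM => //; rewrite ger0_norm //; lra.
  rewrite mulrC in h5; apply: le_trans (_ : `|v| * `|f0| <= _).
    by rewrite ler_piMr // mulr_ge0.
  by rewrite mulrC [X in _ <= X]mulrC.
have : 0 <= 2 * c3 * v ^+ 2 by rewrite mulr_ge0 // mulr_ge0 // ltW.
have : 0 <= 2 * c3 * `|v| * u ^+ 2 by rewrite mulr_ge0 // mulr_ge0 // mulr_ge0 // ltW.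
lra.
Qed.

Lemma small_ball_prob b : 0 < b ->
  fine (P [set w | `|X w| <= b]) <= 3 * M * b + 5 * c3 * b ^+ 2.
Proof.
move=> b0; have c30 := cub_gt0; have /andP [fm fM] := f0b.
have mI : measurable [set w | `|X w| <= b].
  have -> : [set w | `|X w| <= b] = X @^-1` `[- b, b]%classic.
    by apply/seteqP; split=> w /=; rewrite in_itv /= ler_norml.
  exact: RV_preimage.
(* The point [- (2 * b)] in place of [- b] makes the two events disjoint, which costs [3 * b]
   instead of [2 * b] in the linear term. *)
have h1 : fine (P [set w | `|X w| <= b]) + F (- (2 * b)) <= F b.
  rewrite !distr_funE.
  have mJ := mpred_le (- (2 * b)).
  rewrite -fineD ?fin_num_measure // -measureU //; last first.
    apply/seteqP; split=> // w [/= /ler_normlP [? ?] ?].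
    by exfalso; lra.
  apply: fine_le; rewrite ?fin_num_measure //; try exact: measurableU; try exact: mpred_le.
  apply: le_measure; rewrite ?inE //; try exact: measurableU; try exact: mpred_le.
  by move=> w [/= /ler_normlP [? ?]|/= ?]; lra.
have /ler_normlP [p1 p2] := distr_fun_quad b.
have /ler_normlP [q1 q2] := distr_fun_quad (- (2 * b)).
have : b * f0 <= b * M by rewrite ler_pM2l.
rewrite !expr2 in p1 p2 q1 q2 *; nra.
Qed.

End KnightMean.

Section UniformInstances.
Context (d : measure_display) (T : measurableType d) (R : realType)
  (P : probability T R) (n s : nat) (eps : 'I_n -> {RV P >-> R}).
Hypothesis indep : mutually_independent eps.
Variables (b : R) (J : finType) (j0 : J) (S : 'M[R]_(n, s))
    (w : J -> 'I_n -> R) (rad v th t : R).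
Hypotheses (b0 : 0 < b) (rad0 : 0 <= rad) (th0 : 0 < th) (t0 : 0 < t).
Hypothesis wv : forall j, \sum_i w j i ^+ 2 <= v.
Hypothesis w0 : forall i, w j0 i = 0.
Hypothesis Ub : forall (x : 'cV[R]_s) j i, norm2 x <= rad ->
  `|(S *m x) i 0 + w j i| <= b.

Lemma uniform_kn : exists A : set T, [/\ measurable A,
    1 - 8 / t * (rad * Num.sqrt (\sum_i norm2 (row i S)^T ^+ 2 *
           fine (P [set om | `|eps i om| <= 2 * b])) + (ln #|J|%:R / th + 2 * th * v))
      <= fine (P A) &
    forall om, A om -> forall (x : 'cV[R]_s) j, norm2 x <= rad ->
      `|\sum_i (kn (eps i om) ((S *m x) i 0 + w j i) -
                gmean (eps i) ((S *m x) i 0 + w j i))| <= t].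
Proof.
apply: (@uniform_ball _ _ _ P n s eps indep (@kn R) b (fun e => `|e| <= b)
  (fun e => `|e| <= 2 * b)) => //.
- exact: kn0.
- exact: measurable_kn.
- by move=> e x y xb yb; exact: kn_lip.
- by move=> N h e e' u; exact: cell_kn.
- move=> N h e e' h0 hb bN E e'b; have := cell_loc h0 bN E e'b => eb.
  by apply: le_trans eb _; lra.
- rewrite (_ : [set e | _] = `[- (2 * b), 2 * b]%classic) //.
  by apply/seteqP; split=> e /=; rewrite in_itv /= ler_norml.
Qed.

(** [lin0] feels errors of any size, so [xi] is constantly true here and the whole sum of squared
    row norms appears. *)
Lemma uniform_lin (tau : R) : (forall i, P [set om | eps i om <= 0] = tau%:E) ->
  exists A : set T, [/\ measurable A,
    1 - 8 / t * (rad * Num.sqrt (\sum_i norm2 (row i S)^T ^+ 2)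
      + (ln #|J|%:R / th + 2 * th * v)) <= fine (P A) &
    forall om, A om -> forall (x : 'cV[R]_s) j, norm2 x <= rad ->
      `|\sum_i ((S *m x) i 0 + w j i) * ((eps i om <= 0)%R%:R - tau)| <= t].
Proof.
move=> Ptau.
have mE i : measurable [set om | eps i om <= 0].
  rewrite -[X in measurable X]/(eps i @^-1` [set y | y <= 0]); apply: RV_preimage.
  by rewrite (_ : [set y | _] = `]-oo, 0]%classic).
have Kl e x y : `|x| <= b -> `|y| <= b ->
    `|lin0 e x - lin0 e y| <= (true%:R : R) * `|x - y|.
  by move=> _ _; rewrite mul1r lin0_lip.
have Kc (N : nat) (h e e' u : R) : 0 < h -> `|u| + h < N%:R * h ->
    cell N h e = cell N h e' -> `|lin0 e u - lin0 e' u| <= h.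
  by move=> h0 _ E; rewrite /lin0 (cell_le0 E) subrr normr0 ltW.
have mT : measurable [set _ : R | true].
  by rewrite (_ : [set _ | _] = setT) //; apply/seteqP.
have [A [mA pA hA]] := @uniform_ball _ _ _ P n s eps indep (@lin0 R) b (fun=> true)
  (fun=> true) b0 (@lin00 R) (@measurable_lin0 R) Kl Kc (fun _ _ _ _ _ _ _ _ _ => isT)
  mT J j0 S w rad v th t rad0 th0 t0 wv w0 Ub.
exists A; split=> //.
  apply: le_trans pA; rewrite lerD2l lerN2 ler_wpM2l ?divr_ge0 ?(ltW t0) //.
  rewrite lerD2r ler_wpM2l // ler_wsqrtr // ler_sum // => i _.
  rewrite [X in P X](_ : _ = setT); last by apply/seteqP.
  by rewrite probability_setT /= mulr1.
move=> om Aom x j hx; have := hA om Aom x j hx.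
rewrite (eq_bigr (fun i => ((S *m x) i 0 + w j i) * ((eps i om <= 0)%R%:R - tau))) //.
move=> i _; rewrite mulrBr; congr (_ - _).
rewrite /meanK /lin0 EPZ; last exact: (bmf_pred R (mE i)).
by rewrite EP_pred // Ptau.
Qed.

End UniformInstances.

(** * Minimizers of the check loss *)

Lemma mulmx_lincomb (R : realType) n s (S : 'M[R]_(n, s)) (x v : 'cV[R]_s) t i :
  (S *m (x + t *: v)) i 0 = (S *m x) i 0 + t * (S *m v) i 0.
Proof. by rewrite mulmxDr -scalemxAr mxE [X in _ + X]mxE. Qed.

Section CheckLoss.
Variables (R : realType) (tau : R).
Hypothesis tau01 : 0 < tau < 1.

Lemma rhoE u : rho tau u = tau * u + Num.max 0 (- u).
Proof.
by rewrite /rho; have [u0|u0] := leP u 0; [rewrite max_r|rewrite max_l]; rewrite /=; lra.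
Qed.

Lemma rhoD u v : rho tau (u + v) <= rho tau u + rho tau v.
Proof.
rewrite !rhoE mulrDr.
suff : Num.max 0 (- (u + v)) <= Num.max 0 (- u) + Num.max 0 (- v) by lra.
by rewrite opprD; case: (leP 0 (- u)); case: (leP 0 (- v)); case: (leP 0 (- u - v)) => * ; lra.
Qed.

Lemma rhoZ c u : 0 <= c -> rho tau (c * u) = c * rho tau u.
Proof.
move=> c0; rewrite !rhoE mulrDr mulrCA; congr (_ + _).
by rewrite -mulrN -[X in Num.max X _](mulr0 c) maxr_pMr.
Qed.

Lemma rho_sum (I : finType) (c u : I -> R) : (forall i, 0 <= c i) ->
  rho tau (\sum_i c i * u i) <= \sum_i c i * rho tau (u i).
Proof.
move=> c0; elim/big_rec2: _ => [|i x y _ h]; first by rewrite /rho mul0r.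
by apply: le_trans (rhoD _ _) _; rewrite rhoZ // lerD2l.
Qed.

Lemma rho_step r t a : (r = 0 -> a = 0) -> (0 < r -> t * a <= r) ->
  (r < 0 -> r <= t * a) ->
  rho tau (r - t * a) = rho tau r - t * (a * (tau - (r <= 0)%R%:R)).
Proof.
rewrite /rho; case: (ltrgt0P r) => [r0|r0|->] h0 hp hn.
- have ta := hp isT; have [e|e] := leP (r - t * a) 0; rewrite /=; last by lra.
  have te : t * a = r by lra.
  by rewrite te subrr mul0r !subr0 mulrA te subrr.
- have ta := hn isT; have -> : r - t * a <= 0 by lra.
  by rewrite /=; lra.
- by rewrite h0 // mulr0 subrr lexx; lra.
Qed.

Definition resid_loss n s (S : 'M[R]_(n, s)) (y : 'cV[R]_n) (x : 'cV[R]_s) : R :=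
  \sum_i rho tau (y i 0 - (S *m x) i 0).

(* Vertices of the polyhedral loss: [x] is determined by its zero residuals.
   There are finitely many, so picking the best one is measurable in [y]. *)
Definition basic n s (S : 'M[R]_(n, s)) (y : 'cV[R]_n) (x : 'cV[R]_s) : Prop :=
  forall v : 'cV[R]_s,
    (forall i, y i 0 - (S *m x) i 0 = 0 -> (S *m v) i 0 = 0) -> v = 0.

(** A pivot as in the simplex method. A direction that keeps all zero residuals at 0, oriented so
    that the loss does not increase, is followed until the first nonzero residual vanishes; the loss
    is linear up to there, and the number of nonzero residuals drops. *)
Lemma basic_improve n s (S : 'M[R]_(n, s)) (y : 'cV[R]_n) (x : 'cV[R]_s) :
  (forall v : 'cV[R]_s, S *m v = 0 -> v = 0) ->
  exists2 x', basic S y x' & resid_loss S y x' <= resid_loss S y x.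
Proof.
move=> inj.
have [k] := ubnP #|[set i | y i 0 - (S *m x) i 0 != 0]%SET|.
elim: k x => // k IH x hk.
have [bx|] := pselect (basic S y x); first by exists x.
move/existsNP => [v0 /not_implyP [zv0 v00]].
pose r i := y i 0 - (S *m x) i 0.
pose psi i := tau - (r i <= 0)%R%:R.
have [v [zv vn0 slope]] : exists v : 'cV[R]_s,
    [/\ forall i, r i = 0 -> (S *m v) i 0 = 0, v <> 0 &
        0 <= \sum_i (S *m v) i 0 * psi i].
  have [h|h] := leP 0 (\sum_i (S *m v0) i 0 * psi i); first by exists v0.
  exists (- v0); split.
  - by move=> i ri; rewrite mulmxN mxE zv0 ?oppr0.
  - by move/eqP; rewrite oppr_eq0 => /eqP.
  - rewrite (eq_bigr (fun i => - ((S *m v0) i 0 * psi i))).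
      by rewrite sumrN oppr_ge0 ltW.
    by move=> i _; rewrite mulmxN mxE mulNr.
pose a i : R := (S *m v) i 0.
have [i1 ai1] : exists i, a i != 0.
  apply/not_existsP => h; apply: vn0; apply: inj; apply/matrixP => i j.
  by rewrite ord1 [RHS]mxE; have /negP := h i; rewrite negbK => /eqP.
(* Residuals that move towards 0. If there were none, every [a i * psi i] would be at most 0,
   strictly so at [i1], against the choice of orientation. *)
pose C := [pred i | 0 < r i * a i].
have [i0 Ci0] : exists i, C i.
  apply/not_existsP => h; move: slope; rewrite leNgt => /negP; apply.
  have neg i : a i * psi i <= 0 /\ (a i != 0 -> a i * psi i < 0).
    have [->|ai] := eqVneq (a i) 0; first by rewrite mul0r lexx.
    suff lt : a i * psi i < 0 by split=> //; exact: ltW.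
    have ri : r i != 0 by apply: contra ai => /eqP /zv h'; apply/eqP.
    have : r i * a i <= 0 by rewrite leNgt; apply/negP; exact: h.
    rewrite /psi; move/andP: tau01 => [t0 t1].
    case: (ltrgt0P (r i)) ri => [p|p|//] _ hra; rewrite /=.
      by rewrite subr0 pmulr_llt0 // lt_neqAle ai /= -(pmulr_rle0 _ p).
    by rewrite nmulr_llt0 ?subr_lt0 // lt_neqAle eq_sym ai /= -(nmulr_rle0 _ p).
  rewrite (bigD1 i1) //=; apply: (@lt_le_trans _ _ (0 + 0)); last by rewrite addr0.
  by apply: ltr_leD; [exact: (neg i1).2|apply: sumr_le0 => i _; exact: (neg i).1].
pose tm := \big[Num.min/r i0 / a i0]_(i | C i) (r i / a i).
have aC i : C i -> a i != 0.
  by rewrite inE /=; apply: contraTneq => ->; rewrite mulr0 ltxx.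
have posC i : C i -> 0 < r i / a i.
  move=> Ci; have : 0 < r i * a i by [].
  by rewrite -(pmulr_lgt0 (r i / a i) (x := a i ^+ 2)) ?exprn_even_gt0 ?aC //
    expr2 mulrA divfK ?aC // mulrC.
have [i2 Ci2 tmE] : exists2 i, C i & tm = r i / a i.
  rewrite /tm; apply: (big_ind (fun z => exists2 i, C i & z = r i / a i)).
  - by exists i0.
  - move=> z1 z2 [i Ci ->] [j Cj ->].
    by case: (leP (r i / a i) (r j / a j)) => _; [exists i|exists j].
  - by move=> i Ci; exists i.
have tmle i : C i -> tm <= r i / a i by move=> Ci; exact: bigmin_le_cond.
have tm0 : 0 < tm by rewrite tmE; exact: posC.
have step i : rho tau (r i - tm * a i) = rho tau (r i) - tm * (a i * psi i).
  apply: rho_step.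
  - exact: zv.
  - move=> ri; have [Ci|nC] := boolP (C i).
      have ai : 0 < a i by rewrite -(pmulr_rgt0 _ ri).
      by rewrite -ler_pdivlMr // tmle.
    apply: le_trans (ltW ri); rewrite pmulr_rle0 // -(pmulr_rle0 _ ri).
    by rewrite leNgt.
  - move=> ri; have [Ci|nC] := boolP (C i).
      have ai : a i < 0 by rewrite -(nmulr_rgt0 _ ri).
      by rewrite -ler_ndivlMr // tmle.
    apply: le_trans (ltW ri) _; rewrite pmulr_rge0 // -(nmulr_rle0 _ ri).
    by rewrite leNgt.
have resE i : y i 0 - (S *m (x + tm *: v)) i 0 = r i - tm * a i.
  by rewrite mulmx_lincomb opprD addrA.
have lt : (#|[set i | (y i 0 - (S *m (x + tm *: v)) i 0 != 0)%R]%SET| < k)%N.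
  rewrite ltnS in hk; apply: leq_trans hk; apply: proper_card; apply/properP; split.
    apply/fintype.subsetP => i; rewrite !inE resE; apply: contra => /eqP ri.
    by rewrite /a (zv i) // mulr0 subr0; apply/eqP.
  exists i2; rewrite !inE ?resE.
    by apply: contraTneq Ci2 => e; rewrite inE /= /r e mul0r ltxx.
  by rewrite negbK tmE divfK ?aC // subrr.
have [x' bx' lx'] := IH _ lt; exists x' => //; apply: le_trans lx' _.
rewrite /resid_loss (eq_bigr (fun i => rho tau (r i) - tm * (a i * psi i))); last first.
  by move=> i _; rewrite resE step.
by rewrite sumrB -mulr_sumr gerBl mulr_ge0 // ltW.
Qed.

Definition mask_mx n (I : {set 'I_n}) : 'M[R]_n := diag_mx (\row_i (i \in I)%:R).

(** Least squares on the rows in [I]. It is linear in [y], hence measurable, and total: where the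
    normal equations are singular it is one more harmless competitor. *)
Definition cand n s (S : 'M[R]_(n, s)) (y : 'cV[R]_n) (I : {set 'I_n}) : 'cV[R]_s :=
  invmx (S^T *m mask_mx I *m S) *m (S^T *m mask_mx I *m y).

(** With [I] the set of zero residuals, a vector in the kernel of the normal matrix is annihilated
    by the rows in [I], so it vanishes because [x] is basic. *)
Lemma basic_cand n s (S : 'M[R]_(n, s)) (y : 'cV[R]_n) (x : 'cV[R]_s) :
  basic S y x -> exists I, x = cand S y I.
Proof.
move=> bx; pose I := [set i | y i 0 - (S *m x) i 0 == 0]%SET; exists I.
have DI (v : 'cV[R]_n) i : (mask_mx I *m v) i 0 = (i \in I)%:R * v i 0.
  by rewrite mul_diag_mx !mxE.
have e : mask_mx I *m y = mask_mx I *m (S *m x).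
  apply/matrixP => i j; rewrite ord1 !DI inE subr_eq0.
  by case: eqP => [->|]; rewrite ?mul0r.
have U : S^T *m mask_mx I *m S \in unitmx.
  rewrite -row_free_unit -kermx_eq0; apply/eqP/row_matrixP => k.
  rewrite row0; set u := row k _.
  have hu : u *m (S^T *m mask_mx I *m S) = 0 by rewrite -row_mul mulmx_ker row0.
  suff : u^T = 0 by move/(congr1 trmx); rewrite trmxK trmx0.
  apply: bx => i ri.
  have : (u *m (S^T *m mask_mx I *m S) *m u^T) 0 0 = 0 by rewrite hu mul0mx mxE.
  have -> : u *m (S^T *m mask_mx I *m S) *m u^T =
      (S *m u^T)^T *m (mask_mx I *m (S *m u^T)).
    by rewrite trmx_mul trmxK !mulmxA.
  rewrite dotE (eq_bigr (fun i => (i \in I)%:R * (S *m u^T) i 0 ^+ 2)); last first.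
    by move=> j _; rewrite DI expr2 mulrCA.
  move/eqP; rewrite psumr_eq0 => [/allP h|j _]; last by rewrite mulr_ge0 // sqr_ge0.
  have := h i; rewrite mem_index_enum => /(_ isT).
  by rewrite inE ri eqxx mul1r sqrf_eq0 => /eqP.
have E : S^T *m mask_mx I *m y = (S^T *m mask_mx I *m S) *m x by rewrite -mulmxA e !mulmxA.
by rewrite /cand E mulKmx.
Qed.

(** The residual [r i] is a convex combination, with weights proportional to [h] and to the [|b j|],
    of [r i - (Q b) i] and of the residuals after a step of length [h] along a single column, signed
    like [b j]. Convexity of [rho] turns the bounds for single columns into one for [b]. *)
Lemma nullity n q (Q : 'M[R]_(n, q)) (r : 'I_n -> R) (b : 'cV[R]_q) (h c : R) :
  0 < h ->
  (forall (e : bool) j, \sum_i rho tau (r i + (-1) ^+ e * h * Q i j) <=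
     \sum_i rho tau (r i) + h * c) ->
  \sum_i rho tau (r i) <= \sum_i rho tau (r i - (Q *m b) i 0)
     + c * \sum_j `|b j 0|.
Proof.
move=> h0 hyp; set L := (\sum_j `|b j 0|).
have L0 : 0 <= L by exact: sumr_ge0.
pose e j := b j 0 < 0.
have bE j : b j 0 = (-1) ^+ (e j) * `|b j 0|.
  by apply: realEsign; exact: num_real.
have pt i : (h + L) * rho tau (r i) <= h * rho tau (r i - (Q *m b) i 0) +
    \sum_j `|b j 0| * rho tau (r i + (-1) ^+ (e j) * h * Q i j).
  rewrite -rhoZ ?addr_ge0 ?(ltW h0) //.
  have -> : (h + L) * r i = h * (r i - (Q *m b) i 0) +
      \sum_j `|b j 0| * (r i + (-1) ^+ (e j) * h * Q i j).
    under eq_bigr do rewrite mulrDr.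
    rewrite big_split /= -mulr_suml -/L mulrBr mulrDl.
    have -> : \sum_j `|b j 0| * ((-1) ^+ (e j) * h * Q i j) = h * (Q *m b) i 0.
      rewrite mxE mulr_sumr; apply: eq_bigr => j _; rewrite [in RHS]bE; ring.
    by ring.
  apply: le_trans (rhoD _ _) _; rewrite rhoZ ?(ltW h0) // lerD2l.
  exact: rho_sum.
have tot : (h + L) * \sum_i rho tau (r i) <=
   h * \sum_i rho tau (r i - (Q *m b) i 0) + L * (\sum_i rho tau (r i) + h * c).
  rewrite mulr_sumr; apply: le_trans (ler_sum _ (fun i _ => pt i)) _.
  rewrite big_split /= -mulr_sumr lerD2l exchange_big /= /L mulr_suml.
  apply: ler_sum => j _; rewrite -mulr_sumr ler_wpM2l //; exact: hyp.
rewrite -(ler_pM2l h0); lra.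
Qed.

Lemma resid_loss_convex n s (S : 'M[R]_(n, s)) (y : 'cV[R]_n) (x x' : 'cV[R]_s) th :
  0 <= th <= 1 ->
  resid_loss S y (x + th *: (x' - x)) <=
  (1 - th) * resid_loss S y x + th * resid_loss S y x'.
Proof.
move=> /andP [th0 th1]; rewrite /resid_loss !mulr_sumr -big_split; apply: ler_sum => i _.
have -> : y i 0 - (S *m (x + th *: (x' - x))) i 0 =
  (1 - th) * (y i 0 - (S *m x) i 0) + th * (y i 0 - (S *m x') i 0).
  have -> : (S *m x') i 0 = (S *m x) i 0 + (S *m (x' - x)) i 0.
    by rewrite -[X in _ + X]mul1r -mulmx_lincomb scale1r subrKC.
  by rewrite mulmx_lincomb; ring.
by apply: le_trans (rhoD _ _) _; rewrite !rhoZ // subr_ge0.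
Qed.

End CheckLoss.

(** * Measurable choice of a minimizer *)

Section MeasurableArgmin.
Context (d : measure_display) (T : measurableType d) (R : realType).

Lemma measurable_mulmx n s (A : 'M[R]_(s, n)) (y : T -> 'cV[R]_n) :
  measurable_vector y -> measurable_vector (fun w => A *m y w).
Proof.
move=> my j.
rewrite (_ : (fun w => _) = (fun w => \sum_k A j k * y w k 0)); last first.
  by apply/funext => w; rewrite mxE.
by apply: measurable_sum => k; apply: measurable_funM.
Qed.

Lemma measurable_best (I : finType) (s : nat) (i0 : I) (c : I -> T -> 'cV[R]_s)
    (L : T -> 'cV[R]_s -> R) :
  (forall i, measurable_vector (c i)) ->
  (forall b, measurable_vector b -> measurable_fun setT (fun w => L w (b w))) ->
  exists b, measurable_vector b /\ forall w i, L w (b w) <= L w (c i w).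
Proof.
move=> mc mL.
suff S (l : seq I) : exists b, measurable_vector b /\
    forall w i, i \in i0 :: l -> L w (b w) <= L w (c i w).
  have [b [mb hb]] := S (enum I); exists b; split=> // w i.
  by apply: hb; rewrite inE mem_enum orbT.
elim: l => [|i l [b [mb hb]]].
  by exists (c i0); split=> // w i; rewrite inE => /eqP ->.
exists (fun w => if L w (c i w) <= L w (b w) then c i w else b w); split.
  move=> j.
  rewrite (_ : (fun w => _) = (fun w => if L w (c i w) <= L w (b w) then c i w j 0 else b w j 0)).
    apply: measurable_fun_if => //.
    - by apply: measurable_fun_ler; exact: mL.
    - by apply: measurable_funTS; exact: mc.
    - by apply: measurable_funTS; exact: mb.
  by apply/funext => w; case: ifP.
move=> w k; rewrite !inE => /or3P [/eqP ->|/eqP ->|kl].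
- case: ifP => h; last by apply: hb; rewrite inE eqxx.
  by apply: le_trans h _; apply: hb; rewrite inE eqxx.
- by case: ifP => // /negbT; rewrite -ltNge => /ltW.
- case: ifP => h; last by apply: hb; rewrite inE kl orbT.
  by apply: le_trans h _; apply: hb; rewrite inE kl orbT.
Qed.

Lemma measurable_rho (tau : R) : measurable_fun setT (rho tau).
Proof.
rewrite /rho; apply: measurable_funM => //; apply: measurable_funB => //.
have -> : (fun x : R => (x <= 0)%R%:R : R) = \1_`]-oo, 0]%classic.
  apply/funext => x; rewrite indicE; congr (nat_of_bool _)%:R.
  by apply/idP/idP; rewrite inE /= in_itv.
by apply: measurable_indic; exact: measurable_itv.
Qed.

(** Every point is dominated by a vertex and every vertex is a [cand], so the best of finitely many
    candidates is a global minimizer. *)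
Lemma oracle_exists (tau : R) n s (S : 'M[R]_(n, s)) (y : T -> 'cV[R]_n) :
  0 < tau < 1 -> (forall v : 'cV[R]_s, S *m v = 0 -> v = 0) ->
  measurable_vector y ->
  exists b, measurable_vector b /\
    forall w x, resid_loss tau S (y w) (b w) <= resid_loss tau S (y w) x.
Proof.
move=> tau01 inj my.
have [|b mb|b [mb hb]] := @measurable_best {set 'I_n} s finset.set0
  (fun I w => cand S (y w) I) (fun w x => resid_loss tau S (y w) x).
- by move=> I; do 2 apply: measurable_mulmx.
- apply: measurable_sum => i; apply: (measurableT_comp (measurable_rho tau)).
  by apply: measurable_funB; [exact: my|exact: (measurable_mulmx S mb i)].
exists b; split=> // w x.
have [x' bx' lx'] := basic_improve tau01 (y w) x inj.
have [I xI] := basic_cand bx'.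
by apply: le_trans lx'; rewrite xI.
Qed.

End MeasurableArgmin.

(* Convexity moves any competitor into the ball of radius [2 * r], so the
   optimality condition in the noise directions is needed only there. It takes
   the form of a finite difference with step [h], which avoids subgradients. *)
Lemma global_of_oracle (R : realType) (tau lam r h : R) n s q
    (X : 'M[R]_(n, s + q)) (y : 'cV[R]_n) (dhat : 'cV[R]_(s + q)) (b0 bh : 'cV[R]_s) :
  0 < tau < 1 -> 0 < h -> 0 < r ->
  (forall j, dhat (lshift q j) 0 = 0) -> (forall j, dhat (rshift s j) 0 = 1) ->
  (forall x, resid_loss tau (lsubmx X) y bh <= resid_loss tau (lsubmx X) y x) ->
  norm2 (bh - b0) <= r ->
  (forall x, norm2 (x - b0) <= 2 * r -> forall (e : bool) j,
    \sum_i rho tau (y i 0 - (lsubmx X *m x) i 0 + (-1) ^+ e * h * rsubmx X i j) <=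
    resid_loss tau (lsubmx X) y x + h * (n%:R * lam)) ->
  global_minimizer (arlasso_obj tau X y lam dhat) (col_mx bh 0).
Proof.
move=> tau01 h0 r0 d0 d1 bmin br fd b'.
set S := lsubmx X; set Q := rsubmx X.
have XE b : X *m b = S *m usubmx b + Q *m dsubmx b.
  by rewrite -{1}(hsubmxK X) -{1}(vsubmxK b) mul_row_col.
have objE b : arlasso_obj tau X y lam dhat b =
    \sum_i rho tau (y i 0 - (S *m usubmx b) i 0 - (Q *m dsubmx b) i 0)
    + n%:R * lam * \sum_j `|dsubmx b j 0|.
  rewrite /arlasso_obj /check_loss; congr (_ + _ * _).
    by apply: eq_bigr => i _; rewrite XE 2!mxE [(_ + _ : 'cV__) i 0]mxE opprD addrA.
  rewrite big_split_ord /= big1 ?add0r => [|j _]; last by rewrite d0 mul0r.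
  by apply: eq_bigr => j _; rewrite d1 mul1r mxE.
set x1 := usubmx b'; set b2 := dsubmx b'.
have Lh : arlasso_obj tau X y lam dhat (col_mx bh 0) = resid_loss tau S y bh.
  rewrite objE col_mxKu col_mxKd [X in _ * X]big1 ?mulr0 ?addr0 => [|j _]; last by rewrite mxE normr0.
  by apply: eq_bigr => i _; rewrite mulmx0 [(0 : 'cV__) _ _]mxE subr0.
rewrite Lh objE -/x1 -/b2.
set D := norm2 (x1 - bh).
have D0 : 0 <= D := norm2_ge0 _.
(* This shrinkage is positive, at most 1 and satisfies [th * D <= r], also when [D = 0]; so [xt]
   stays within [2 * r] of [b0]. *)
pose th := r / (r + D).
have th0 : 0 < th by rewrite divr_gt0 //; lra.
have th1 : th <= 1 by rewrite ler_pdivrMr; lra.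
have thD : th * D <= r.
  by rewrite /th mulrAC ler_pdivrMr; [nra|lra].
pose xt := bh + th *: (x1 - bh).
have xtr : norm2 (xt - b0) <= 2 * r.
  have -> : xt - b0 = (bh - b0) + th *: (x1 - bh) by rewrite /xt addrAC.
  by apply: le_trans (norm2D _ _) _; rewrite norm2Z ger0_norm ?(ltW th0) // -/D; lra.
have N := nullity (Q := Q) (th *: b2) h0 (fd xt xtr).
have l1 := bmin xt.
set c := n%:R * lam in N *.
have sumE : \sum_j `|(th *: b2) j 0| = th * \sum_j `|b2 j 0|.
  rewrite mulr_sumr; apply: eq_bigr => j _.
  by rewrite mxE normrM ger0_norm // ltW.
have cvx : \sum_i rho tau (y i 0 - (S *m xt) i 0 - (Q *m (th *: b2)) i 0) <=
   (1 - th) * resid_loss tau S y bh +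
   th * \sum_i rho tau (y i 0 - (S *m x1) i 0 - (Q *m b2) i 0).
  rewrite /resid_loss !mulr_sumr -big_split; apply: ler_sum => i _.
  have -> : y i 0 - (S *m xt) i 0 - (Q *m (th *: b2)) i 0 =
    (1 - th) * (y i 0 - (S *m bh) i 0) + th * (y i 0 - (S *m x1) i 0 - (Q *m b2) i 0).
    rewrite /xt mulmx_lincomb -scalemxAr [(_ *: _ : 'cV__) i 0]mxE.
    have -> : (S *m x1) i 0 = (S *m bh) i 0 + (S *m (x1 - bh)) i 0.
      by rewrite -[X in _ + X]mul1r -mulmx_lincomb scale1r subrKC.
    by ring.
  by apply: le_trans (rhoD _ _ _) _; rewrite !rhoZ // ?subr_ge0 ?(ltW th0).
rewrite sumE in N.
have l2 : resid_loss tau S y xt = \sum_i rho tau (y i 0 - (S *m xt) i 0) by [].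
rewrite -(ler_pM2l th0); rewrite -l2 in N; lra.
Qed.

(** * Positive semidefinite square roots *)

Section RealSpectral.
Variable R : realType.
Local Notation C := (complex R).
Local Notation toC := (real_complex R).

(** [N x i] is the squared modulus of a coordinate of [x] in a unitary complex eigenbasis of [A].
    Later arguments only involve quadratic forms, so the eigenvectors may remain complex; the
    polynomial [p] gives access to functions of [A]. *)
Lemma sym_quad n (A : 'M[R]_n.+1) : A^T = A ->
  exists (dd : 'I_n.+1 -> R) (N : 'cV[R]_n.+1 -> 'I_n.+1 -> R),
    [/\ forall i, eigenvalue A (dd i), forall x i, 0 <= N x i,
        forall x, \sum_i N x i = norm2 x ^+ 2 &
        forall (p : {poly R}) x,
          (x^T *m horner_mx A p *m x) 0 0 = \sum_i p.[dd i] * N x i].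
Proof.
move=> symA; pose Ac : 'M[C]_n.+1 := map_mx toC A.
have realc m k (B : 'M[R]_(m, k)) : map_mx toC B \is a mxOver Num.real.
  by apply/mxOverP => i j; rewrite mxE; apply/complex_realP; exists (B i j).
have herm : Ac \is hermsymmx.
  apply: realsym_hermsym; last exact: realc.
  by apply/is_hermitianmxP; rewrite expr0 scale1r map_mx_id // /Ac map_trmx symA.
have /orthomx_spectralP := hermitian_normalmx herm.
have := hermitian_spectral_diag_real herm.
have := spectral_unitarymx Ac.
move: (spectralmx Ac) (spectral_diag Ac) => U sp uU realsp spE.
have uUu := unitarymx_unit uU.
pose dd i := complex.Re (sp 0 i).
have ddE i : toC (dd i) = sp 0 i by apply: RRe_real; exact: (mxOverP realsp).
pose y (x : 'cV[R]_n.+1) := U *m map_mx toC x.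
pose N x i := complex.Re (`|y x i 0| ^+ 2).
have NE x i : toC (N x i) = `|y x i 0| ^+ 2.
  by apply: RRe_real; rewrite ger0_real // exprn_ge0.
have quad (p : {poly R}) x :
    (x^T *m horner_mx A p *m x) 0 0 = \sum_i p.[dd i] * N x i.
  apply: (@fmorph_inj _ _ toC).
  transitivity ((map_mx toC (x^T *m horner_mx A p *m x)) 0 0).
    by rewrite [RHS]mxE.
  rewrite !map_mxM map_horner_mx -/Ac spE.
  rewrite horner_mx_uconjC // horner_mx_diag.
  rewrite (invmx_unitary uU) -!mulmxA -/(y x) mulmxA.
  have -> : map_mx toC x^T *m map_mx Num.conj U^T = (map_mx Num.conj (y x))^T.
    rewrite /y map_mxM trmx_mul map_trmx; congr (_ *m _); last by rewrite map_trmx.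
    apply/matrixP => i j; rewrite !mxE.
    by apply/esym/CrealP/complex_realP; exists (x j i).
  move: (y x) (NE x) => z Nz.
  rewrite mxE rmorph_sum; apply: eq_bigr => i _.
  rewrite mul_diag_mx !mxE rmorphM /= Nz normCK -ddE.
  have := horner_map toC p (dd i); move=> /= ->.
  by rewrite mulrCA [X in _ * X]mulrC.
exists dd, N; split=> //.
- move=> i; have := eigenvalue_map toC A (dd i); move=> /= <-.
  rewrite [X in eigenvalue _ X]ddE -/Ac; apply/eigenvalueP; exists (row i U).
    rewrite spE -row_mul !mulmxA mulmxV // mul1mx row_mul.
    by rewrite row_diag_mx -scalemxAl -rowE.
  apply: contraTneq uUu => ui; rewrite unitmxE unitfE negbK.
  by rewrite (expand_det_row _ i) big1 // => j _; move/rowP/(_ j): ui; rewrite !mxE => ->; rewrite mul0r.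
- move=> x i; rewrite -(@lecR R) [X in _ <= X]NE.
  by rewrite exprn_ge0.
- move=> x; rewrite -dot_sqr.
  have := quad 1%:P x; rewrite horner_mx_C mulmx1 => -> .
  by apply: eq_bigr => i _; rewrite hornerC mul1r.
Qed.

Lemma interpolate (F : fieldType) (g : F -> F) (l : seq F) :
  exists p : {poly F}, forall x, x \in l -> p.[x] = g x.
Proof.
elim: l => [|a l [p hp]]; first by exists 0.
have [al|al] := boolP (a \in l).
  by exists p => x; rewrite inE => /orP [/eqP ->|]; apply: hp.
pose m := \prod_(x <- l) ('X - x%:P).
have ma : m.[a] != 0.
  by rewrite -[m.[a] != 0]/(~~ root m a) root_prod_XsubC.
exists (p + ((g a - p.[a]) / m.[a])%:P * m) => x; rewrite inE hornerD hornerCM.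
case/orP => [/eqP ->|xl]; first by rewrite divfK // subrKC.
have /eqP -> : m.[x] == 0 by rewrite -[_ == 0]/(root m x) root_prod_XsubC.
by rewrite mulr0 addr0 hp.
Qed.

Lemma trmx_horner n (A : 'M[R]_n.+1) (p : {poly R}) : A^T = A ->
  (horner_mx A p)^T = horner_mx A p.
Proof.
move=> sA; elim/poly_ind: p => [|p c IH]; first by rewrite rmorph0 trmx0.
rewrite !rmorphD !rmorphM /= horner_mx_X horner_mx_C raddfD /= tr_scalar_mx.
congr (_ + _); rewrite -mulmxE trmx_mul IH sA.
by apply: comm_mx_horner.
Qed.

Lemma sym_form_eq0 n (B : 'M[R]_n) : B^T = B ->
  (forall x : 'cV[R]_n, (x^T *m B *m x) 0 0 = 0) -> B = 0.
Proof.
move=> sB h; apply/matrixP => i j; rewrite [RHS]mxE.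
have e (k l : 'I_n) : ((delta_mx k 0 : 'cV[R]_n)^T *m B *m (delta_mx l 0 : 'cV[R]_n)) 0 0 = B k l.
  by rewrite trmx_delta -rowE -colE !mxE.
have E (u v : 'cV[R]_n) : ((u + v)^T *m B *m (u + v)) 0 0 =
   (u^T *m B *m u) 0 0 + (u^T *m B *m v) 0 0 +
   ((v^T *m B *m u) 0 0 + (v^T *m B *m v) 0 0).
  have -> : (u + v)^T = u^T + v^T by apply/matrixP => k l; rewrite !mxE.
  by rewrite !mulmxDl !mulmxDr mxE [X in X + _]mxE [X in _ + X]mxE.
have := h (delta_mx i 0 + delta_mx j 0); rewrite E !h !e.
have -> : B j i = B i j by rewrite -[in LHS]sB mxE.
by lra.
Qed.

Lemma form_bounds n (A : 'M[R]_n) (c C : R) : A^T = A ->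
  (forall a, eigenvalue A a -> c <= a <= C) ->
  forall x : 'cV[R]_n, c * norm2 x ^+ 2 <= (x^T *m A *m x) 0 0 <= C * norm2 x ^+ 2.
Proof.
case: n A => [|n] A sA h x.
  by rewrite norm2_sqr big_ord0 !mulr0 [A]thinmx0 mulmx0 mul0mx mxE lexx.
have [dd [N [ev N0 sN q]]] := sym_quad sA.
have := q 'X x; rewrite horner_mx_X => ->.
rewrite -sN !mulr_sumr; apply/andP; split; apply: ler_sum => i _;
  by rewrite hornerX ler_wpM2r //; have /andP [] := h _ (ev i).
Qed.

Lemma psd_eigenvalue n (A : 'M[R]_n) a : is_psd A -> eigenvalue A a -> 0 <= a.
Proof.
move=> [sA pA] /eigenvalueP [v vA v0].
have := pA v^T; rewrite trmxK vA -scalemxAl mxE.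
have -> : (v *m v^T) 0 0 = norm2 v^T ^+ 2 by rewrite -dot_sqr trmxK.
rewrite pmulr_lge0 // exprn_gt0 // norm2_gt0 //.
by apply: contra v0 => /eqP v0; rewrite -[v]trmxK v0 trmx0.
Qed.

(** The root is the polynomial in [A] that interpolates [Num.sqrt] at the eigenvalues: it is
    symmetric because [A] is, and the form of [p(A)^2 - A] vanishes at every vector. *)
Lemma sqrtmxP n (A : 'M[R]_n) : is_psd A ->
  is_psd (sqrtmx A) /\ sqrtmx A *m sqrtmx A = A.
Proof.
move=> pA; rewrite /sqrtmx; case: xgetP => [B -> //|no]; exfalso.
case: n A pA no => [|n] A pA no.
  apply: (no 0); split; last by rewrite mulmx0 [RHS]thinmx0.
  by split=> [|x]; rewrite ?trmx0 // mulmx0 mul0mx mxE.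
have sA := pA.1.
have [dd [N [ev N0 sN q]]] := sym_quad sA.
have [p hp] := interpolate (@Num.sqrt R) (codom dd).
have pE i : p.[dd i] = Num.sqrt (dd i) by apply: hp; exact: codom_f.
have dd0 i : 0 <= dd i := psd_eigenvalue pA (ev i).
apply: (no (horner_mx A p)); split.
  split; first exact: trmx_horner.
  by move=> x; rewrite q sumr_ge0 // => i _; rewrite pE mulr_ge0 ?sqrtr_ge0.
suff : horner_mx A (p * p - 'X) = 0.
  by rewrite rmorphB rmorphM /= horner_mx_X => /eqP; rewrite subr_eq0 => /eqP.
apply: sym_form_eq0; first exact: trmx_horner.
move=> x; rewrite q big1 // => i _.
by rewrite !hornerE pE -expr2 sqr_sqrtr // subrr mul0r.
Qed.

End RealSpectral.

(** * A central limit theorem for weighted Bernoulli sums *)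

Lemma lip_of_derive (R : realType) (f df : R -> R) (B x y : R) :
  (forall z : R, is_derive z 1 f (df z)) -> (forall z, `|df z| <= B) ->
  `|f y - f x| <= B * `|y - x|.
Proof.
move=> fd dB; wlog xy : x y / x <= y.
  move=> H; have [xy|yx] := leP x y; first exact: H.
  by rewrite distrC [`|y - x|]distrC; apply: H; exact: ltW.
have [|c _ ->] := @MVT_segment R f df x y xy (fun z _ => fd z).
  apply: continuous_subspaceT => z; apply: differentiable_continuous.
  by apply/derivable1_diffP; exact: ex_derive.
by rewrite normrM ler_wpM2r.
Qed.

Lemma lip_of_derive01 (R : realType) (f df : R -> R) (B : R) :
  (forall z : R, 0 <= z <= 1 -> is_derive z 1 f (df z)) ->
  (forall z, 0 <= z <= 1 -> `|df z| <= B) ->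
  `|f 1 - f 0| <= B.
Proof.
move=> fd dB.
have [z zI||c] := @MVT_segment R f df 0 1 ler01.
- by apply: fd; move: zI; rewrite in_itv /= => /andP [? ?]; rewrite !ltW.
- apply: derivable_within_continuous => z zI.
  by apply: ex_derive; apply: fd; move: zI; rewrite in_itv.
- by rewrite in_itv /= => cI ->; rewrite subr0 mulr1; exact: dB.
Qed.

Section GaussianSmoothing.
Variables (R : realType) (sg pk : R) (Phi : R -> R).
Hypothesis sg0 : 0 < sg.
Hypothesis pk0 : 0 < pk.
Let g (z : R) := pk * expR (- (z ^+ 2) / (sg ^+ 2 * 2)).
Hypothesis dPhi : forall z : R, is_derive z 1 Phi (g z).

Lemma d_density (z : R) : is_derive z 1 g (- z / sg ^+ 2 * g z).
Proof.
rewrite /g.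
have h : is_derive z 1 (fun z : R => - (z ^+ 2) / (sg ^+ 2 * 2)) (- z / sg ^+ 2).
  apply: is_derive_eq; rewrite ?scaler0 ?addr0 ?add0r /GRing.scale /=.
  by field; rewrite gt_eqF.
have h2 := @is_derive1_comp _ (@expR R) (fun z : R => - (z ^+ 2) / (sg ^+ 2 * 2)) z _ _
  (is_derive_expR (- (z ^+ 2) / (sg ^+ 2 * 2))) h.
apply: (is_derive_eq (is_deriveZ pk h2)).
rewrite /GRing.scale /=; ring.
Qed.

Variables (w : R).
Hypothesis w0 : 0 < w.
(** The derivative in [y] of [Phi (y / sqrt w)], a Gaussian density of variance [sg ^+ 2 * w] up to
    the normalization [pk]. The next two functions are its first and second derivatives. *)
Definition dens (y : R) := g (y / Num.sqrt w) / Num.sqrt w.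
Definition dens1 (y : R) := - y / (sg ^+ 2 * w) * dens y.
Definition dens2 (y : R) := (y ^+ 2 / (sg ^+ 2 * w) ^+ 2 - (sg ^+ 2 * w)^-1) * dens y.

Let sw0 : 0 < Num.sqrt w. Proof. by rewrite sqrtr_gt0. Qed.
Let sw2 : Num.sqrt w ^+ 2 = w. Proof. by rewrite sqr_sqrtr // ltW. Qed.

Lemma d_dens (y : R) : is_derive y 1 dens (dens1 y).
Proof.
rewrite /dens.
have h : is_derive y 1 (fun y : R => y / Num.sqrt w) (Num.sqrt w)^-1.
  by apply: is_derive_eq; rewrite !scaler0 add0r /GRing.scale /= mulr1.
have h2 := @is_derive1_comp _ g (fun y : R => y / Num.sqrt w) y _ _
  (d_density (y / Num.sqrt w)) h.
have h3 : is_derive y 1 (fun y : R => g (y / Num.sqrt w) * (Num.sqrt w)^-1)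
   ((Num.sqrt w)^-1 *: (- (y / Num.sqrt w) / sg ^+ 2 * g (y / Num.sqrt w) / Num.sqrt w)).
  have -> : (fun y : R => g (y / Num.sqrt w) * (Num.sqrt w)^-1) =
      (Num.sqrt w)^-1 *: (g \o (fun y : R => y / Num.sqrt w)).
    by apply/funext => z; rewrite mulrC.
  exact: is_deriveZ.
apply: (is_derive_eq h3).
rewrite /dens1 /dens /GRing.scale /= -{5}sw2; field.
by rewrite !gt_eqF.
Qed.

Lemma d_dens1 (y : R) : is_derive y 1 dens1 (dens2 y).
Proof.
have h : is_derive y 1 (fun y : R => - y / (sg ^+ 2 * w)) (- (sg ^+ 2 * w)^-1).
  by apply: is_derive_eq; rewrite !scaler0 add0r /GRing.scale /= mulrN mulr1.
have h2 := is_deriveM h (d_dens y).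
apply: (is_derive_eq h2).
rewrite /dens2 /dens1 /GRing.scale /=; field.
by rewrite !gt_eqF // exprn_gt0.
Qed.

(** With [t = y ^+ 2 / (2 * sg ^+ 2 * w)] the varying factor is [|2 * t - 1| * exp (- t)], at most 3
    since [t * exp (- t) <= 1]. *)
Lemma dens2_bound e y : 0 < e -> e ^+ 2 <= w ->
  `|dens2 y| <= 3 * pk / (sg ^+ 2 * e ^+ 3).
Proof.
move=> e0 ew.
have sg2 : 0 < sg ^+ 2 by rewrite exprn_gt0.
have ew' : e <= Num.sqrt w.
  by rewrite -(ler_pXn2r (n := 2)) ?nnegrE ?sqrtr_ge0 ?(ltW e0) // sw2.
pose t := y ^+ 2 / (sg ^+ 2 * w * 2).
have t0 : 0 <= t by rewrite divr_ge0 ?sqr_ge0 // !mulr_ge0 // ltW.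
have tE : expR (- t) * t <= 1.
  have := expR_ge1Dx t; have := expRxMexpNx_1 t; have := expR_gt0 (- t); nra.
have dE : dens y = pk / Num.sqrt w * expR (- t).
  rewrite /dens /g exprMn exprVn sw2 mulrAC; congr (_ * expR _).
  by rewrite /t; field; rewrite !gt_eqF.
have -> : dens2 y = (t * 2 - 1) / (sg ^+ 2 * w) * dens y.
  by rewrite /dens2 /t; field; rewrite !gt_eqF.
rewrite dE normrM normrM [X in _ * X * _]ger0_norm; last first.
  by rewrite invr_ge0 mulr_ge0 ?ltW.
have p1 : 0 <= pk / Num.sqrt w by rewrite divr_ge0 ?ltW.
rewrite [X in _ * X]ger0_norm; last by apply: mulr_ge0 => //; exact: expR_ge0.
have -> : `|t * 2 - 1| / (sg ^+ 2 * w) * (pk / Num.sqrt w * expR (- t)) =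
   (`|t * 2 - 1| * expR (- t)) * (pk / (sg ^+ 2 * (w * Num.sqrt w))).
  by field; rewrite !gt_eqF.
have a1 : `|t * 2 - 1| * expR (- t) <= 3.
  have : `|t * 2 - 1| <= t * 2 + 1 by apply/ler_normlP; split; lra.
  have e1 : expR (- t) <= 1 by rewrite expR_le1; lra.
  have e2 := expR_gt0 (- t); nra.
have a2 : pk / (sg ^+ 2 * (w * Num.sqrt w)) <= pk / (sg ^+ 2 * e ^+ 3).
  rewrite ler_pM2l // lef_pV2 ?posrE ?mulr_gt0 ?exprn_gt0 //.
  rewrite ler_pM2l // exprSr; apply: ler_pM => //; rewrite ?sqr_ge0 //; exact: ltW.
rewrite -[3 * pk / _]mulrA; apply: ler_pM => //.
by rewrite divr_ge0 ?(ltW pk0) // !mulr_ge0 ?ltW.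
Qed.

End GaussianSmoothing.

Section OneStep.
Variables (R : realType) (sg pk tau e : R) (Phi : R -> R).
Hypothesis sg0 : 0 < sg.
Hypothesis pk0 : 0 < pk.
Hypothesis e0 : 0 < e.
Hypothesis tau01 : 0 < tau < 1.
Hypothesis sgE : sg ^+ 2 = tau * (1 - tau).
Hypothesis dPhi : forall z : R,
  is_derive z 1 Phi (pk * expR (- (z ^+ 2) / (sg ^+ 2 * 2))).

(* [smooth v x] solves the heat equation in [(v, x)], so replacing a Bernoulli
   summand [a * (tau - b)] by an increase of [v] by [a ^+ 2] is exact up to third
   order. *)
Definition smooth (v x : R) : R := Phi (x / Num.sqrt v).

(** The path runs from variance [v + a ^+ 2] at [t = 0] to [v] at [t = 1]. With the profile
    [1 - t ^+ 2] the loss of variance contributes [t * a ^+ 2 * sg ^+ 2 * dens1], which matches for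
    each [t] the averaged second-order effect [t * k ^+ 2 * dens1] of the jump [k]. *)
Let w (v a t : R) : R := v + a ^+ 2 * (1 - t ^+ 2).

Lemma d_path (v a x k t : R) : 0 < v -> 0 <= t <= 1 ->
  is_derive t 1 (fun t : R => Phi ((x + t * k) / Num.sqrt (w v a t)))
    (k * dens sg pk (w v a t) (x + t * k) -
     t * a ^+ 2 * sg ^+ 2 * dens1 sg pk (w v a t) (x + t * k)).
Proof.
move=> v0 /andP [t0 t1].
have w0 : 0 < w v a t.
  rewrite /w; have : 0 <= a ^+ 2 * (1 - t ^+ 2); last by lra.
  by rewrite mulr_ge0 ?sqr_ge0 // subr_ge0 exprn_ile1.
have sw0 : 0 < Num.sqrt (w v a t) by rewrite sqrtr_gt0.
have sw2 : Num.sqrt (w v a t) ^+ 2 = w v a t by rewrite sqr_sqrtr // ltW.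
have dw : is_derive t 1 (w v a) (- (2 * t * a ^+ 2)).
  apply: is_derive_eq; rewrite ?scaler0 ?addr0 ?add0r /GRing.scale /=; ring.
have ds := @is_derive1_comp _ (@Num.sqrt R) (w v a) t _ _ (is_derive1_sqrt w0) dw.
have di := @is_deriveV _ (@Num.sqrt R \o w v a) t _ 1 (lt0r_neq0 sw0) ds.
have dl : is_derive t 1 (fun t : R => x + t * k) k.
  apply: is_derive_eq; rewrite ?scaler0 ?addr0 ?add0r /GRing.scale /=; ring.
have dm := is_deriveM dl di.
have dP := @is_derive1_comp _ Phi (fun t : R => (x + t * k) / Num.sqrt (w v a t)) t _ _
  (dPhi _) dm.
apply: (is_derive_eq dP).
rewrite /dens1 /dens /GRing.scale /=.
set E := expR _; rewrite -/E.
set s := Num.sqrt _ in sw0 sw2 E *; set W := w v a t in w0 sw2 *.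
rewrite -sw2; field.
by rewrite !gt_eqF.
Qed.

Lemma one_step (v a x : R) : e ^+ 2 <= v ->
  `|tau * smooth v (x + a * (tau - 1)) + (1 - tau) * smooth v (x + a * tau) -
    smooth (v + a ^+ 2) x| <= 6 * pk / (sg ^+ 2 * e ^+ 3) * `|a| ^+ 3.
Proof.
move=> ev; have v0 : 0 < v by apply: lt_le_trans ev; rewrite exprn_gt0.
have /andP [ta tb] := tau01.
set B := 3 * pk / (sg ^+ 2 * e ^+ 3).
have B0 : 0 <= B by rewrite divr_ge0 ?mulr_ge0 ?exprn_ge0 ?(ltW pk0) ?(ltW sg0) ?(ltW e0).
have -> : 6 * pk / (sg ^+ 2 * e ^+ 3) = 2 * B by rewrite /B; ring.
pose k1 := a * (tau - 1); pose k2 := a * tau.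
pose f (t : R) := tau * Phi ((x + t * k1) / Num.sqrt (w v a t)) +
   (1 - tau) * Phi ((x + t * k2) / Num.sqrt (w v a t)).
pose D k (t : R) := k * dens sg pk (w v a t) (x + t * k) -
     t * a ^+ 2 * sg ^+ 2 * dens1 sg pk (w v a t) (x + t * k).
have f1 : f 1 = tau * smooth v (x + a * (tau - 1)) + (1 - tau) * smooth v (x + a * tau).
  by rewrite /f /smooth /w expr1n subrr mulr0 addr0 !mul1r.
have f0 : f 0 = smooth (v + a ^+ 2) x.
  by rewrite /f /smooth /w expr0n /= subr0 mulr1 !mul0r addr0; ring.
rewrite -f1 -f0.
apply: (@lip_of_derive01 R f (fun t => tau * D k1 t + (1 - tau) * D k2 t)).
  move=> t tI.
  have h1 := is_deriveZ tau (d_path a x k1 v0 tI).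
  have h2 := is_deriveZ (1 - tau) (d_path a x k2 v0 tI).
  exact: is_deriveD h1 h2.
move=> t /andP [t0 t1]; rewrite /D.
set W := w v a t.
have vW : v <= W.
  by rewrite /W /w lerDl mulr_ge0 ?sqr_ge0 // subr_ge0 exprn_ile1.
have W0 : 0 < W by exact: lt_le_trans vW.
have eW : e ^+ 2 <= W by exact: le_trans vW.
have lq1 y : `|dens1 sg pk W y - dens1 sg pk W x| <= B * `|y - x|.
  apply: (@lip_of_derive R _ (dens2 sg pk W)) => z; first exact: d_dens1.
  exact: dens2_bound.
(* Taylor's formula with quadratic remainder: after subtraction of the linear part, slopes between
   [x] and [y] are at most [B * |y - x|]. *)
have lq y : `|dens sg pk W y - dens sg pk W x - dens1 sg pk W x * (y - x)| <= B * (y - x) ^+ 2.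
  have := @telescope_bound R (fun u => dens sg pk W (x + u) - dens1 sg pk W x * u)
    (B * `|y - x|) 0 (y - x) (lexx _).
  rewrite addr0 mulr0 subr0 subrKC addrAC -mulrA -expr2 real_normK ?num_real //.
  apply=> a' b' ha hb ab; rewrite mul0r addr0.
  have [||c cI] := @MVT_segment R (fun u => dens sg pk W (x + u) - dens1 sg pk W x * u)
     (fun u => dens1 sg pk W (x + u) - dens1 sg pk W x) a' b' ab.
  - move=> z _.
    have hz : is_derive z 1 (fun u : R => x + u) 1.
      by have := is_deriveD (is_derive_cst x z 1) (is_derive_id z (1 : R)); rewrite add0r.
    have h1 := @is_derive1_comp _ (dens sg pk W) (fun u : R => x + u) z _ _
      (d_dens pk sg0 W0 (x + z)) hz.
    have h2 := is_deriveZ (dens1 sg pk W x) (is_derive_id z 1).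
    have h3 := is_deriveB h1 h2.
    by apply: (is_derive_eq h3); rewrite /GRing.scale /= !mulr1.
  - apply: derivable_within_continuous => z _.
    apply: derivableB; last by apply: derivableM.
    exact: ex_derive.
  move=> ->; rewrite normrM [`|b' - a'|]ger0_norm ?subr_ge0 // ler_wpM2r ?subr_ge0 //.
  apply: le_trans (lq1 _) _; rewrite addrAC subrr add0r ler_wpM2l //.
  have /andP [c1 c2] : a' <= c <= b' by move: cI; rewrite in_itv.
  move: ha hb => /ler_normlP [? ?] /ler_normlP [? ?]; apply/ler_normlP; split; lra.
set q0 := dens sg pk W x in lq; set q1 := dens1 sg pk W x in lq lq1.
have kb1 : `|k1| <= `|a|.
  by rewrite normrM ler_piMr // ler_norml; apply/andP; split; lra.
have kb2 : `|k2| <= `|a|.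
  by rewrite normrM ler_piMr // ler_norml; apply/andP; split; lra.
have bnd k : `|k| <= `|a| ->
   `|k * (dens sg pk W (x + t * k) - q0 - q1 * (t * k)) -
     t * a ^+ 2 * sg ^+ 2 * (dens1 sg pk W (x + t * k) - q1)| <= 2 * B * `|a| ^+ 3.
  move=> ka.
  have ex : x + t * k - x = t * k by rewrite addrAC subrr add0r.
  have tk : `|t * k| <= `|a|.
    by rewrite normrM (ger0_norm t0); apply: le_trans ka; rewrite ler_piMl.
  have h1 := lq (x + t * k); have h2 := lq1 (x + t * k); rewrite ex in h1 h2.
  have na := normr_ge0 a.
  have tk2 : (t * k) ^+ 2 <= `|a| ^+ 2.
    by rewrite -real_normK ?num_real // lerXn2r ?nnegrE.
  have p1 : `|k * (dens sg pk W (x + t * k) - q0 - q1 * (t * k))| <= `|a| * (B * `|a| ^+ 2).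
    rewrite normrM; apply: ler_pM => //; apply: le_trans h1 _; exact: ler_wpM2l.
  have p2 : `|t * a ^+ 2 * sg ^+ 2 * (dens1 sg pk W (x + t * k) - q1)| <=
      `|a| ^+ 2 * (B * `|a|).
    rewrite normrM; apply: ler_pM => //; last first.
      by apply: le_trans h2 _; exact: ler_wpM2l.
    rewrite real_normK ?num_real // ger0_norm; last first.
      by apply: mulr_ge0; [apply: mulr_ge0 => //; exact: sqr_ge0|exact: sqr_ge0].
    have s1 : sg ^+ 2 <= 1 by rewrite sgE; nra.
    rewrite mulrAC -[X in _ <= X]mul1r ler_wpM2r ?sqr_ge0 //.
    by rewrite mulr_ile1 // sqr_ge0.
  apply: le_trans (ler_normB _ _) _; apply: le_trans (lerD p1 p2) _.
  by apply: le_of_eq; ring.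
have b1 := bnd _ kb1; have b2 := bnd _ kb2.
set e1 := _ - _ in b1; set e2 := _ - _ in b2.
(* Under the Bernoulli weights [k1] and [k2] have mean 0 and variance [a ^+ 2 * sg ^+ 2], so the
   terms in [q0] and [q1] drop out and only Taylor remainders are left. *)
have -> : tau * (k1 * dens sg pk W (x + t * k1) -
      t * a ^+ 2 * sg ^+ 2 * dens1 sg pk W (x + t * k1)) +
   (1 - tau) * (k2 * dens sg pk W (x + t * k2) -
      t * a ^+ 2 * sg ^+ 2 * dens1 sg pk W (x + t * k2)) = tau * e1 + (1 - tau) * e2.
  by rewrite /e1 /e2 sgE /k1 /k2; ring.
move: b1 b2 => /ler_normlP [? ?] /ler_normlP [? ?].
by apply/ler_normlP; split; nra.
Qed.

End OneStep.

(** Exchanging coordinate [k] with a fresh draw from [p k] is an involution that preserves the joint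
    weight. *)
Lemma Ex_resample (R : realType) (I G : finType) (p : I -> G -> R) (k : I)
    (F : {ffun I -> G} -> R) : is_pmf p ->
  Ex p F = Ex p (fun x => \sum_g p k g * F [ffun i => if i == k then g else x i]).
Proof.
move=> pp; pose upd (x : {ffun I -> G}) g := [ffun i => if i == k then g else x i].
have e1 : Ex p F = \sum_(z : {ffun I -> G} * G) pw p z.1 * p k z.2 * F z.1.
  rewrite -(pair_bigA _ (fun x g => pw p x * p k g * F x)) /=; apply: eq_bigr => x _.
  by rewrite -mulr_suml -mulr_sumr pp.2 mulr1.
have -> : Ex p (fun x => \sum_g p k g * F (upd x g)) =
    \sum_(z : {ffun I -> G} * G) pw p z.1 * p k z.2 * F (upd z.1 z.2).
  rewrite -(pair_bigA _ (fun x g => pw p x * p k g * F (upd x g))) /=.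
  by apply: eq_bigr => x _; rewrite mulr_sumr; apply: eq_bigr => g _; rewrite mulrA.
rewrite e1.
pose h (z : {ffun I -> G} * G) := (upd z.1 z.2, z.1 k).
have hK : involutive h.
  move=> [x g]; rewrite /h /=; congr pair; last by rewrite ffunE eqxx.
  by apply/ffunP => i; rewrite !ffunE; case: eqP => // ->.
rewrite [LHS](reindex_inj (inv_inj hK)); apply: eq_bigr => -[x g] _ /=.
congr (_ * _); rewrite /pw (bigD1 k) //= [\prod_i p i (x i)](bigD1 k) //=.
rewrite ffunE eqxx [in LHS](eq_bigr (fun i => p i (x i))); first by ring.
by move=> i ik; rewrite ffunE (negbTE ik).
Qed.

Section Lindeberg.
Variables (R : realType) (sg pk tau e : R) (Phi : R -> R).
Hypothesis sg0 : 0 < sg.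
Hypothesis pk0 : 0 < pk.
Hypothesis e0 : 0 < e.
Hypothesis tau01 : 0 < tau < 1.
Hypothesis sgE : sg ^+ 2 = tau * (1 - tau).
Hypothesis dPhi : forall z : R,
  is_derive z 1 Phi (pk * expR (- (z ^+ 2) / (sg ^+ 2 * 2))).

Definition bern (n : nat) : 'I_n -> bool -> R := fun _ b => if b then tau else 1 - tau.

Lemma bern_pmf n : is_pmf (@bern n).
Proof.
move/andP: tau01 => [t0 t1]; split=> [i [] /=|i]; rewrite /bern ?(ltW t0) //.
  by rewrite subr_ge0 ltW.
by rewrite big_bool /= subrKC.
Qed.

(** One Bernoulli summand at a time is traded for variance. The initial variance [v >= e ^+ 2]
    provides the smoothness that bounds each trade. *)
Lemma lindeberg n (a : 'I_n -> R) v x : e ^+ 2 <= v ->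
  `|Ex (@bern n) (fun b => smooth Phi v (x + \sum_i a i * (tau - (b i)%:R))) -
    smooth Phi (v + \sum_i a i ^+ 2) x| <=
  6 * pk / (sg ^+ 2 * e ^+ 3) * \sum_i `|a i| ^+ 3.
Proof.
set C := 6 * pk / _; have pb := bern_pmf n.
elim: (index_enum 'I_n) (index_enum_uniq 'I_n) v x => [|k l IH] ul v x ev.
  rewrite !big_nil addr0 mulr0 (eq_Ex _ (_ : _ =1 fun=> smooth Phi v x)).
    by rewrite (Ex_cst pb) subrr normr0.
  by move=> b; rewrite big_nil addr0.
move: ul => /= /andP [kl ul].
have ev' : e ^+ 2 <= v + a k ^+ 2 by rewrite (le_trans ev) // lerDl sqr_ge0.
have := IH ul (v + a k ^+ 2) x ev'.
rewrite !big_cons addrA mulrDr.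
pose S (b : {ffun 'I_n -> bool}) := \sum_(i <- l) a i * (tau - (b i)%:R).
rewrite [Ex _ (fun b => smooth Phi v _)](Ex_resample k) // => h.
apply: le_trans (ler_distD (Ex (@bern n) (fun b => smooth Phi (v + a k ^+ 2) (x + S b))) _ _) _.
apply: lerD h.
rewrite -ExB; apply/ler_normlP.
have ptw (b : {ffun 'I_n -> bool}) : `|\sum_g bern k g * smooth Phi v (x + \sum_(i <- k :: l) a i *
   (tau - ([ffun i => if i == k then g else b i] i)%:R)) -
   smooth Phi (v + a k ^+ 2) (x + S b)| <= C * `|a k| ^+ 3.
  have := one_step sg0 pk0 e0 tau01 sgE dPhi (a k) (x + S b) ev.
  have e2 g : x + \sum_(i <- k :: l) a i * (tau - ([ffun i => if i == k then g else b i] i)%:R)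
      = x + S b + a k * (tau - g%:R).
    rewrite big_cons ffunE eqxx [X in _ + (_ + X)](_ : _ = S b); first by ring.
    apply: eq_big_seq => i il; rewrite ffunE; case: eqP => // ik.
    by rewrite -ik il in kl.
  by rewrite big_bool /= !e2 /= subr0.
split.
  rewrite -ExN -[X in _ <= X](Ex_cst pb); apply: (le_Ex pb) => b.
  by have /ler_normlP [] := ptw b.
rewrite -[X in _ <= X](Ex_cst pb); apply: (le_Ex pb) => b.
by have /ler_normlP [] := ptw b.
Qed.

End Lindeberg.

Section NormalCdf.
Variables (R : realType) (sg : R).
Hypothesis sg0 : 0 < sg.

Definition ncdf (z : R) : R := fine (normal_prob 0 sg `]-oo, z]%classic).
Local Notation pk := (normal_peak sg).

Lemma ncdf_pk0 : 0 < pk. Proof. by rewrite normal_peak_gt0 // gt_eqF. Qed.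

Lemma d_ncdf (z : R) : is_derive z 1 ncdf (pk * expR (- (z ^+ 2) / (sg ^+ 2 * 2))).
Proof.
have i y : lebesgue_measure.-integrable [set` Interval -oo%O (BRight y)]
    (EFin \o normal_pdf 0 sg).
  by apply: (integrableS measurableT) => //; exact: integrable_normal_pdf.
have c : {for z, continuous (normal_pdf 0 sg)}.
  by apply: continuous_normal_pdf; rewrite gt_eqF.
have z1 : z < z + 1 by rewrite ltrDl.
have [d1 d2] := @continuous_FTC1 R (normal_pdf 0 sg) -oo%O z (z + 1) z1 (i _) (ltNyr _) c.
have e : (fun y => \int[lebesgue_measure]_(t in [set` Interval -oo%O (BRight y)])
   normal_pdf 0 sg t)%R = ncdf by [].
rewrite e in d1 d2.
apply: DeriveDef => //; rewrite -derive1E d2 normal_pdfE ?gt_eqF //.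
by rewrite /normal_fun subr0 mulr_natr.
Qed.

Lemma ncdf01 z : 0 <= ncdf z <= 1.
Proof.
rewrite /ncdf fine_ge0 //= -[leRHS]/(fine 1%E) fine_le ?fin_num_measure //;
  try exact: measurable_itv.
by apply: probability_le1; exact: measurable_itv.
Qed.

Lemma ncdf_lip x y : `|ncdf y - ncdf x| <= pk * `|y - x|.
Proof.
apply: (@lip_of_derive R _ _ _ _ _ d_ncdf) => z.
rewrite ger0_norm ?mulr_ge0 ?expR_ge0 ?(ltW ncdf_pk0) //.
rewrite ler_piMr ?(ltW ncdf_pk0) // expR_le1 mulNr oppr_le0.
by rewrite divr_ge0 ?sqr_ge0 // mulr_ge0 ?sqr_ge0.
Qed.

(** As a random variable under the normal law, the identity has [ncdf] as its distribution function,
    which gives access to the limits at infinity. *)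
Let idR : measurableTypeR R -> R := idfun.

#[local] HB.instance Definition _ :=
  @isMeasurableFun.Build _ _ _ _ idR (@measurable_id _ _ setT).

Let cdfE z : fine (cdf (idR : {RV (normal_prob 0 sg : probability _ R) >-> R}) z) = ncdf z.
Proof. by []. Qed.

Lemma ncdf_cvgy e : 0 < e -> exists2 M, 0 < M & forall z, M <= z -> 1 - e <= ncdf z.
Proof.
move=> e0; have /fine_cvg := cvg_cdfy1 (idR : {RV (normal_prob 0 sg : probability _ R) >-> R}).
move=> /cvgrPdist_le /(_ e e0) [M [_ hM]].
exists (Num.max M 0 + 1); first by rewrite ltr_pwDr // le_max lexx orbT.
move=> z zM; have Mz : M < z by apply: lt_le_trans zM; rewrite ltr_pwDr // le_max lexx.
by have := hM _ Mz; rewrite /= cdfE => /ler_normlP [? ?]; lra.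
Qed.

Lemma ncdf_cvgNy e : 0 < e -> exists2 M, 0 < M & forall z, z <= - M -> ncdf z <= e.
Proof.
move=> e0; have /fine_cvg := cvg_cdfNy0 (idR : {RV (normal_prob 0 sg : probability _ R) >-> R}).
move=> /cvgrPdist_le /(_ e e0) [M [_ hM]].
exists (Num.max (- M) 0 + 1); first by rewrite ltr_pwDr // le_max lexx orbT.
move=> z zM; have Mz : z < M.
  have : - M <= Num.max (- M) 0 by rewrite le_max lexx.
  by move: zM; lra.
by have := hM _ Mz; rewrite /= cdfE => /ler_normlP [? ?]; lra.
Qed.

End NormalCdf.

(** The threshold [dl] depends on [tau], [y] and [eta] only, so the approximation is uniform over
    sample sizes and weights. The indicator is sandwiched between smooth functions
    [ncdf ((x - W) / e)] with [x = y - ze] and [x = y + ze]; four errors of [eta / 4] come from the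
    sandwich, the replacement, the extra variance [e ^+ 2] and the shift [ze]. *)
Lemma clt_bernoulli (R : realType) (tau y eta : R) : 0 < tau < 1 -> 0 < eta ->
  exists2 dl : R, 0 < dl & forall (n : nat) (a : 'I_n -> R),
    \sum_i a i ^+ 2 = 1 -> (forall i, `|a i| <= dl) ->
    `|Ex (bern tau (n := n)) (fun b => (\sum_i a i * (tau - (b i)%:R) <= y)%R%:R) -
      ncdf (Num.sqrt (tau * (1 - tau))) y| <= eta.
Proof.
move=> tau01 eta0; set sg := Num.sqrt _.
have /andP [t0 t1] := tau01.
have tt : 0 < tau * (1 - tau) by rewrite mulr_gt0 // subr_gt0.
have sg0 : 0 < sg by rewrite sqrtr_gt0.
have sgE : sg ^+ 2 = tau * (1 - tau) by rewrite sqr_sqrtr // ltW.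
have pk0 := ncdf_pk0 sg0; set pk := normal_peak sg in pk0.
have e40 : 0 < eta / 4 by rewrite divr_gt0.
have [M1 M10 hM1] := ncdf_cvgy sg e40.
have [M2 M20 hM2] := ncdf_cvgNy sg e40.
pose M := Num.max M1 M2.
have M1M : M1 <= M by rewrite le_max lexx.
have M2M : M2 <= M by rewrite le_max lexx orbT.
have M0 : 0 < M by apply: lt_le_trans M1M.
pose ze := eta / (4 * pk).
have ze0 : 0 < ze by rewrite divr_gt0 // mulr_gt0.
have yp : 0 < `|y| + 1 by rewrite ltr_wpDl.
(* The three bounds let [ze / e] reach the tails of [ncdf], give [e ^+ 2 <= e], and make the extra
   variance harmless for arguments up to [|y| + ze]. *)
pose e := Num.min (ze / M) (Num.min 1 (eta / (4 * pk * (`|y| + 1 + ze)))).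
have yz : 0 < `|y| + 1 + ze by rewrite addr_gt0.
have e0 : 0 < e.
  have d1 : 0 < ze / M by rewrite divr_gt0.
  have d2 : 0 < eta / (4 * pk * (`|y| + 1 + ze)) by rewrite divr_gt0 // !mulr_gt0.
  by rewrite !lt_min ltr01 d1 d2.
have eM : M <= ze / e.
  by rewrite ler_pdivlMr // mulrC -ler_pdivlMr // ge_min lexx.
have e1 : e <= 1 by rewrite !ge_min lexx orbT.
have e2 : pk * (`|y| + ze) * e ^+ 2 <= eta / 4.
  have : e <= eta / (4 * pk * (`|y| + 1 + ze)) by rewrite !ge_min lexx !orbT.
  rewrite ler_pdivlMr ?mulr_gt0 // => h.
  have h2 : e ^+ 2 <= e by rewrite expr2 ler_piMr // ltW.
  have h3 : pk * (`|y| + ze) * e ^+ 2 <= pk * (`|y| + ze) * e.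
    by rewrite ler_wpM2l // mulr_ge0 ?(ltW pk0) // addr_ge0 // ltW.
  have : 0 <= pk * e by rewrite mulr_ge0 ?ltW.
  nra.
pose C := 6 * pk / (sg ^+ 2 * e ^+ 3).
have C0 : 0 < C by rewrite divr_gt0 // mulr_gt0 // exprn_gt0.
exists (eta / (4 * C)); first by rewrite divr_gt0 // mulr_gt0.
move=> n a a1 ad.
have sum3 : C * \sum_i `|a i| ^+ 3 <= eta / 4.
  have : \sum_i `|a i| ^+ 3 <= eta / (4 * C).
    have -> : eta / (4 * C) = eta / (4 * C) * \sum_i a i ^+ 2 by rewrite a1 mulr1.
    rewrite mulr_sumr; apply: ler_sum => i _.
    by rewrite exprS real_normK ?num_real // ler_wpM2r // sqr_ge0.
  have C4 : 0 < 4 * C by apply: mulr_gt0.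
  by rewrite ler_pdivlMr // mulrC => h; lra.
have pb := bern_pmf tau01 n.
pose W (b : {ffun 'I_n -> bool}) := \sum_i a i * (tau - (b i)%:R).
rewrite -/pk in sum3.
have lin x := @lindeberg R sg pk tau e (ncdf sg) sg0 pk0 e0 tau01 sgE (d_ncdf sg0) n
  (fun i => - a i) (e ^+ 2) x (lexx _).
have lin' x : `|Ex (bern tau (n := n)) (fun b => ncdf sg ((x - W b) / e)) -
    ncdf sg (x / Num.sqrt (e ^+ 2 + 1))| <= eta / 4.
  apply: le_trans sum3; have := lin x; rewrite /smooth sqrtr_sqr (gtr0_norm e0).
  rewrite (eq_bigr (fun i => a i ^+ 2)) ?a1 => [|i _]; last by rewrite sqrrN.
  have -> : \sum_i `|- a i| ^+ 3 = \sum_i `|a i| ^+ 3.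
    by apply: eq_bigr => i _; rewrite normrN.
  rewrite (eq_Ex _ (_ : _ =1 fun b => ncdf sg ((x - W b) / e))) //.
  move=> b; rewrite (eq_bigr (fun i => - (a i * (tau - (b i)%:R)))) ?sumrN //.
  by move=> i _; rewrite mulNr.
have r1 : 1 <= Num.sqrt (e ^+ 2 + 1).
  by rewrite -[X in X <= _]sqrtr1 ler_wsqrtr // lerDr sqr_ge0.
have rr : Num.sqrt (e ^+ 2 + 1) ^+ 2 = e ^+ 2 + 1.
  by rewrite sqr_sqrtr // addr_ge0 ?sqr_ge0.
have shrink x : `|x| <= `|y| + ze -> `|ncdf sg (x / Num.sqrt (e ^+ 2 + 1)) - ncdf sg x| <= eta / 4.
  move=> hx; apply: le_trans (ncdf_lip sg0 _ _) _; apply: le_trans e2.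
  rewrite -mulrA ler_pM2l //.
  set r := Num.sqrt _ in r1 rr *.
  have r0 : 0 < r by lra.
  have -> : x / r - x = - (x * ((r - 1) / r)) by field; rewrite gt_eqF.
  rewrite normrN normrM; apply: ler_pM => //.
  rewrite ger0_norm; last by rewrite divr_ge0 //; lra.
  by rewrite ler_pdivrMr //; nra.
have close x : `|x - y| <= ze -> `|ncdf sg x - ncdf sg y| <= eta / 4.
  move=> hx; apply: le_trans (ncdf_lip sg0 _ _) _.
  have : ze * pk = eta / 4 by rewrite /ze; field; rewrite gt_eqF.
  by move=> <-; rewrite mulrC ler_pM2r.
have zn : `|ze| = ze by rewrite gtr0_norm.
have up : Ex (bern tau (n := n)) (fun b => (W b <= y)%R%:R) <=
   Ex (bern tau (n := n)) (fun b => ncdf sg ((y + ze - W b) / e)) + eta / 4.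
  rewrite -[X in _ <= _ + X](Ex_cst pb) -ExD; apply: (le_Ex pb) => b.
  have /andP [p0 p1] := ncdf01 sg ((y + ze - W b) / e).
  case: (leP (W b) y) => [h|_] /=; last by lra.
  suff : 1 - eta / 4 <= ncdf sg ((y + ze - W b) / e) by lra.
  apply: hM1; apply: le_trans (le_trans M1M eM) _.
  by rewrite ler_pM2r ?invr_gt0 //; lra.
have lo : Ex (bern tau (n := n)) (fun b => ncdf sg ((y - ze - W b) / e)) <=
   Ex (bern tau (n := n)) (fun b => (W b <= y)%R%:R) + eta / 4.
  rewrite -[X in _ <= _ + X](Ex_cst pb) -ExD; apply: (le_Ex pb) => b.
  have /andP [p0 p1] := ncdf01 sg ((y - ze - W b) / e).
  case: (leP (W b) y) => [_|h] /=; first by lra.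
  rewrite add0r; apply: hM2.
  have : (y - ze - W b) / e <= - ze / e by rewrite ler_pM2r ?invr_gt0 //; lra.
  by rewrite mulNr; lra.
have s1 : `|y + ze| <= `|y| + ze by rewrite -{2}zn ler_normD.
have s2 : `|y - ze| <= `|y| + ze by rewrite -{2}zn ler_normB.
have c1 : `|y + ze - y| <= ze by rewrite addrAC subrr add0r zn.
have c2 : `|y - ze - y| <= ze by rewrite addrAC subrr add0r normrN zn.
move: (lin' (y + ze)) (lin' (y - ze)) (shrink _ s1) (shrink _ s2) (close _ c1) (close _ c2).
move=> /ler_normlP [? ?] /ler_normlP [? ?] /ler_normlP [? ?] /ler_normlP [? ?].
move=> /ler_normlP [? ?] /ler_normlP [? ?].
apply/ler_normlP; split; lra.
Qed.

(** * Events of probability tending to one *)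

Lemma with_prob_to_oneI (R : realType) (d : nat -> measure_display)
    (T : forall n, measurableType (d n)) (P : forall n, probability (T n) R)
    (E : forall n, set (T n)) :
  (forall eta : R, 0 < eta -> \forall n \near \oo, exists A : set (T n),
    [/\ measurable A, 1 - eta <= fine (P n A) & A `<=` E n]) ->
  with_prob_to_one P E.
Proof.
move=> hE.
have ex n k : exists A : set (T n), [/\ measurable A, A `<=` E n &
    (exists B : set (T n), [/\ measurable B, 1 - k.+1%:R^-1 <= fine (P n B) & B `<=` E n]) ->
    1 - k.+1%:R^-1 <= fine (P n A)].
  have [[B [mB pB BE]]|nB] := pselect (exists B : set (T n),
      [/\ measurable B, 1 - k.+1%:R^-1 <= fine (P n B) & B `<=` E n]).
    by exists B.
  by exists set0; split=> // /nB.
pose A n k := sval (cid (ex n k)).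
have mA n k : measurable (A n k) by rewrite /A; case: cid => B [].
have AE n k : A n k `<=` E n by rewrite /A; case: cid => B [].
have pA n k : (exists B : set (T n), [/\ measurable B, 1 - k.+1%:R^-1 <= fine (P n B) & B `<=` E n]) ->
    1 - k.+1%:R^-1 <= fine (P n (A n k)).
  by rewrite /A; case: cid => B [].
have mU n : measurable (\bigcup_k A n k) by exact: bigcup_measurable.
(* [A n k] serves [eta = k.+1^-1]. *)
exists (fun n => \bigcup_k A n k); split=> // [n x [k _]|]; first exact: AE.
have fP n : P n (\bigcup_k A n k) = (fine (P n (\bigcup_k A n k)))%:E.
  by rewrite fineK // fin_num_measure.
under eq_fun do rewrite fP.
apply: cvg_EFin; first by near=> n.
apply/cvgrPdist_le => /= e e0.
pose k := Num.truncn e^-1.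
have ke : k.+1%:R^-1 <= e.
  by rewrite -[leRHS]invrK lef_pV2 ?posrE ?invr_gt0 // ltW // truncnS_gt.
near=> n.
have pn : exists B : set (T n), [/\ measurable B, 1 - k.+1%:R^-1 <= fine (P n B) & B `<=` E n].
  by near: n; apply: hE; rewrite invr_gt0.
have p1 : fine (P n (\bigcup_k A n k)) <= 1.
  by rewrite -[leRHS]/(fine 1%E) fine_le ?fin_num_measure // probability_le1.
have p2 : fine (P n (A n k)) <= fine (P n (\bigcup_k A n k)).
  by rewrite fine_le ?fin_num_measure // le_measure ?inE //; exact: bigcup_sup.
rewrite ger0_norm ?subr_ge0 // lerBlDr -lerBlDl.
by apply: le_trans p2; apply: le_trans (pA n k pn); rewrite lerB.
Unshelve. all: by end_near. Qed.

Lemma prob_setI (d : measure_display) (T : measurableType d) (R : realType)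
    (P : probability T R) (A B : set T) (a b : R) :
  measurable A -> measurable B -> 1 - a <= fine (P A) -> 1 - b <= fine (P B) ->
  measurable (A `&` B) /\ 1 - (a + b) <= fine (P (A `&` B)).
Proof.
move=> mA mB hA hB; split; first exact: measurableI.
have e1 : P B = (P (B `&` A) + P (B `\` A))%E by rewrite addeC -measureDI.
have mD : measurable (B `\` A) by exact: measurableD.
have mI : measurable (B `&` A) by exact: measurableI.
have e2 : (P (A `|` (B `\` A)) = P A + P (B `\` A))%E.
  by rewrite measureU //; apply/seteqP; split=> // x [? []].
have e3 : (P (A `|` (B `\` A)) <= 1)%E.
  by apply: probability_le1; exact: measurableU.
rewrite setIC; move: e1 e2 e3 hB => -> -> + .
rewrite -(fineK (fin_num_measure P _ mA)) -(fineK (fin_num_measure P _ mD)).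
rewrite -(fineK (fin_num_measure P _ mI)) -!EFinD lee_fin /=; lra.
Qed.

Lemma prob_le_on (d : measure_display) (T : measurableType d) (R : realType)
    (P : probability T R) (A B C : set T) (eta : R) :
  measurable A -> measurable B -> measurable C -> A `&` B `<=` C ->
  1 - eta <= fine (P A) -> fine (P B) <= fine (P C) + eta.
Proof.
move=> mA mB mC ABC pA.
have pB : 1 - (1 - fine (P B)) <= fine (P B) by lra.
have [mI pI] := prob_setI mA mB pA pB.
have : fine (P (A `&` B)) <= fine (P C).
  by rewrite fine_le ?fin_num_measure // le_measure ?inE.
lra.
Qed.

Lemma signs_transfer (d : measure_display) (T : measurableType d) (R : realType)
    (P : probability T R) n (eps : 'I_n -> {RV P >-> R}) (tau : R) (a : 'I_n -> R) (z : R) :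
  mutually_independent eps -> (forall i, P [set om | eps i om <= 0] = tau%:E) ->
  let E := [set om | \sum_i a i * (tau - (eps i om <= 0)%R%:R) <= z] in
  measurable E /\
  fine (P E) = Ex (bern tau (n := n)) (fun b => (\sum_i a i * (tau - (b i)%:R) <= z)%R%:R).
Proof.
move=> indep Ptau E.
pose c (i : 'I_n) (u : R) : bool := (u <= 0)%R.
have mc i g : measurable (c i @^-1` [set g]).
  have m0 : measurable [set u : R | u <= 0].
    by have := @measurable_itv R `]-oo, 0%R]; rewrite set_itvNyc.
  case: g; first by have -> : c i @^-1` [set true] = [set u : R | u <= 0] by [].
  have -> : c i @^-1` [set false] = ~` [set u : R | u <= 0].
    by apply/seteqP; split=> u /=; rewrite /c; case: (u <= 0).
  exact: measurableC.
have pE : cell_prob eps c = bern tau (n := n).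
  apply/funext => i; apply/funext => g.
  have pt : cell_prob eps c i true = tau.
    rewrite /cell_prob -[RHS]/(fine tau%:E) -(Ptau i); congr (fine (P _)).
  case: g => //; have [_ /(_ i)] := cell_pmf eps mc.
  by rewrite big_bool /= pt /bern => <-; rewrite addrAC subrr add0r.
have := transfer indep mc (fun b : {ffun 'I_n -> bool} => \sum_i a i * (tau - (b i)%:R) <= z).
rewrite pE; rewrite (_ : [set w | _] = E) //.
apply/funext => w; congr (is_true (_ <= z)).
by apply: eq_bigr => i _; rewrite ffunE.
Qed.

(** * The oracle estimator for a fixed sample size *)

Lemma posdef_unitmx (R : realType) n (N : 'M[R]_n) (c : R) : 0 < c ->
  (forall x, c * norm2 x ^+ 2 <= (x^T *m N *m x) 0 0) -> N \in unitmx.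
Proof.
move=> c0 hN; rewrite -row_free_unit -kermx_eq0; apply/eqP/row_matrixP => k.
rewrite row0; set u := row k _.
have hu : u *m N = 0 by rewrite -row_mul mulmx_ker row0.
suff : u^T = 0 by move/(congr1 trmx); rewrite trmxK trmx0.
apply: norm2_eq0; apply/eqP; rewrite -sqrf_eq0; apply/eqP.
have := hN u^T; rewrite trmxK hu mul0mx mxE => h.
by apply/le_anti; rewrite sqr_ge0 andbT -(pmulr_rle0 _ c0).
Qed.

Lemma sqrtmx_unit (R : realType) n (N : 'M[R]_n) :
  is_psd N -> N \in unitmx -> sqrtmx N \in unitmx.
Proof.
by move=> /sqrtmxP [_ NN]; rewrite -{1}NN unitmx_mul => /andP [].
Qed.

(** An estimated signal entry stays above [(2 * a - 1) * lam > a * lam], where the SCAD derivative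
    is 0; an estimated noise entry stays within [lam], where it is 1. *)
Lemma scad_weights_oracle (R : realType) s q (a lam : R) (beta1 : 'cV[R]_s)
    (bi : 'cV[R]_(s + q)) : 0 < lam -> 2 < a -> (forall j, 2 * a * lam <= `|beta1 j 0|) ->
  norm2 (bi - col_mx beta1 0) <= lam ->
  (forall j, scad_weights a lam bi (lshift q j) 0 = 0) /\
  (forall j, scad_weights a lam bi (rshift s j) 0 = 1).
Proof.
move=> lam0 a2 bmin bil; rewrite /scad_weights /scad_deriv; split=> j; rewrite mxE.
  have := le_trans (entry_le_norm2 (bi - col_mx beta1 0) (lshift q j)) bil.
  rewrite [(_ - _ : 'cV__) _ 0]mxE [(- _ : 'cV__) _ 0]mxE col_mxEu => hj.
  have hb := bmin j.
  have big : a * lam < `|bi (lshift q j) 0|.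
    have := ler_normD (bi (lshift q j) 0) (beta1 j 0 - bi (lshift q j) 0).
    rewrite addrC subrK distrC.
    have : 2 * lam < a * lam by rewrite ltr_pM2r.
    lra.
  have -> : (`|bi (lshift q j) 0| <= lam) = false.
    apply/negbTE; rewrite -ltNge; apply: le_lt_trans big.
    have : 2 * lam < a * lam by rewrite ltr_pM2r.
    lra.
  by rewrite max_r ?mul0r ?addr0 // subr_le0 ltW.
have := le_trans (entry_le_norm2 (bi - col_mx beta1 0) (rshift s j)) bil.
rewrite [(_ - _ : 'cV__) _ 0]mxE [(- _ : 'cV__) _ 0]mxE col_mxEd mxE subr0 => hj.
by rewrite hj ltNge hj mulr0 addr0.
Qed.

Section FixedN.
Context (d : measure_display) (T : measurableType d) (R : realType)
  (P : probability T R) (n s q : nat) (eps : 'I_n -> {RV P >-> R}).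
Variables (tau m M c0 c1 c2 : R) (X : 'M[R]_(n, s + q)) (f : 'I_n -> R -> R).
Hypothesis n0 : (0 < n)%N.
Hypothesis s0 : (0 < s)%N.
Hypothesis tau01 : 0 < tau < 1.
Hypothesis indep : mutually_independent eps.
Hypothesis Ptau : forall i, P [set om | eps i om <= 0] = tau%:E.
Hypothesis Xcol : forall j, norm2 (col j X) = Num.sqrt n%:R.
Hypothesis m0 : 0 < m.
Hypothesis c00 : 0 < c0.
Hypothesis c10 : 0 < c1.
Hypothesis c20 : 0 < c2.
Hypothesis fb : forall i, m <= f i 0 <= M.
Hypothesis FE : forall i x, `|x| <= c1 ->
  `|distr_fun (eps i) x - distr_fun (eps i) 0 - x * f i 0| <= c2 * x ^+ 2.
Local Notation S := (lsubmx X).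
Local Notation Q := (rsubmx X).
Local Notation A := (SHS X f).
Local Notation c3 := (cub M c1 c2).
Hypothesis Aform : forall x : 'cV[R]_s,
  c0 * n%:R * norm2 x ^+ 2 <= (x^T *m A *m x) 0 0 <= n%:R / c0 * norm2 x ^+ 2.
Variables (K b : R).
Hypothesis K0 : 0 < K.
Hypothesis b0 : 0 < b.
Hypothesis b1 : b <= 1.
Hypothesis bm : c3 * b <= m / 4.
(* [K] is a constant, large but independent of the sample size: the rate
   [sqrt (s ln n / n)] leaves room for [sqrt (s / n)] up to any fixed factor. *)
Definition radius : R := K * Num.sqrt (s%:R / n%:R).
Local Notation r := radius.
(** The factor 2 leaves room for shrunken competitors around the oracle estimator and for the
    minimizer of the quadratic form. The bound [b] comes from Condition 2 for the rate, and from
    [max_fZ] for normality when [s > 1]. *)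
Hypothesis Sb : forall (x : 'cV[R]_s) i, norm2 x <= 2 * r -> `|(S *m x) i 0| <= b.

Let nR : 0 < n%:R :> R. Proof. by rewrite ltr0n. Qed.
Let sR : 0 < s%:R :> R. Proof. by rewrite ltr0n. Qed.
Let r0 : 0 < r. Proof. by rewrite mulr_gt0 // sqrtr_gt0 divr_gt0. Qed.
Let r2 : n%:R * r ^+ 2 = K ^+ 2 * s%:R.
Proof. by rewrite /radius exprMn sqr_sqrtr ?divr_ge0 //; field; rewrite gt_eqF. Qed.

Let rowS : \sum_i norm2 (row i S)^T ^+ 2 = n%:R * s%:R.
Proof.
rewrite sum_norm2_rows (eq_bigr (fun=> n%:R)); last first.
  move=> j _; have <- : col (lshift q j) X = col j S by apply/matrixP=> k l; rewrite !mxE.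
  by rewrite Xcol sqr_sqrtr.
by rewrite sumr_const card_ord mulr_natr.
Qed.

Let rns : r * Num.sqrt (n%:R * s%:R) = K * s%:R.
Proof.
rewrite /radius -mulrA -sqrtrM ?divr_ge0 //.
have -> : s%:R / n%:R * (n%:R * s%:R) = s%:R ^+ 2 :> R by field; rewrite gt_eqF.
by rewrite sqrtr_sqr ger0_norm.
Qed.

Lemma formE (x y : 'cV[R]_s) :
  (x^T *m A *m y) 0 0 = \sum_i f i 0 * ((S *m x) i 0 * (S *m y) i 0).
Proof.
have -> : x^T *m A *m y = (S *m x)^T *m (Hmx f *m (S *m y)).
  by rewrite /SHS trmx_mul !mulmxA.
by rewrite dotE; apply: eq_bigr => i _; rewrite mul_diag_mx !mxE mulrCA.
Qed.

Let ff i : 0 < f i 0. Proof. by have := m0; have /andP [? ?] := fb i; lra. Qed.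

Lemma sum_sqr_le x : \sum_i (S *m x) i 0 ^+ 2 <= n%:R / (m * c0) * norm2 x ^+ 2.
Proof.
have /andP [_ h] := Aform x; rewrite formE in h.
have h2 : m * \sum_i (S *m x) i 0 ^+ 2 <=
    \sum_i f i 0 * ((S *m x) i 0 * (S *m x) i 0).
  rewrite mulr_sumr; apply: ler_sum => i _; rewrite -expr2 ler_wpM2r ?sqr_ge0 //.
  by case/andP: (fb i).
have -> : n%:R / (m * c0) * norm2 x ^+ 2 = m^-1 * (n%:R / c0 * norm2 x ^+ 2).
  by field; rewrite !gt_eqF.
by rewrite mulrC ler_pdivlMr // mulrC; exact: le_trans h.
Qed.

Lemma SHS_psd : is_psd A.
Proof.
split=> [|z]; first by rewrite /SHS !trmx_mul trmxK tr_diag_mx mulmxA.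
have /andP [h _] := Aform z; apply: le_trans h.
by rewrite mulr_ge0 ?sqr_ge0 // mulr_ge0 // ltW.
Qed.

Lemma SHS_unit : A \in unitmx.
Proof.
apply: (@posdef_unitmx _ _ _ (c0 * n%:R)); first by rewrite mulr_gt0.
by move=> x; case/andP: (Aform x).
Qed.

Definition oracle_incr (om : T) (x : 'cV[R]_s) : R :=
  \sum_i (rho tau (eps i om - (S *m x) i 0) - rho tau (eps i om)).

Lemma oracle_incrE om x : oracle_incr om x =
  \sum_i (S *m x) i 0 * ((eps i om <= 0)%R%:R - tau) + \sum_i kn (eps i om) ((S *m x) i 0).
Proof.
rewrite -big_split; apply: eq_bigr => i _ /=.
by rewrite knight /lin0; ring.
Qed.

Definition lin_event (t : R) (om : T) : Prop := forall x : 'cV[R]_s,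
  norm2 x <= 2 * r -> `|\sum_i (S *m x) i 0 * ((eps i om <= 0)%R%:R - tau)| <= t.

Definition kn_event (t : R) (om : T) : Prop := forall x : 'cV[R]_s,
  norm2 x <= 2 * r ->
  `|\sum_i (kn (eps i om) ((S *m x) i 0) - gmean (eps i) ((S *m x) i 0))| <= t.

Lemma lin_event_prob t : 0 < t -> exists A0, [/\ measurable A0,
  1 - 16 * K * s%:R / t <= fine (P A0) & A0 `<=` lin_event t].
Proof.
move=> t0.
(* The only extra direction is 0, so the logarithm and the variance vanish and any positive [th],
   here 1, will do. *)
have [|||||A0 [mA pA hA]] := @uniform_lin _ _ R P n s eps indep b unit tt S
  (fun _ _ => 0) (2 * r) 0 1 t b0 _ _ t0 _ _ _ tau Ptau => //.
- by rewrite mulr_ge0 // ltW.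
- by move=> j; rewrite big1 // => i _; rewrite expr0n.
- by move=> x _ i hx; rewrite addr0; exact: Sb.
exists A0; split=> //.
  apply: le_trans pA; rewrite card_unit ln1 mul0r mulr0 addr0 addr0 rowS.
  have -> : 2 * r * Num.sqrt (n%:R * s%:R) = 2 * (K * s%:R) by rewrite -rns; ring.
  by rewrite lerD2l lerN2 le_eqVlt; apply/orP; left; apply/eqP; field; rewrite gt_eqF.
move=> om Aom x hx; have := hA om Aom x tt hx.
by under eq_bigr do rewrite addr0.
Qed.

(** In the minimum, the value 1 serves the confinement to the ball, where [b] is a constant. The
    other value bounds the chance of an error within [2 * b] of 0, by [small_ball_prob] and
    [b ^+ 2 <= b], and serves the linearization, where [b] is small. *)
Lemma kn_event_prob t : 0 < t -> exists A0, [/\ measurable A0,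
  1 - 16 * K * s%:R * Num.sqrt (Num.min 1 ((6 * M + 20 * c3) * b)) / t <= fine (P A0) &
  A0 `<=` kn_event t].
Proof.
move=> t0.
have [|||||A0 [mA pA hA]] := @uniform_kn _ _ R P n s eps indep b unit tt S
  (fun _ _ => 0) (2 * r) 0 1 t b0 _ _ t0 => //.
- by rewrite mulr_ge0 // ltW.
- by move=> j; rewrite big1 // => i _; rewrite expr0n.
- by move=> x _ i hx; rewrite addr0; exact: Sb.
exists A0; split=> //.
  apply: le_trans pA; rewrite card_unit ln1 mul0r mulr0 addr0 addr0.
  set V := Num.min _ _.
  have hV : \sum_i norm2 (row i S)^T ^+ 2 * fine (P [set om | `|eps i om| <= 2 * b])
      <= n%:R * s%:R * V.
    rewrite -rowS mulr_suml; apply: ler_sum => i _; rewrite ler_wpM2l ?sqr_ge0 //.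
    have mI : measurable [set om | `|eps i om| <= 2 * b].
      have -> : [set om | `|eps i om| <= 2 * b] = eps i @^-1` `[- (2 * b), 2 * b]%classic.
        by apply/seteqP; split=> w /=; rewrite in_itv /= ler_norml.
      exact: RV_preimage.
    rewrite le_min -[X in _ <= X]/(fine 1%E) fine_le ?fin_num_measure ?probability_le1 //=.
    have b20 : 0 < 2 * b by rewrite mulr_gt0.
    apply: le_trans (small_ball_prob m0 c10 c20 (fb i) (FE i) b20) _.
    have c30 := cub_gt0 m0 c10 c20 (fb i).
    have b2b : b ^+ 2 <= b by rewrite expr2 ler_piMl ?b1 // ltW.
    have : c3 * b ^+ 2 <= c3 * b by rewrite ler_pM2l.
    by rewrite exprMn; lra.
  have V0 : 0 <= V.
    have i0 := Ordinal n0.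
    rewrite le_min ler01 mulr_ge0 ?(ltW b0) //.
    have := cub_gt0 m0 c10 c20 (fb i0); have := m0; have /andP [? ?] := fb i0; lra.
  have : Num.sqrt (\sum_i norm2 (row i S)^T ^+ 2 * fine (P [set om | `|eps i om| <= 2 * b]))
     <= Num.sqrt (n%:R * s%:R) * Num.sqrt V.
    by rewrite -sqrtrM ?mulr_ge0 // ler_wsqrtr.
  rewrite lerD2l lerN2 => h; apply: le_trans (_ : 8 / t * (2 * r * (Num.sqrt (n%:R * s%:R) * Num.sqrt V)) <= _).
    by rewrite ler_wpM2l ?divr_ge0 ?(ltW t0) // ler_wpM2l // mulr_ge0 // ltW.
  have -> : 2 * r * (Num.sqrt (n%:R * s%:R) * Num.sqrt V) =
     2 * (r * Num.sqrt (n%:R * s%:R)) * Num.sqrt V by ring.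
  by rewrite rns le_eqVlt; apply/orP; left; apply/eqP; field; rewrite gt_eqF.
move=> om Aom x hx; have := hA om Aom x tt hx.
by under eq_bigr do rewrite addr0.
Qed.

Local Notation t1 := (c0 * K ^+ 2 * s%:R / 16).

(** On the sphere the quadratic form is at least [c0 * n * r ^+ 2 = c0 * K ^+ 2 * s]. The mean of
    the remainder keeps a quarter of it, the cubic error being absorbed by [c3 * b <= m / 4], and
    the two fluctuations together take at most an eighth. *)
Lemma oracle_incr_pos om x : lin_event t1 om -> kn_event t1 om ->
  norm2 x = r -> 0 < oracle_incr om x.
Proof.
move=> hl hk xr.
have x2r : norm2 x <= 2 * r by have := r0; rewrite xr; lra.
rewrite oracle_incrE.
have l := hl x x2r; have k := hk x x2r; rewrite sumrB in k.
have g : 1 / 4 * (x^T *m A *m x) 0 0 <= \sum_i gmean (eps i) ((S *m x) i 0).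
  rewrite formE mulr_sumr; apply: ler_sum => i _.
  set u := (S *m x) i 0.
  have ub : `|u| <= b by exact: Sb.
  have /ler_normlP [g1 g2] := gmean_quad m0 c10 c20 (fb i) (FE i) u.
  have c30 := cub_gt0 m0 c10 c20 (fb i).
  have h1 : c3 * `|u| ^+ 3 <= m / 4 * u ^+ 2.
    rewrite exprS mulrA real_normK ?num_real // ler_wpM2r ?sqr_ge0 //.
    by apply: le_trans bm; rewrite ler_pM2l.
  have h2 : m * u ^+ 2 <= f i 0 * u ^+ 2.
    by rewrite ler_wpM2r ?sqr_ge0 //; case/andP: (fb i).
  rewrite -expr2; lra.
have /andP [a1 _] := Aform x; rewrite xr -mulrA r2 in a1.
have KS : 0 < c0 * (K ^+ 2 * s%:R) by rewrite !mulr_gt0 // exprn_gt0.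
move: l k => /ler_normlP [? ?] /ler_normlP [? ?]; lra.
Qed.

(** By convexity and the value 0 at the origin, a point outside the ball with nonpositive increment
    would yield a point on the sphere with nonpositive increment. *)
Lemma oracle_rate om x : lin_event t1 om -> kn_event t1 om ->
  oracle_incr om x <= 0 -> norm2 x <= r.
Proof.
move=> hl hk hx; rewrite leNgt; apply/negP => rx.
have x0 : 0 < norm2 x := lt_trans r0 rx.
pose th := r / norm2 x.
have th0 : 0 < th by rewrite divr_gt0.
have th1 : th <= 1 by rewrite ler_pdivrMr // mul1r ltW.
have := oracle_incr_pos hl hk (_ : norm2 (th *: x) = r).
rewrite norm2Z gtr0_norm // divfK ?gt_eqF // => /(_ erefl).
have th01 : 0 <= th <= 1 by rewrite (ltW th0).
have := resid_loss_convex tau S (\col_i eps i om) 0 x th01.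
rewrite add0r subr0.
have e (z : 'cV[R]_s) : resid_loss tau S (\col_i eps i om) z =
   oracle_incr om z + \sum_i rho tau (eps i om).
  by rewrite /oracle_incr sumrB subrK; apply: eq_bigr => i _; rewrite mxE.
rewrite !e.
have -> : oracle_incr om 0 = 0.
  by rewrite /oracle_incr big1 // => i _; rewrite mulmx0 mxE subr0 subrr.
nra.
Qed.

(** [z] minimizes the quadratic form [qf], and [qf x - qf z] is half the squared norm in question.
    The true increment is within [om4] of [qf] at both points and is minimal at [x], so this gap is
    at most [2 * om4]. *)
Lemma oracle_bahadur om x t : lin_event t1 om -> kn_event t om ->
  norm2 x <= r -> (forall z, oracle_incr om x <= oracle_incr om z) ->
  norm2 (sqrtmx A *m x - invmx (sqrtmx A) *m (S^T *m \col_i (tau - (eps i om <= 0)%R%:R))) ^+ 2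
    <= 4 * (t + c3 * b * (4 * (K ^+ 2 * s%:R) / (m * c0))).
Proof.
move=> hl hk xr xmin; set psi := \col_i _; set om4 := t + _.
have [[sB pB] BB] := sqrtmxP SHS_psd.
have uA := SHS_unit; have uB := sqrtmx_unit SHS_psd uA.
set B := sqrtmx A in sB pB BB uB *.
set g := S^T *m psi.
pose z := invmx A *m g.
have Bz : B *m z = invmx B *m g.
  apply: (can_inj (mulKmx uB)); rewrite mulmxA BB mulKVmx //.
  by rewrite /z mulKVmx.
have key (y : 'cV[R]_s) : \sum_i f i 0 * ((S *m y) i 0 * (S *m z) i 0) =
    \sum_i (S *m y) i 0 * psi i 0.
  have Az : A *m z = g by rewrite /z mulKVmx.
  rewrite -formE -dotE trmx_mul -[_ *m A *m z]mulmxA Az.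
  by rewrite /g mulmxA.
have c30 : 0 < c3 by exact: (cub_gt0 m0 c10 c20 (fb (Ordinal n0))).
have linE (y : 'cV[R]_s) : \sum_i (S *m y) i 0 * ((eps i om <= 0)%R%:R - tau) =
    - \sum_i (S *m y) i 0 * psi i 0.
  by rewrite -sumrN; apply: eq_bigr => i _; rewrite [psi i 0]mxE -mulrN opprB.
(* Otherwise [z] scaled back to norm [2 * r] would have a linear term above [4 * c0 * K ^+ 2 * s],
   far beyond the threshold of [lin_event]. *)
have zr : norm2 z <= 2 * r.
  rewrite leNgt; apply/negP => zr.
  have z0 : 0 < norm2 z by apply: lt_trans zr; rewrite mulr_gt0.
  pose th := 2 * r / norm2 z.
  have th0 : 0 < th by rewrite divr_gt0 // mulr_gt0.
  have thz : norm2 (th *: z) = 2 * r by rewrite norm2Z gtr0_norm // divfK ?gt_eqF.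
  have := hl (th *: z); rewrite thz lexx linE => /(_ isT).
  have -> : \sum_i (S *m (th *: z)) i 0 * psi i 0 = th * \sum_i (S *m z) i 0 * psi i 0.
    by rewrite mulr_sumr; apply: eq_bigr => i _; rewrite -scalemxAr mxE mulrA.
  rewrite normrN => /ler_normlP [_ h1].
  have /andP [h2 _] := Aform z; rewrite formE key in h2.
  have h3 : th * (c0 * n%:R * norm2 z ^+ 2) <= t1.
    by apply: le_trans h1; rewrite ler_pM2l.
  have e3 : th * (c0 * n%:R * norm2 z ^+ 2) = c0 * n%:R * (2 * r) * norm2 z.
    by rewrite /th; field; rewrite gt_eqF.
  have h4 : c0 * n%:R * (2 * r) * (2 * r) < c0 * n%:R * (2 * r) * norm2 z.
    by rewrite ltr_pM2l // mulr_gt0 // mulr_gt0.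
  have e4 : c0 * n%:R * (2 * r) * (2 * r) = 4 * (c0 * (K ^+ 2 * s%:R)).
    by rewrite -r2; ring.
  have : 0 < c0 * (K ^+ 2 * s%:R) by rewrite !mulr_gt0 // exprn_gt0.
  by rewrite e3 in h3; rewrite e4 in h4; lra.
pose qf (y : 'cV[R]_s) := \sum_i (- ((S *m y) i 0 * psi i 0) + 1 / 2 * f i 0 * (S *m y) i 0 ^+ 2).
have approx (y : 'cV[R]_s) : norm2 y <= 2 * r -> `|oracle_incr om y - qf y| <= om4.
  move=> yr; rewrite oracle_incrE linE /qf big_split /= sumrN.
  have -> : forall a b' c : R, a + b' - (a + c) = b' - c by move=> a b' c; ring.
  have k := hk y yr; rewrite sumrB in k.
  have h : `|\sum_i gmean (eps i) ((S *m y) i 0) -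
      \sum_i 1 / 2 * f i 0 * (S *m y) i 0 ^+ 2| <=
      c3 * b * (4 * (K ^+ 2 * s%:R) / (m * c0)).
    rewrite -sumrB; apply: le_trans (ler_norm_sum _ _ _) _.
    apply: (@le_trans _ _ (\sum_i c3 * b * (S *m y) i 0 ^+ 2)).
      apply: ler_sum => i _; set u := (S *m y) i 0.
      have ub : `|u| <= b by exact: Sb.
      have := gmean_quad m0 c10 c20 (fb i) (FE i) u.
      rewrite mulrAC => h; apply: le_trans (_ : c3 * `|u| ^+ 3 <= _).
        by apply: le_trans h; apply: le_of_eq;
           congr (`|_|); ring.
      rewrite exprS real_normK ?num_real // -mulrA ler_pM2l //.
      by rewrite ler_wpM2r ?sqr_ge0.
    rewrite -mulr_sumr ler_pM2l ?mulr_gt0 //.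
    apply: le_trans (sum_sqr_le y) _.
    have h2 : norm2 y ^+ 2 <= (2 * r) ^+ 2.
      by rewrite lerXn2r ?nnegrE ?norm2_ge0 // mulr_ge0 // ltW.
    have -> : 4 * (K ^+ 2 * s%:R) / (m * c0) = n%:R / (m * c0) * (2 * r) ^+ 2.
      by rewrite -r2; ring.
    by rewrite ler_wpM2l // divr_ge0 // mulr_ge0 // ltW.
  move: k h => /ler_normlP [? ?] /ler_normlP [? ?].
  by rewrite /om4; apply/ler_normlP; split; lra.
pose y := x - z.
have ydef : B *m x - invmx B *m g = B *m y by rewrite mulmxBr Bz.
rewrite ydef.
have nB : norm2 (B *m y) ^+ 2 = \sum_i f i 0 * ((S *m y) i 0 * (S *m y) i 0).
  rewrite -formE -dot_sqr trmx_mul sB -BB.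
  by rewrite !mulmxA.
have qd : qf x - qf z = 1 / 2 * norm2 (B *m y) ^+ 2.
  rewrite nB /qf -sumrB.
  have xi i : (S *m x) i 0 = (S *m z) i 0 + (S *m y) i 0.
    by rewrite /y -[X in _ + X]mul1r -mulmx_lincomb scale1r subrKC.
  have k0 : \sum_i (f i 0 * ((S *m y) i 0 * (S *m z) i 0) - (S *m y) i 0 * psi i 0) = 0.
    by rewrite sumrB key subrr.
  rewrite -[RHS]add0r -[X in _ = X + _]k0 mulr_sumr -big_split.
  have alg (p' f' x' z' y' : R) : x' = z' + y' ->
      - (x' * p') + 1 / 2 * f' * x' ^+ 2 - (- (z' * p') + 1 / 2 * f' * z' ^+ 2) =
      f' * (y' * z') - y' * p' + 1 / 2 * (f' * (y' * y')) by move=> ->; field.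
  by apply: eq_bigr => i _ /=; exact: alg (xi i).
have x2r : norm2 x <= 2 * r by have := r0; lra.
move: (approx x x2r) (approx z zr) (xmin z) => /ler_normlP [? ?] /ler_normlP [? ?] ?.
lra.
Qed.

Lemma norm2inf_ge k l (N : 'M[R]_(k, l)) (x : 'cV[R]_l) i :
  `|(N *m x) i 0| <= norm2inf N * norm2 x.
Proof.
have [->|x0] := eqVneq x 0.
  by rewrite mulmx0 mxE normr0 norm20 mulr0.
have nx := norm2_gt0 x0.
rewrite -ler_pdivrMr //.
apply: (@le_trans _ _ (norm_inf (N *m x) / norm2 x)).
  by rewrite ler_pM2r ?invr_gt0 // /norm_inf; exact: (le_bigmax _ (fun i => `|(N *m x) i 0|)).
apply: ub_le_sup; last by exists x.
(* [sup] is meaningful only for a set bounded above; the sum of the row norms is such a bound. *)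
exists (\sum_j norm2 (row j N)^T) => _ [y y0 ->].
have ny := norm2_gt0 y0.
rewrite ler_pdivrMr // /norm_inf; apply: bigmax_le => [|j _].
  by rewrite mulr_ge0 ?norm2_ge0 // sumr_ge0 // => j _; exact: norm2_ge0.
apply: le_trans (mulmx_row_le _ _ _) _; rewrite ler_wpM2r ?norm2_ge0 //.
by rewrite (bigD1 j) //= lerDl sumr_ge0 // => j' _; exact: norm2_ge0.
Qed.

Lemma max_entry_ge k l (N : 'M[R]_(k, l)) i j : `|N i j| <= max_entry N.
Proof.
apply: le_trans (le_bigmax _ (fun i => \big[Num.max/0]_(j < l) `|N i j|) i).
exact: (le_bigmax _ (fun j => `|N i j|)).
Qed.

(** Four deviations of at most [h * n * lam / 8] account for half of the bound, the change of the
    mean for the other half. That change has three sources, which match the summands of the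
    assumption: the weighted correlation of noise and signal columns, the curvature along the step,
    and the cubic error. *)
Lemma nullity_prob lam h L : 0 < h -> 0 < lam -> 0 < L ->
  ln (2 * q + 1)%:R <= L ->
  2 * r * norm2inf (n%:R^-1 *: QHS X f) + (1 + M + 2 * c3) * h +
    8 * c3 * max_entry X * (r ^+ 2 / (m * c0)) <= lam / 2 ->
  exists A0, [/\ measurable A0,
    1 - 128 * (2 * K * s%:R + 3 * h * Num.sqrt n%:R * Num.sqrt L) / (h * (n%:R * lam))
      <= fine (P A0) &
    forall om, A0 om -> forall x : 'cV[R]_s, norm2 x <= 2 * r -> forall (e : bool) j,
     \sum_i rho tau (eps i om - (S *m x) i 0 + (-1) ^+ e * h * Q i j) <=
     \sum_i rho tau (eps i om - (S *m x) i 0) + h * (n%:R * lam)].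
Proof.
move=> h0 lam0 L0 LJ hyp.
(* [None] is no step and [Some (e, j)] a signed step along column [j], hence [2 * q + 1] directions.
   The sign is reversed in [w] because the perturbation is subtracted from the error. *)
pose J := option (bool * 'I_q) : finType.
pose w (j : J) i := if j is Some ej then - ((-1) ^+ ej.1 * h * Q i ej.2) else 0.
have kap0 : 0 <= max_entry X by rewrite /max_entry; apply: bigmax_ge_id.
have cw j i : `|w j i| <= h * max_entry X.
  case: j => [[e j]|] /=; last by rewrite normr0 mulr_ge0 // ltW.
  rewrite normrN !normrM normr_sign mul1r gtr0_norm // ler_pM2l //.
  by apply: le_trans (max_entry_ge X i (rshift s j)); rewrite mxE.
have c30 : 0 < c3 by exact: (cub_gt0 m0 c10 c20 (fb (Ordinal n0))).
pose b' := b + h * max_entry X.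
have b'0 : 0 < b' by rewrite ltr_wpDr // mulr_ge0 // ltW.
have Ub (x : 'cV[R]_s) j i : norm2 x <= 2 * r -> `|(S *m x) i 0 + w j i| <= b'.
  by move=> hx; apply: le_trans (ler_normD _ _) _; rewrite lerD // Sb.
pose t := h * (n%:R * lam) / 8.
have hnl : 0 < h * (n%:R * lam) by rewrite !mulr_gt0.
have t0 : 0 < t by rewrite divr_gt0.
have wv j : \sum_i w j i ^+ 2 <= h ^+ 2 * n%:R.
  case: j => [[e j]|] /=; last first.
    rewrite big1 => [|i _]; last by rewrite expr0n.
    by rewrite ltW // mulr_gt0 // exprn_gt0.
  rewrite (eq_bigr (fun i => h ^+ 2 * Q i j ^+ 2)); last first.
    by move=> i _; rewrite sqrrN !exprMn sqrr_sign mul1r.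
  rewrite -mulr_sumr ler_pM2l ?exprn_gt0 //.
  have -> : \sum_i Q i j ^+ 2 = norm2 (col (rshift s j) X) ^+ 2.
    by rewrite norm2_sqr; apply: eq_bigr => i _; rewrite !mxE.
  by rewrite Xcol sqr_sqrtr.
pose sL := Num.sqrt L; pose sn := Num.sqrt n%:R : R.
have sL0 : 0 < sL by rewrite sqrtr_gt0.
have sn0 : 0 < sn by rewrite sqrtr_gt0.
have sL2 : sL ^+ 2 = L by rewrite sqr_sqrtr // ltW.
have sn2 : sn ^+ 2 = n%:R by rewrite sqr_sqrtr.
(* Balances the two terms of [rademacher_max] for the variance [h ^+ 2 * n] and the logarithm
   [L]. *)
pose th := sL / (h * sn).
have th0 : 0 < th by rewrite divr_gt0 // mulr_gt0.
have cardJ : #|J| = (2 * q + 1)%N.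
  by rewrite card_option card_prod card_bool card_ord addn1.
have r20 : 0 <= 2 * r by rewrite mulr_ge0 // ltW.
have w0 i : w None i = 0 by [].
have [A1 [mA1 pA1 hA1]] := @uniform_lin _ _ R P n s eps indep b' J None S w (2 * r)
  (h ^+ 2 * n%:R) th t b'0 r20 th0 t0 wv w0 Ub tau Ptau.
have [A2 [mA2 pA2 hA2]] := @uniform_kn _ _ R P n s eps indep b' J None S w (2 * r)
  (h ^+ 2 * n%:R) th t b'0 r20 th0 t0 wv w0 Ub.
pose Z := 2 * K * s%:R + 3 * h * sn * sL.
have tail : ln #|J|%:R / th + 2 * th * (h ^+ 2 * n%:R) <= 3 * h * sn * sL.
  rewrite cardJ.
  have : ln (2 * q + 1)%:R / th <= L / th by rewrite ler_pM2r ?invr_gt0.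
  have -> : L / th = h * sn * sL by rewrite /th -sL2; field; rewrite !gt_eqF.
  have -> : 2 * th * (h ^+ 2 * n%:R) = 2 * h * sn * sL.
    by rewrite /th -sn2; field; rewrite !gt_eqF.
  lra.
have loss (V : R) : V <= n%:R * s%:R ->
    8 / t * (2 * r * Num.sqrt V + (ln #|J|%:R / th + 2 * th * (h ^+ 2 * n%:R))) <= 64 * Z / (h * (n%:R * lam)).
  move=> hV.
  have -> : 64 * Z / (h * (n%:R * lam)) = 8 / t * Z by rewrite /t; field; rewrite !gt_eqF.
  apply: ler_wpM2l; first by rewrite divr_ge0 // ltW.
  rewrite /Z; apply: lerD => //.
  have -> : 2 * K * s%:R = 2 * r * Num.sqrt (n%:R * s%:R) by rewrite -[LHS]mulrA -rns mulrA.
  by rewrite ler_wpM2l // ler_wsqrtr.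
have p1 : 1 - 64 * Z / (h * (n%:R * lam)) <= fine (P A1).
  by apply: le_trans pA1; rewrite lerD2l lerN2; apply: loss; rewrite rowS.
have p2 : 1 - 64 * Z / (h * (n%:R * lam)) <= fine (P A2).
  apply: le_trans pA2; rewrite lerD2l lerN2; apply: loss.
  rewrite -rowS; apply: ler_sum => i _; rewrite ler_piMr ?sqr_ge0 //.
  have mI : measurable [set om | `|eps i om| <= 2 * b'].
    have -> : [set om | `|eps i om| <= 2 * b'] = eps i @^-1` `[- (2 * b'), 2 * b']%classic.
      by apply/seteqP; split=> y /=; rewrite in_itv /= ler_norml.
    exact: RV_preimage.
  by rewrite -[X in _ <= X]/(fine 1%E) fine_le ?fin_num_measure ?probability_le1.
have [mA pA] := prob_setI mA1 mA2 p1 p2.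
exists (A1 `&` A2); split=> //.
  by apply: le_trans pA; apply: le_of_eq; rewrite /Z /sn /sL; ring.
move=> om [in1 in2] x hx e j.
pose u i := (S *m x) i 0; pose v i := w (Some (e, j)) i.
have l1 := hA1 om in1 x None hx; have l2 := hA1 om in1 x (Some (e, j)) hx.
have k1 := hA2 om in2 x None hx; have k2 := hA2 om in2 x (Some (e, j)) hx.
have dE : \sum_i rho tau (eps i om - (S *m x) i 0 + (-1) ^+ e * h * Q i j) -
     \sum_i rho tau (eps i om - (S *m x) i 0) =
   (\sum_i (u i + v i) * ((eps i om <= 0)%R%:R - tau) -
     \sum_i (u i + w None i) * ((eps i om <= 0)%R%:R - tau)) +
   (\sum_i (kn (eps i om) (u i + v i) - gmean (eps i) (u i + v i)) -
    \sum_i (kn (eps i om) (u i + w None i) - gmean (eps i) (u i + w None i))) +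
   \sum_i (gmean (eps i) (u i + v i) - gmean (eps i) (u i)).
  rewrite -!sumrB -!big_split; apply: eq_bigr => i _ /=.
  have k0 := knight tau (eps i om) (u i); have kv := knight tau (eps i om) (u i + v i).
  rewrite /lin0 in k0 kv.
  have -> : eps i om - (S *m x) i 0 + (-1) ^+ e * h * Q i j = eps i om - (u i + v i).
    by rewrite /v /w /u /=; ring.
  by rewrite -/(u i) addr0; lra.
have gd : \sum_i (gmean (eps i) (u i + v i) - gmean (eps i) (u i)) <= h * (n%:R * lam) / 2.
  apply: (@le_trans _ _ (\sum_i (v i * f i 0 * u i + (1 + M + 2 * c3) * v i ^+ 2 +
      2 * c3 * (h * max_entry X) * u i ^+ 2))).
    apply: ler_sum => i _.
    have u1 : `|u i| <= 1 by apply: le_trans b1; exact: Sb.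
    apply: le_trans (gmean_diff m0 c10 c20 (fb i) (FE i) (v i) u1) _.
    by rewrite lerD2l ler_wpM2r ?sqr_ge0 // ler_pM2l ?mulr_gt0 // cw.
  rewrite !big_split /= -!mulr_sumr.
  have x2 : norm2 x ^+ 2 <= (2 * r) ^+ 2 by rewrite lerXn2r ?nnegrE ?norm2_ge0.
  have a1 : \sum_i v i * f i 0 * u i <= h * n%:R * (norm2inf (n%:R^-1 *: QHS X f) * (2 * r)).
    have -> : \sum_i v i * f i 0 * u i =
        - ((-1) ^+ e * h * n%:R) * ((n%:R^-1 *: QHS X f) *m x) j 0.
      have qE : (QHS X f *m x) j 0 = \sum_i Q i j * (f i 0 * u i).
        rewrite /QHS -!mulmxA mxE; apply: eq_bigr => i _.
        by rewrite mul_diag_mx [X in _ * X]mxE [(\row_i _) _ _]mxE [Q^T _ _]mxE.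
      rewrite -scalemxAl mxE qE !mulr_sumr; apply: eq_bigr => i _.
      by rewrite /v /w /=; field; rewrite gt_eqF.
    apply: le_trans (ler_norm _) _; rewrite normrM normrN !normrM normr_sign mul1r.
    rewrite (gtr0_norm h0) (gtr0_norm nR) ler_pM2l ?mulr_gt0 //.
    apply: le_trans (norm2inf_ge _ _ _) _; rewrite ler_wpM2l //.

    (* Nonnegativity of [norm2inf], read off at the vector of ones, whose norm is at least 1. *)
    have e1 := norm2inf_ge (n%:R^-1 *: QHS X f) (const_mx 1) j.
    have e2 := entry_le_norm2 (const_mx 1 : 'cV[R]_s) (Ordinal s0).
    rewrite mxE normr1 in e2.
    by rewrite -(pmulr_lge0 _ (lt_le_trans ltr01 e2)) (le_trans _ e1).
  have a2 : (1 + M + 2 * c3) * \sum_i v i ^+ 2 <= (1 + M + 2 * c3) * (h ^+ 2 * n%:R).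
    rewrite ler_wpM2l ?wv //.
    have := m0; have /andP [? ?] := fb (Ordinal n0); lra.
  have a3 : 2 * c3 * (h * max_entry X) * \sum_i u i ^+ 2 <=
     2 * c3 * (h * max_entry X) * (n%:R / (m * c0) * (2 * r) ^+ 2).
    rewrite ler_wpM2l ?mulr_ge0 ?(ltW c30) ?(ltW h0) //.
    apply: le_trans (sum_sqr_le x) _; rewrite ler_wpM2l // divr_ge0 // mulr_ge0 // ltW //.
  have hn : 0 < h * n%:R by rewrite mulr_gt0.
  have := hyp; rewrite -(ler_pM2l hn) => hyp'.
  have e1 : h * n%:R * (2 * r * norm2inf (n%:R^-1 *: QHS X f) + (1 + M + 2 * c3) * h +
      8 * c3 * max_entry X * (r ^+ 2 / (m * c0))) =
    h * n%:R * (norm2inf (n%:R^-1 *: QHS X f) * (2 * r)) + (1 + M + 2 * c3) * (h ^+ 2 * n%:R)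
    + 2 * c3 * (h * max_entry X) * (n%:R / (m * c0) * (2 * r) ^+ 2) by ring.
  by rewrite e1 in hyp'; lra.
move: l1 l2 k1 k2 => /ler_normlP [? ?] /ler_normlP [? ?] /ler_normlP [? ?] /ler_normlP [? ?].
rewrite /t in t0 *; rewrite -/t; rewrite -lerBlDl dE.
have t8 : h * (n%:R * lam) = 8 * t by rewrite /t; field.
rewrite t8 in gd *; lra.
Qed.

(** The weights are the entries of the unit vector [Z w], with [w = (Z^T Z)^(-1/2) c]. Since
    [Z^T H Z] is the identity and [f <= M], the squared norm of [w] is at most [M], whence the error
    bound by Cauchy-Schwarz. The weights are small by [Sb], applied after rescaling to norm
    [2 * r]. *)
Lemma clt_decomp (c : 'cV[R]_s) : c^T *m c = 1%:M ->
  exists a : 'I_n -> R, [/\ \sum_i a i ^+ 2 = 1,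
    (forall i, `|a i| <= b * Num.sqrt M / (2 * K * Num.sqrt c0)) &
    forall om x W,
      norm2 (sqrtmx A *m x - invmx (sqrtmx A) *m (S^T *m \col_i (tau - (eps i om <= 0)%R%:R))) ^+ 2
        <= W ->
      `|(c^T *m invsqrtmx ((Zmx X f)^T *m Zmx X f) *m invmx (Vmx X f) *m x) 0 0 -
        \sum_i a i * (tau - (eps i om <= 0)%R%:R)| <= Num.sqrt (M * W)].
Proof.
move=> cc.
have [[sB pB] BB] := sqrtmxP SHS_psd.
have uA := SHS_unit; have uB := sqrtmx_unit SHS_psd uA.
set B := sqrtmx A in sB pB BB uB *.
have M0 : 0 < M by have /andP [? ?] := fb (Ordinal n0); have := m0; lra.
set Z := Zmx X f; pose N := Z^T *m Z.
have ZE x : Z *m x = S *m (invmx B *m x) by rewrite /Z /Zmx /Vmx /invsqrtmx mulmxA.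
have normA x : (x^T *m A *m x) 0 0 = norm2 (B *m x) ^+ 2.
  by rewrite -dot_sqr trmx_mul sB -BB !mulmxA.
have Zlow x : M^-1 * norm2 x ^+ 2 <= norm2 (Z *m x) ^+ 2.
  rewrite mulrC ler_pdivrMr // mulrC.
  have -> : norm2 x ^+ 2 = ((invmx B *m x)^T *m A *m (invmx B *m x)) 0 0.
    by rewrite normA mulKVmx.
  rewrite formE ZE norm2_sqr mulr_sumr; apply: ler_sum => i _.
  by rewrite -expr2 ler_wpM2r ?sqr_ge0 //; case/andP: (fb i).
have Nform x : (x^T *m N *m x) 0 0 = norm2 (Z *m x) ^+ 2.
  by rewrite -dot_sqr trmx_mul !mulmxA.
have pN : is_psd N.
  split=> [|x]; first by rewrite /N trmx_mul trmxK.
  by rewrite Nform sqr_ge0.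
have uN : N \in unitmx.
  apply: (@posdef_unitmx _ _ _ M^-1); first by rewrite invr_gt0.
  by move=> x; rewrite Nform.
have [[sG _] GG] := sqrtmxP pN; have uG := sqrtmx_unit pN uN.
set G := sqrtmx N in sG GG uG.
have WE : invsqrtmx N = invmx G by [].
pose w := invmx G *m c.
have c1' : norm2 c ^+ 2 = 1 by rewrite -dot_sqr cc mxE eqxx.
have Zw : norm2 (Z *m w) ^+ 2 = 1.
  by rewrite -Nform -GG -c1' -!dot_sqr trmx_mul trmx_inv sG !mulmxA mulmxKV // mulmxK.
have wM : norm2 w ^+ 2 <= M.
  by have := Zlow w; rewrite Zw mulrC ler_pdivrMr // mul1r.
have trinv : (invmx B)^T = invmx B by rewrite trmx_inv sB.
exists (fun i => (Z *m w) i 0); split.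
- by rewrite -Zw norm2_sqr.
- move=> i; rewrite ZE; set u := invmx B *m w.
  have u2 : c0 * n%:R * norm2 u ^+ 2 <= M.
    have /andP [h _] := Aform u; apply: le_trans h _.
    by rewrite normA /u mulKVmx.
  have [->|u0] := eqVneq u 0.
    rewrite mulmx0 mxE normr0 divr_ge0 // mulr_ge0 ?sqrtr_ge0 ?(ltW b0) //.
    by rewrite mulr_ge0 // ltW.
  have nu := norm2_gt0 u0.
  pose th := 2 * r / norm2 u.
  have th0 : 0 < th by rewrite divr_gt0 // mulr_gt0.
  have := Sb (x := th *: u) i _.
  rewrite norm2Z gtr0_norm // divfK ?gt_eqF // lexx => /(_ isT).
  rewrite -scalemxAr mxE normrM gtr0_norm // => h.
  have h1 : `|(S *m u) i 0| <= b * (norm2 u / (2 * r)).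
    move: h; rewrite /th mulrAC ler_pdivrMr //.
    by move=> h'; rewrite mulrA ler_pdivlMr; [rewrite mulrC|rewrite mulr_gt0].
  apply: le_trans h1 _; rewrite -mulrA ler_pM2l //.
  have sc0 : 0 < Num.sqrt c0 by rewrite sqrtr_gt0.
  suff hh : norm2 u * (K * Num.sqrt c0) <= Num.sqrt M * r.
    rewrite ler_pdivrMr; last by rewrite mulr_gt0.
    rewrite [leRHS]mulrAC ler_pdivlMr; last by rewrite mulr_gt0 // mulr_gt0.
    by lra.
  rewrite -ler_sqr ?nnegrE ?mulr_ge0 ?norm2_ge0 ?sqrtr_ge0 ?(ltW K0) ?(ltW r0) //.
  rewrite -(ler_pM2l nR).
  have -> : n%:R * (norm2 u * (K * Num.sqrt c0)) ^+ 2 = c0 * n%:R * norm2 u ^+ 2 * K ^+ 2.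
    by rewrite -{2}(sqr_sqrtr (ltW c00)); ring.
  have -> : n%:R * (Num.sqrt M * r) ^+ 2 = M * (K ^+ 2 * s%:R).
    by rewrite -r2 -{2}(sqr_sqrtr (ltW M0)); ring.
  apply: ler_pM; rewrite ?sqr_ge0 //.
    by rewrite mulr_ge0 ?sqr_ge0 // mulr_ge0 // ltW.
  by rewrite ler_peMr ?sqr_ge0 // ler1n.
- move=> om x W; set psi := \col_i _; set del := _ - _ => hW.
  have -> : \sum_i (Z *m w) i 0 * (tau - (eps i om <= 0)%R%:R) = ((Z *m w)^T *m psi) 0 0.
    by rewrite dotE; apply: eq_bigr => i _; rewrite [psi _ _]mxE.
  have iV : invmx (Vmx X f) = B by rewrite /Vmx /invsqrtmx invmxK.
  have -> : (Z *m w)^T *m psi = w^T *m (invmx B *m (S^T *m psi)).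
    by rewrite ZE !trmx_mul trinv !mulmxA.
  rewrite iV -/N WE.
  have -> : c^T *m invmx G *m B *m x = w^T *m (B *m x).
    by rewrite /w trmx_mul trmx_inv sG !mulmxA.
  have -> : (w^T *m (B *m x)) 0 0 - (w^T *m (invmx B *m (S^T *m psi))) 0 0 = (w^T *m del) 0 0.
    by rewrite /del mulmxBr [RHS]mxE [X in _ = _ + X]mxE.
  rewrite -ler_sqr ?nnegrE ?sqrtr_ge0 // sqr_sqrtr; last first.
    by rewrite mulr_ge0 ?(ltW M0) // (le_trans _ hW) // sqr_ge0.
  apply: (@le_trans _ _ ((norm2 w * norm2 del) ^+ 2)).
    by rewrite ler_sqr ?nnegrE ?mulr_ge0 ?norm2_ge0 //; exact: dotmx_le.
  by rewrite exprMn ler_pM ?sqr_ge0.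
Qed.

Variable beta1 : 'cV[R]_s.
Local Notation y om := (response X (col_mx beta1 0) (fun i => eps i) om).

Lemma response_resid om x i :
  y om i 0 - (S *m x) i 0 = eps i om - (S *m (x - beta1)) i 0.
Proof.
rewrite /response -{1}(hsubmxK X) mul_row_col mulmx0 addr0 mulmxBr.
by rewrite 2![(_ + _ : 'cV__) i 0]mxE [(- _ : 'cV__) i 0]mxE [(\col_i _) i 0]mxE; ring.
Qed.

Lemma resid_incr om x :
  resid_loss tau S (y om) x = oracle_incr om (x - beta1) + \sum_i rho tau (eps i om).
Proof.
by rewrite /oracle_incr sumrB subrK; apply: eq_bigr => i _; rewrite response_resid.
Qed.

Lemma oracle_argmin om bh z :
  (forall x, resid_loss tau S (y om) bh <= resid_loss tau S (y om) x) ->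
  oracle_incr om (bh - beta1) <= oracle_incr om z.
Proof. by move=> /(_ (z + beta1)); rewrite !resid_incr lerD2r addrK. Qed.

Lemma oracle_argmin_le0 om bh :
  (forall x, resid_loss tau S (y om) bh <= resid_loss tau S (y om) x) ->
  oracle_incr om (bh - beta1) <= 0.
Proof.
move=> bmin; apply: le_trans (oracle_argmin 0 bmin) _.
by rewrite /oracle_incr big1 // => i _; rewrite mulmx0 mxE subr0 subrr.
Qed.

(** The fluctuations are of order [K * s] and the threshold [t1] of order [K ^+ 2 * s]: the factor
    [s] cancels, and the failure probability is governed by [c0 * K] alone. *)
Lemma rate_event : exists A0, [/\ measurable A0, 1 - 512 / (c0 * K) <= fine (P A0) &
  A0 `<=` [set om | lin_event t1 om /\ kn_event t1 om]].
Proof.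
have t10 : 0 < t1 by rewrite divr_gt0 // !mulr_gt0 // exprn_gt0.
have [A1 [m1 p1 h1]] := lin_event_prob t10.
have [A2 [m2 p2 h2]] := kn_event_prob t10.
have e : 16 * K * s%:R / t1 = 256 / (c0 * K) by field; rewrite !gt_eqF.
have p2' : 1 - 16 * K * s%:R / t1 <= fine (P A2).
  apply: le_trans p2; rewrite lerD2l lerN2 ler_pM2r ?invr_gt0 //.
  rewrite ler_piMr ?mulr_ge0 ?(ltW K0) // -[leRHS]sqrtr1 ler_wsqrtr //.
  by rewrite ge_min lexx.
have [mA pA] := prob_setI m1 m2 p1 p2'.
exists (A1 `&` A2); split=> [//||om [? ?]]; last by split; [exact: h1|exact: h2].
by apply: le_trans pA; rewrite e lerD2l lerN2 -mulrDl; lra.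
Qed.

Lemma bahadur_event t : 0 < t -> exists A0, [/\ measurable A0,
  1 - (512 / (c0 * K) + 16 * K * s%:R * Num.sqrt ((6 * M + 20 * c3) * b) / t) <= fine (P A0) &
  forall om bh, A0 om ->
    (forall x, resid_loss tau S (y om) bh <= resid_loss tau S (y om) x) ->
    norm2 (sqrtmx A *m (bh - beta1) -
           invmx (sqrtmx A) *m (S^T *m \col_i (tau - (eps i om <= 0)%R%:R))) ^+ 2
    <= 4 * (t + c3 * b * (4 * (K ^+ 2 * s%:R) / (m * c0)))].
Proof.
move=> t0.
have [A1 [m1 p1 h1]] := rate_event.
have [A2 [m2 p2 h2]] := kn_event_prob t0.
have p2' : 1 - 16 * K * s%:R * Num.sqrt ((6 * M + 20 * c3) * b) / t <= fine (P A2).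
  apply: le_trans p2; rewrite lerD2l lerN2 ler_pM2r ?invr_gt0 //.
  rewrite ler_wpM2l ?mulr_ge0 ?(ltW K0) // ler_wsqrtr //.
  by rewrite ge_min lexx orbT.
have [mA pA] := prob_setI m1 m2 p1 p2'.
exists (A1 `&` A2); split=> // om bh [/h1 [hl hk] /h2 hk2] bmin.
apply: (oracle_bahadur hl hk2).
  exact: (oracle_rate hl hk (oracle_argmin_le0 bmin)).
by move=> z; exact: oracle_argmin.
Qed.

Lemma minimizer_event a lam h L : 0 < h -> 0 < lam -> 0 < L ->
  ln (2 * q + 1)%:R <= L ->
  2 * r * norm2inf (n%:R^-1 *: QHS X f) + (1 + M + 2 * c3) * h +
    8 * c3 * max_entry X * (r ^+ 2 / (m * c0)) <= lam / 2 ->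
  2 < a -> (forall j, 2 * a * lam <= `|beta1 j 0|) ->
  exists A0, [/\ measurable A0,
    1 - (512 / (c0 * K) +
      128 * (2 * K * s%:R + 3 * h * Num.sqrt n%:R * Num.sqrt L) / (h * (n%:R * lam)))
      <= fine (P A0) &
    forall om bh, A0 om ->
    (forall x, resid_loss tau S (y om) bh <= resid_loss tau S (y om) x) ->
    norm2 (bh - beta1) <= r /\
    forall bi, norm2 (bi - col_mx beta1 0) <= lam ->
      global_minimizer (arlasso_obj tau X (y om) lam (scad_weights a lam bi)) (col_mx bh 0)].
Proof.
move=> h0 lam0 L0 LJ hyp a2 bmin.
have [A1 [m1 p1 h1]] := rate_event.
have [A2 [m2 p2 h2]] := nullity_prob h0 lam0 L0 LJ hyp.
have [mA pA] := prob_setI m1 m2 p1 p2.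
exists (A1 `&` A2); split=> // om bh [/h1 [hl hk] in2] ohb.
have br := oracle_rate hl hk (oracle_argmin_le0 ohb); split=> // bi bil.
have [d0 d1] := scad_weights_oracle lam0 a2 bmin bil.
apply: (global_of_oracle (b0 := beta1) tau01 h0 r0 d0 d1 ohb br) => x xr e j.
have := h2 om in2 _ xr e j.
rewrite /resid_loss; under eq_bigr do rewrite -response_resid.
by under [X in _ <= X + _]eq_bigr do rewrite -response_resid.
Qed.

Lemma clt_event (c : 'cV[R]_s) t : c^T *m c = 1%:M -> 0 < t ->
  exists a : 'I_n -> R, [/\ \sum_i a i ^+ 2 = 1,
    (forall i, `|a i| <= b * Num.sqrt M / (2 * K * Num.sqrt c0)) &
    exists A0, [/\ measurable A0,
      1 - (512 / (c0 * K) + 16 * K * s%:R * Num.sqrt ((6 * M + 20 * c3) * b) / t)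
        <= fine (P A0) &
      forall om bh, A0 om ->
        (forall x, resid_loss tau S (y om) bh <= resid_loss tau S (y om) x) ->
        `|(c^T *m invsqrtmx ((Zmx X f)^T *m Zmx X f) *m invmx (Vmx X f) *m (bh - beta1)) 0 0 -
          \sum_i a i * (tau - (eps i om <= 0)%R%:R)| <=
        Num.sqrt (M * (4 * (t + c3 * b * (4 * (K ^+ 2 * s%:R) / (m * c0)))))]].
Proof.
move=> /clt_decomp [a [a1 a2 a3]] /bahadur_event [A0 [mA pA hA]].
exists a; split=> //; exists A0; split=> // om bh Aom bmin.
by apply: a3; exact: hA.
Qed.

End FixedN.

(** The event is trapped between those of the linear statistic at [x - kap] and [x + kap]: [e1] pays
    for the exceptional set, [e2] for the normal approximation, the last term for the shift. *)
Lemma clt_cdf_bound (d : measure_display) (T : measurableType d) (R : realType)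
    (P : probability T R) n (eps : 'I_n -> {RV P >-> R}) (tau sg x kap e1 e2 : R)
    (a : 'I_n -> R) (Y : T -> R) (A : set T) :
  0 < sg ->
  mutually_independent eps -> (forall i, P [set om | eps i om <= 0] = tau%:E) ->
  measurable_fun setT Y -> measurable A -> 1 - e1 <= fine (P A) -> 0 <= kap ->
  (forall om, A om -> `|Y om - \sum_i a i * (tau - (eps i om <= 0)%R%:R)| <= kap) ->
  (forall z, z = x + kap \/ z = x - kap -> `|Ex (bern tau (n := n))
     (fun b => (\sum_i a i * (tau - (b i)%:R) <= z)%R%:R) - ncdf sg z| <= e2) ->
  `|fine (P [set om | Y om <= x]) - ncdf sg x| <= e1 + e2 + normal_peak sg * kap.
Proof.
move=> sg0 indep Ptau mY mA pA kap0 YA hz.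
have mE : measurable [set om | Y om <= x].
  have -> : [set om | Y om <= x] = [set: T] `&` Y @^-1` `]-oo, x].
    by apply/seteqP; split=> om /=; rewrite in_itv //= => -[].
  exact: mY.
have [mp ep] := signs_transfer a (x + kap) indep Ptau.
have [mm em] := signs_transfer a (x - kap) indep Ptau.
have up := prob_le_on mA mE mp _ pA; have lo := prob_le_on mA mm mE _ pA.
have := hz _ (or_introl erefl); have := hz _ (or_intror erefl); rewrite -ep -em.
have := ncdf_lip sg0 x (x + kap); have := ncdf_lip sg0 x (x - kap).
rewrite ![x + _ - x]addrAC subrr !add0r normrN (ger0_norm kap0).
move=> /ler_normlP [? ?] /ler_normlP [? ?] /ler_normlP [? ?] /ler_normlP [? ?].
have {}up : fine (P [set om | Y om <= x]) <=
    fine (P [set om | \sum_i a i * (tau - (eps i om <= 0)%R%:R) <= x + kap]) + e1.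
  apply: up => om [h1 /= h2]; have /ler_normlP [? ?] := YA om h1; lra.
have {}lo : fine (P [set om | \sum_i a i * (tau - (eps i om <= 0)%R%:R) <= x - kap]) <=
    fine (P [set om | Y om <= x]) + e1.
  apply: lo => om [h1 /= h2]; have /ler_normlP [? ?] := YA om h1; lra.
by apply/ler_normlP; split; lra.
Qed.

(** * Elementary bounds relating the rates *)

Lemma max_entry_ge1 (R : realType) n p (X : 'M[R]_(n, p)) (j : 'I_p) : (0 < n)%N ->
  norm2 (col j X) = Num.sqrt n%:R -> 1 <= max_entry X.
Proof.
move=> n0 hX; have k0 : 0 <= max_entry X by rewrite /max_entry; apply: bigmax_ge_id.
have nR : 0 < n%:R :> R by rewrite ltr0n.
rewrite -(ler_pXn2r (n := 2)) ?nnegrE // expr1n -(ler_pM2l nR) mulr1.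
rewrite -[leLHS]sqr_sqrtr // -hX norm2_sqr.
apply: le_trans (_ : \sum_(i < n) max_entry X ^+ 2 <= _).
  apply: ler_sum => i _; rewrite mxE -real_normK ?num_real //.
  by rewrite ler_sqr ?nnegrE // max_entry_ge.
by rewrite sumr_const card_ord mulr_natl.
Qed.

(** The value 1/4 is chosen for its root 1/2, a convenient lower bound for [sqrt (ln p)]. *)
Lemma ln_nat_ge (R : realType) k : (1 < k)%N -> 1 / 4 <= ln k%:R :> R.
Proof.
move=> k1; apply: (@le_trans _ _ (ln 2%:R)); last first.
  by rewrite ler_ln ?posrE ?ltr0n ?ler_nat // (ltn_trans _ k1).
have := expR_ge1Dx (- ln 2%:R : R); rewrite expRN lnK ?posrE ?ltr0n //.
have : (2%:R : R)^-1 = 1 / 2 by rewrite div1r.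
move=> ->; lra.
Qed.

(** [ell] stands for [ln (ln n)] and [G] for an arbitrarily large lower bound of its root: this is
    how [lam] comes to exceed [sqrt (s * ln p / n)], and with [ln p >= 1 / 4] also [sqrt (s / n)],
    by any given factor. *)
Lemma scale_bounds (R : realType) (c lam s lp ell n G : R) :
  0 < c -> 0 < s -> 0 < n -> 1 / 4 <= lp -> 0 < G -> G ^+ 2 <= ell ->
  c * Num.sqrt (s * lp * ell / n) <= lam ->
  [/\ 0 < lam, Num.sqrt (s / n) * Num.sqrt lp <= lam / (c * G) &
      Num.sqrt (s / n) <= 2 * (lam / (c * G))].
Proof.
move=> c0 s0 n0 lp1 G0 hG.
have l0 : 0 < lp by lra.
have e0 : 0 < ell by apply: lt_le_trans hG; rewrite exprn_gt0.
have -> : s * lp * ell / n = s / n * lp * ell by field; rewrite gt_eqF.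
rewrite (sqrtrM ell) ?(sqrtrM lp) ?mulr_ge0 ?divr_ge0 ?invr_ge0 ?(ltW s0) ?(ltW n0) ?(ltW l0) //.
set w := Num.sqrt (s / n); set v := Num.sqrt lp; set g := Num.sqrt ell => h.
have w0 : 0 < w by rewrite sqrtr_gt0 divr_gt0.
have v12 : 1 / 2 <= v.
  rewrite -[leLHS]ger0_norm ?divr_ge0 // -sqrtr_sqr ler_wsqrtr //.
  by apply: le_trans lp1; rewrite expr2; lra.
have gG : G <= g by rewrite -[leLHS](gtr0_norm G0) -sqrtr_sqr ler_wsqrtr.
have wv : 0 < w * v by rewrite mulr_gt0 //; lra.
have h1 : w * v * G <= w * v * g by rewrite ler_pM2l.
have hw : w * v * (c * G) <= lam.
  apply: le_trans h; have -> : w * v * (c * G) = c * (w * v * G) by ring.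
  by rewrite ler_pM2l.
have cG : 0 < c * G by rewrite mulr_gt0.
have b1 : w * v <= lam / (c * G) by rewrite ler_pdivlMr.
split=> //; first by apply: lt_le_trans hw; rewrite mulr_gt0.
have : w * (1 / 2) <= w * v by rewrite ler_pM2l.
lra.
Qed.

(** Here [w] stands for [sqrt (s / n)], [v] for [sqrt (ln p)], [sn] for [sqrt n], [N] for [norm2inf]
    and [kap] for the largest entry. The step is [h = e0 * lam]: small enough for the curvature
    term, yet proportional to [lam], so that [s / (h * n * lam)] is of order [s / (n * lam ^+ 2)]
    and hence small. Each of the three terms gets [lam / 8]. *)
Lemma nullity_numeric (R : realType) (K C4 D c3 m c0 e0 lam w v kap N th sn s n eta : R) :
  0 < K -> 0 < C4 -> 0 < c3 -> 0 < m -> 0 < c0 -> 0 < e0 -> 0 < lam -> 0 < w -> 0 < v ->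
  0 < th -> th <= 1 -> 0 < s -> 0 < n -> 0 < sn -> sn ^+ 2 = n -> w ^+ 2 = s / n -> sn^-1 <= w ->
  D * e0 <= 1 / 8 -> N <= C4 * v -> kap * (s / sn) <= 1 ->
  w * v <= th * lam -> w <= 2 * (th * lam) ->
  16 * K * C4 * th <= 1 -> 128 * (c3 * K ^+ 2 / (m * c0)) * th <= 1 ->
  (1024 * K / e0 + 768) * th <= eta ->
  2 * (K * w) * N + D * (e0 * lam) + 8 * c3 * kap * ((K * w) ^+ 2 / (m * c0)) <= lam / 2 /\
  128 * (2 * K * s + 3 * (e0 * lam) * sn * (2 * v)) / (e0 * lam * (n * lam)) <= eta.
Proof.
move=> K0 C40 c30 m0 c00 e00 lam0 w0 v0 th0 th1 s0 n0 sn0 snn w2 snw De Nv ks wv wt t1 t2 t3.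
have mc : 0 < m * c0 by rewrite mulr_gt0.
split.
  have a1 : 2 * (K * w) * N <= lam / 8.
    apply: (@le_trans _ _ (2 * (K * w) * (C4 * v))).
      by rewrite ler_wpM2l // !mulr_ge0 // ltW.
    have -> : 2 * (K * w) * (C4 * v) = 2 * K * C4 * (w * v) by ring.
    apply: (@le_trans _ _ (2 * K * C4 * (th * lam))).
      by rewrite ler_pM2l // !mulr_gt0.
    have -> : 2 * K * C4 * (th * lam) = 16 * K * C4 * th * (lam / 8) by field.
    by rewrite ler_piMl // divr_ge0 // ltW.
  have a2 : D * (e0 * lam) <= lam / 8.
    rewrite mulrA; apply: le_trans (_ : 1 / 8 * lam <= _); last by lra.
    by rewrite ler_pM2r.
  have a3 : 8 * c3 * kap * ((K * w) ^+ 2 / (m * c0)) <= lam / 8.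
    have kw : kap * w ^+ 2 <= 2 * (th * lam).
      apply: le_trans wt; apply: le_trans snw.
      have -> : kap * w ^+ 2 = kap * (s / sn) * sn^-1.
        by rewrite w2 -snn; field; rewrite gt_eqF.
      by rewrite ler_piMl // invr_ge0 ltW.
    have -> : 8 * c3 * kap * ((K * w) ^+ 2 / (m * c0)) =
       8 * (c3 * K ^+ 2 / (m * c0)) * (kap * w ^+ 2) by field; rewrite !gt_eqF.
    have q0 : 0 < c3 * K ^+ 2 / (m * c0) by rewrite divr_gt0 // mulr_gt0 // exprn_gt0.
    apply: (@le_trans _ _ (8 * (c3 * K ^+ 2 / (m * c0)) * (2 * (th * lam)))).
      by rewrite ler_pM2l // mulr_gt0.
    have -> : 8 * (c3 * K ^+ 2 / (m * c0)) * (2 * (th * lam)) =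
       128 * (c3 * K ^+ 2 / (m * c0)) * th * (lam / 8) by field; rewrite !gt_eqF.
    by rewrite ler_piMl // divr_ge0 // ltW.
  lra.
apply: le_trans t3.
have -> : 128 * (2 * K * s + 3 * (e0 * lam) * sn * (2 * v)) / (e0 * lam * (n * lam)) =
   256 * K / e0 * (s / n / lam ^+ 2) + 768 * (sn^-1 * v / lam).
  by rewrite -snn; field; rewrite !gt_eqF.
have b1 : s / n / lam ^+ 2 <= 4 * th.
  rewrite -w2 ler_pdivrMr ?exprn_gt0 //.
  apply: (@le_trans _ _ ((2 * (th * lam)) ^+ 2)).
    by rewrite ler_sqr ?nnegrE ?mulr_ge0 ?(ltW w0) ?(ltW th0) ?(ltW lam0).
  have -> : (2 * (th * lam)) ^+ 2 = 4 * th * lam ^+ 2 * th by ring.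
  by rewrite ler_piMr // mulr_ge0 ?sqr_ge0 // mulr_ge0 // ltW.
have b2 : sn^-1 * v / lam <= th.
  rewrite ler_pdivrMr //; apply: le_trans wv.
  by rewrite ler_pM2r.
have -> : (1024 * K / e0 + 768) * th = 256 * K / e0 * (4 * th) + 768 * th by ring.
apply: lerD; [apply: (ler_wpM2l _ b1)|apply: (ler_wpM2l _ b2)]; last exact: ler0n.
by apply: divr_ge0; [apply: mulr_ge0; [exact: ler0n|]|]; exact: ltW.
Qed.

Lemma littleo_le (R : realType) (u v : nat -> R) : u =o_\oo v ->
  forall e, 0 < e -> \forall n \near \oo, `|u n| <= e * `|v n|.
Proof. by move/eqoP. Qed.

Lemma theta_ge (R : realType) (u v : nat -> R) : u =Theta_\oo v ->
  exists2 c, 0 < c & \forall n \near \oo, c * `|v n| <= `|u n|.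
Proof.
rewrite eqThetaE qualifE => /asboolP [[k1 k2] /= /andP [k10 k20]] /near_andP [h _].
by exists k1.
Qed.

Lemma near_lnln (R : realType) (G : R) : \forall n \near \oo, G <= ln (ln n%:R).
Proof.
near=> n.
have h : expR (expR G) <= n%:R by near: n; exact: nbhs_infty_ger.
have n0 : 0 < n%:R :> R by apply: lt_le_trans h; exact: expR_gt0.
have h1 : expR G <= ln n%:R by rewrite -ler_expR lnK.
have l0 : 0 < ln n%:R :> R by apply: lt_le_trans h1; exact: expR_gt0.
by rewrite -ler_expR lnK.
Unshelve. all: by end_near. Qed.

(** A row of [S] has norm at most [sqrt s] times the largest entry, and the radius is
    [K * sqrt (s / n)]: up to [2 * K] their product is the quantity that Condition 2 makes small. *)
Lemma lsubmx_entry_bound (R : realType) n s q (X : 'M[R]_(n, s + q)) (K b : R) :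
  (0 < n)%N -> 0 < K -> max_entry X * (s%:R / Num.sqrt n%:R) <= b / (2 * K) ->
  forall (x : 'cV[R]_s) i, norm2 x <= 2 * radius n s K -> `|(lsubmx X *m x) i 0| <= b.
Proof.
move=> n0 K0 hb x i hx.
have k0 : 0 <= max_entry X by rewrite /max_entry; apply: bigmax_ge_id.
apply: le_trans (mulmx_row_le _ _ _) _.
have h1 : norm2 (row i (lsubmx X))^T <= Num.sqrt s%:R * max_entry X.
  apply: norm2_entries_le => // j; rewrite !mxE; exact: max_entry_ge.
apply: (@le_trans _ _ (Num.sqrt s%:R * max_entry X * (2 * radius n s K))).
  by rewrite ler_pM ?norm2_ge0.
have -> : Num.sqrt s%:R * max_entry X * (2 * radius n s K) =
    2 * K * (max_entry X * (s%:R / Num.sqrt n%:R)).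
  rewrite /radius sqrtrM ?ler0n // sqrtrV ?ler0n //.
  rewrite -[in RHS](sqr_sqrtr (ler0n R s)); ring.
by rewrite mulrC -ler_pdivlMr // mulr_gt0.
Qed.

(** [S x = Z (B x)] with [B] the root of [SHS], and [B x] has norm of order [K * sqrt s] on the
    ball; so [max_fZ] bounds the entries at the price of one factor [sqrt s]. *)
Lemma max_fZ_bound (R : realType) n s q (X : 'M[R]_(n, s + q)) (f : 'I_n -> R -> R)
    (K b m c0 : R) :
  (0 < n)%N -> 0 < K -> 0 < m -> 0 < c0 -> (forall i, m <= f i 0) ->
  (forall x : 'cV[R]_s,
    c0 * n%:R * norm2 x ^+ 2 <= (x^T *m SHS X f *m x) 0 0 <= n%:R / c0 * norm2 x ^+ 2) ->
  max_fZ X f * (2 * K * Num.sqrt s%:R) <= b * Num.sqrt (m * c0) ->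
  forall (x : 'cV[R]_s) i, norm2 x <= 2 * radius n s K -> `|(lsubmx X *m x) i 0| <= b.
Proof.
move=> n0 K0 m0 c00 fm Aform hb x i hx.
have nR : 0 < n%:R :> R by rewrite ltr0n.
have pA := SHS_psd c00 Aform; have uA := SHS_unit n0 c00 Aform.
have [[sB _] BB] := sqrtmxP pA; have uB := sqrtmx_unit pA uA.
set B := sqrtmx _ in sB BB uB.
have -> : lsubmx X *m x = Zmx X f *m (B *m x).
  by rewrite /Zmx /Vmx /invsqrtmx -mulmxA mulKmx.
apply: le_trans (mulmx_row_le _ _ _) _; set z := norm2 _.
have sm : 0 < Num.sqrt m by rewrite sqrtr_gt0.
have sc : 0 < Num.sqrt c0 by rewrite sqrtr_gt0.
have h1 : Num.sqrt m * z <= max_fZ X f.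
  apply: le_trans (_ : Num.sqrt (f i 0) * z <= _).
    by rewrite ler_wpM2r ?norm2_ge0 // ler_wsqrtr.
  exact: (le_bigmax _ (fun i => Num.sqrt (f i 0) * norm2 (row i (Zmx X f))^T) i).
have h2 : Num.sqrt c0 * norm2 (B *m x) <= 2 * K * Num.sqrt s%:R.
  rewrite -ler_sqr ?nnegrE ?mulr_ge0 ?norm2_ge0 ?sqrtr_ge0 ?(ltW K0) //.
  have -> : (Num.sqrt c0 * norm2 (B *m x)) ^+ 2 = c0 * norm2 (B *m x) ^+ 2.
    by rewrite exprMn sqr_sqrtr // ltW.
  have -> : norm2 (B *m x) ^+ 2 = (x^T *m SHS X f *m x) 0 0.
    by rewrite -dot_sqr trmx_mul sB -BB !mulmxA.
  have /andP [_ h] := Aform x.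
  apply: (@le_trans _ _ (c0 * (n%:R / c0 * (2 * radius n s K) ^+ 2))).
    rewrite ler_pM2l //; apply: le_trans h _; rewrite ler_pM2l ?divr_gt0 //.
    rewrite ler_sqr ?nnegrE ?norm2_ge0 //; exact: le_trans (norm2_ge0 _) hx.
  have -> : (2 * K * Num.sqrt s%:R) ^+ 2 = 4 * K ^+ 2 * s%:R.
    by rewrite exprMn sqr_sqrtr //; ring.
  have -> : c0 * (n%:R / c0 * (2 * radius n s K) ^+ 2) = 4 * K ^+ 2 * s%:R.
    rewrite exprMn /radius exprMn sqr_sqrtr ?divr_ge0 //; field.
    by rewrite !gt_eqF.
  by [].
rewrite -(ler_pM2r (_ : 0 < Num.sqrt (m * c0))); last by rewrite sqrtr_gt0 mulr_gt0.
apply: le_trans hb; rewrite sqrtrM ?(ltW m0) //.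
have -> : z * norm2 (B *m x) * (Num.sqrt m * Num.sqrt c0) =
  (Num.sqrt m * z) * (Num.sqrt c0 * norm2 (B *m x)) by ring.
by rewrite ler_pM ?mulr_ge0 ?norm2_ge0 // ltW.
Qed.

Lemma scaled_form_bounds (R : realType) s (A : 'M[R]_s) (c0 n : R) : 0 < n ->
  A^T = A -> (forall a, eigenvalue (n^-1 *: A) a -> c0 <= a <= c0^-1) ->
  forall x : 'cV[R]_s,
    c0 * n * norm2 x ^+ 2 <= (x^T *m A *m x) 0 0 <= n / c0 * norm2 x ^+ 2.
Proof.
move=> n0 sA eig x.
have sA' : (n^-1 *: A)^T = n^-1 *: A by rewrite linearZ /= sA.
have /andP [h1 h2] := form_bounds sA' eig x.
have e : (x^T *m (n^-1 *: A) *m x) 0 0 = n^-1 * (x^T *m A *m x) 0 0.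
  by rewrite -scalemxAr -scalemxAl mxE.
have -> : (x^T *m A *m x) 0 0 = n * (x^T *m (n^-1 *: A) *m x) 0 0.
  by rewrite e mulVKf ?gt_eqF.
have -> : c0 * n * norm2 x ^+ 2 = n * (c0 * norm2 x ^+ 2) by ring.
by rewrite -mulrA !ler_pM2l // h1.
Qed.

(** * Asymptotics *)

Section Asymptotics.
Context (R : realType) (d : nat -> measure_display) (T : forall n, measurableType (d n))
  (P : forall n, probability (T n) R) (tau a : R) (s q : nat -> nat)
  (X : forall n, 'M[R]_(n, s n + q n)) (beta1 : forall n, 'cV[R]_(s n))
  (eps : forall n, 'I_n -> {RV (P n) >-> R}) (f : forall n, 'I_n -> R -> R)
  (lam : nat -> R) (m M c0 c1 c2 c C4 : R).
Arguments eps : clear implicits.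
Arguments f : clear implicits.
Hypothesis tau01 : 0 < tau < 1.
Hypothesis a2 : 2 < a.
Hypothesis s0 : forall n, (0 < s n)%N.
Hypothesis Xcol : forall n (j : 'I_(s n + q n)), norm2 (col j (X n)) = Num.sqrt n%:R.
Hypothesis indep : forall n, mutually_independent (eps n).
Hypothesis Ptau : forall n i, P n [set w | eps n i w <= 0] = tau%:E.
Hypothesis m0 : 0 < m.
Hypothesis c00 : 0 < c0.
Hypothesis c10 : 0 < c1.
Hypothesis c20 : 0 < c2.
Hypothesis c_gt0 : 0 < c.
Hypothesis C40 : 0 < C4.
Hypothesis fb : forall n i, m <= f n i 0 <= M.
Hypothesis FE : forall n i x, `|x| <= c1 ->
  `|distr_fun (eps n i) x - distr_fun (eps n i) 0 - x * f n i 0| <= c2 * x ^+ 2.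
Hypothesis eig : \forall n \near \oo, forall x : R,
  eigenvalue (n%:R^-1 *: SHS (X n) (f n)) x -> c0 <= x <= c0^-1.
Hypothesis kap : (fun n => max_entry (X n)) =o_\oo (fun n => Num.sqrt n%:R / (s n)%:R : R).
Hypothesis lamc : \forall n \near \oo,
  c * Num.sqrt ((s n)%:R * ln (s n + q n)%:R * ln (ln n%:R) / n%:R) <= lam n.
Hypothesis lp_ge : \forall n \near \oo, 1 / 4 <= ln (s n + q n)%:R :> R.
Hypothesis bmin : \forall n \near \oo, forall j : 'I_(s n), 2 * a * lam n <= `|beta1 n j 0|.
Hypothesis n2 : \forall n \near \oo, norm2inf (n%:R^-1 *: QHS (X n) (f n)) <
  C4 * Num.sqrt (ln (s n + q n)%:R * ln (ln n%:R) / ln n%:R).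
Local Notation y n w := (response (X n) (col_mx (beta1 n) 0) (fun i => eps n i) w).
Local Notation c3 := (cub M c1 c2).
Local Notation w n := (Num.sqrt ((s n)%:R / n%:R) : R).
Local Notation v n := (Num.sqrt (ln (s n + q n)%:R) : R).

(* The asymptotic hypotheses at a given [n], with [th] in place of every [o(1)]. *)
Definition regular (th : R) (n : nat) : Prop :=
  [/\ (0 < n)%N, 1 / 4 <= ln (s n + q n)%:R :> R, th^-1 <= Num.sqrt (ln n%:R),
    forall x : 'cV[R]_(s n), c0 * n%:R * norm2 x ^+ 2 <=
      (x^T *m SHS (X n) (f n) *m x) 0 0 <= n%:R / c0 * norm2 x ^+ 2 &
    [/\ 0 < lam n, w n * v n <= th * lam n, w n <= 2 * (th * lam n),
      norm2inf (n%:R^-1 *: QHS (X n) (f n)) <= C4 * v n &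
      max_entry (X n) * ((s n)%:R / Num.sqrt n%:R) <= th /\
      forall j, 2 * a * lam n <= `|beta1 n j 0|]].

Lemma near_regular th : 0 < th -> \forall n \near \oo, regular th n.
Proof.
(* The first summand yields [lam / (c * G) <= th * lam], the second [th^-1 <= sqrt (ln n)]. *)
move=> th0; pose G := (c * th)^-1 + th^-1.
have cth : 0 < (c * th)^-1 by rewrite invr_gt0 mulr_gt0.
have ith : 0 < th^-1 by rewrite invr_gt0.
have G0 : 0 < G by rewrite addr_gt0.
near=> n.
have n0 : (0 < n)%N by near: n; exact: nbhs_infty_gt.
have nR : 0 < n%:R :> R by rewrite ltr0n.
have sR : 0 < (s n)%:R :> R by rewrite ltr0n.
have lp : 1 / 4 <= ln (s n + q n)%:R :> R by near: n.
have ell : G ^+ 2 <= ln (ln n%:R) by near: n; exact: near_lnln.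
have ell0 : 0 < ln (ln n%:R) :> R by apply: lt_le_trans ell; rewrite exprn_gt0.
(* [ln] is 0 at nonpositive arguments, so a positive [ln (ln n)] forces [ln n > 0]. *)
have ln0' : 0 < ln n%:R :> R.
  by rewrite ltNge; apply/negP => h; move: ell0; rewrite ln0 ?ltxx.
have lnell : ln (ln n%:R) <= ln n%:R :> R by rewrite ltW // ln_sublinear.
have [lam0 b1 b2] : [/\ 0 < lam n, w n * v n <= lam n / (c * G) & w n <= 2 * (lam n / (c * G))].
  by apply: (scale_bounds (ell := ln (ln n%:R))) => //; near: n.
have cG : lam n / (c * G) <= th * lam n.
  rewrite mulrC ler_pM2r // -[leRHS]invrK lef_pV2 ?posrE ?invr_gt0 ?mulr_gt0 //.
  rewrite /G mulrDr; apply: (@le_trans _ _ (c * (c * th)^-1)); last first.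
    by rewrite lerDl mulr_ge0 ?ltW.
  by rewrite invfM mulrA mulfV ?gt_eqF // mul1r.
split=> //.
- apply: (@le_trans _ _ G); first by rewrite /G lerDr ltW.
  by rewrite -[leLHS](gtr0_norm G0) -sqrtr_sqr ler_wsqrtr // (le_trans ell).
- apply: scaled_form_bounds => //; first by rewrite /SHS !trmx_mul trmxK tr_diag_mx mulmxA.
  by near: n.
split=> //; [exact: le_trans b1 _|lra| |].
- have /ltW h : norm2inf (n%:R^-1 *: QHS (X n) (f n)) <
    C4 * Num.sqrt (ln (s n + q n)%:R * ln (ln n%:R) / ln n%:R) by near: n.
  apply: le_trans h _; rewrite ler_pM2l // ler_wsqrtr // -mulrA ler_piMr //.
    by apply: le_trans lp; lra.
  by rewrite ler_pdivrMr // mul1r.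
- split; last by near: n.
  have : `|max_entry (X n)| <= th * `|Num.sqrt n%:R / (s n)%:R| by near: n; exact: littleo_le.
  have sn : 0 < Num.sqrt n%:R :> R by rewrite sqrtr_gt0.
  rewrite [X in _ <= _ * X]ger0_norm ?divr_ge0 ?sqrtr_ge0 //.
  move=> h; have {}h := le_trans (ler_norm _) h.
  by rewrite -invf_div ler_pdivrMr // divr_gt0.
Unshelve. all: by end_near. Qed.

Let c30 : 0 < c3.
Proof. exact: (cub_gt0 m0 c10 c20 (fb (n := 1) ord0)). Qed.

Let M0 : 0 < M.
Proof. by have /andP [h1 h2] := fb (n := 1) ord0; apply: lt_le_trans (le_trans h1 h2). Qed.

Lemma regular_inj th n (x : 'cV[R]_(s n)) : regular th n ->
  lsubmx (X n) *m x = 0 -> x = 0.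
Proof.
move=> [n0 _ _ Aform _] Sx; apply: norm2_eq0; apply/eqP; rewrite -sqrf_eq0; apply/eqP.
have /andP [h _] := Aform x.
have e : (x^T *m SHS (X n) (f n) *m x) 0 0 = 0.
  by rewrite /SHS -!mulmxA Sx !mulmx0 mxE.
rewrite e in h; have cn : 0 < c0 * n%:R by rewrite mulr_gt0 // ltr0n.
by apply/le_anti; rewrite sqr_ge0 andbT -(pmulr_rle0 _ cn).
Qed.

(** The estimator is fixed once and for all, by a case distinction on the injectivity of [S] that
    does not involve [th], so one sequence serves every tolerance. It is 0 at the sample sizes where
    [S] is not injective. *)
Lemma oracle_choice : exists bor : forall n, T n -> 'cV[R]_(s n),
  (forall n, measurable_vector (bor n)) /\
  forall th n, regular th n -> forall om x,
    resid_loss tau (lsubmx (X n)) (y n om) (bor n om) <=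
    resid_loss tau (lsubmx (X n)) (y n om) x.
Proof.
have ex n : exists b : T n -> 'cV[R]_(s n), measurable_vector b /\
    ((forall x : 'cV[R]_(s n), lsubmx (X n) *m x = 0 -> x = 0) -> forall om x,
      resid_loss tau (lsubmx (X n)) (y n om) (b om) <=
      resid_loss tau (lsubmx (X n)) (y n om) x).
  have [inj|ninj] := pselect (forall x : 'cV[R]_(s n), lsubmx (X n) *m x = 0 -> x = 0).
    have my : measurable_vector (fun om => y n om).
      move=> j; rewrite (_ : (fun om => _) = (fun om => (X n *m col_mx (beta1 n) 0) j 0 + eps n j om)).
        by apply: measurable_funD; [exact: measurable_cst|exact: measurable_funPT].
      by apply/funext => om; rewrite /response mxE [X in _ + X]mxE.
    have [b [mb hb]] := oracle_exists tau01 inj my.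
    by exists b; split.
  by exists (fun=> 0); split=> // j; rewrite /= (_ : (fun=> _) = cst (0 : R)) //;
     apply/funext => om; rewrite mxE.
exists (fun n => sval (cid (ex n))); split=> [n|th n rg].
  by case: cid => b [].
by case: cid => b [_ hb] /=; apply: hb => x; exact: regular_inj rg.
Qed.

Variable bor : forall n, T n -> 'cV[R]_(s n).
Hypothesis bor_min : forall th n, regular th n -> forall om x,
    resid_loss tau (lsubmx (X n)) (y n om) (bor om) <=
    resid_loss tau (lsubmx (X n)) (y n om) x.

Lemma small_scale (l : seq R) :
  exists2 th, 0 < th <= 1 & all (fun z => z * th <= 1) l.
Proof.
elim: l => [|z l [th /andP [th0 th1] hl]]; first by exists 1; rewrite ?ltr01 ?lexx.
have z0 : 0 < 1 + `|z| by rewrite ltr_pwDl.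
exists (th / (1 + `|z|)).
  rewrite divr_gt0 //= ler_pdivrMr // mul1r; apply: le_trans th1 _.
  by rewrite lerDl.
apply/andP; split.
  rewrite mulrA ler_pdivrMr // mul1r; apply: (@le_trans _ _ (`|z| * th)).
    by rewrite ler_pM2r // ler_norm.
  by apply: (@le_trans _ _ `|z|); [rewrite ler_piMr|rewrite lerDr].
apply/allP => x /(allP hl) hx; rewrite mulrA ler_pdivrMr // mul1r.
by apply: le_trans hx _; rewrite lerDl.
Qed.

Lemma near_minimizer (eta C : R) : 0 < eta -> 0 < C -> \forall n \near \oo,
  exists A : set (T n), [/\ measurable A, 1 - eta <= fine (P n A) &
    forall om, A om ->
    [/\ norm2 (bor om - beta1 n) <= Num.sqrt ((s n)%:R * ln n%:R / n%:R),
        forall j, `|bor om j 0 - beta1 n j 0| < `|beta1 n j 0| &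
        forall bi, norm2 (bi - col_mx (beta1 n) 0) <=
            C * Num.sqrt ((s n)%:R * ln (s n + q n)%:R / n%:R) ->
          global_minimizer (arlasso_obj tau (X n) (y n om) (lam n)
            (scad_weights a (lam n) bi)) (col_mx (bor om) 0)]].
Proof.
move=> eta0 C0.
(* Half of the tolerance goes to the confinement of the oracle estimator, half to the noise
   columns. *)
have [K K0 KE] : exists2 K, 0 < K & 512 / (c0 * K) = eta / 2.
  exists (2 * 512 / (c0 * eta)); first by rewrite divr_gt0 ?mulr_gt0 ?ltr0n.
  by field; rewrite !gt_eqF.
pose D := 1 + M + 2 * c3.
have [e0 e00 De] : exists2 e0, 0 < e0 & D * e0 <= 1 / 8.
  have D0 : 0 < D by have := c30; have := M0; rewrite /D; lra.
  exists (8 * D)^-1; first by rewrite invr_gt0 mulr_gt0.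
  by apply: le_of_eq; field; rewrite gt_eqF.
have [b b0 [b1 bm]] : exists2 b, 0 < b & b <= 1 /\ c3 * b <= m / 4.
  exists (Num.min 1 (m / (4 * c3))); first by rewrite lt_min ltr01 divr_gt0 // mulr_gt0.
  rewrite ge_min lexx; split=> //.
  apply: (@le_trans _ _ (c3 * (m / (4 * c3)))); last first.
    by apply: le_of_eq; field; rewrite gt_eqF.
  by rewrite ler_pM2l // ge_min lexx orbT.
(* The first three requirements feed [nullity_numeric]; [2 * K / b] keeps the entries of [S x] below
   [b], [C] puts the initial estimator within [lam], and [2 * K] yields both [radius <= lam] and
   [K <= sqrt (ln n)]. *)
have [th /andP [th0 h1] /= /and5P [t1 t2 t3 t4 /and3P [t5 t6 _]]] := small_scale
  [:: 16 * K * C4; 128 * (c3 * K ^+ 2 / (m * c0)); (1024 * K / e0 + 768) * (2 / eta);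
      2 * K / b; C; 2 * K].
near=> n.
have rg : regular th n by near: n; exact: near_regular.
have [n0 lp1 thn Aform [lam0 wv wl Nv [kb bmn]]] := rg.
have nR : 0 < n%:R :> R by rewrite ltr0n.
have sR : 0 < (s n)%:R :> R by rewrite ltr0n.
set lp := ln (s n + q n)%:R in lp1 wv Nv *.
have lp0 : 0 < lp by lra.
have v0 : 0 < v n by rewrite sqrtr_gt0.
have w0 : 0 < w n by rewrite sqrtr_gt0 divr_gt0.
have sn0 : 0 < Num.sqrt n%:R :> R by rewrite sqrtr_gt0.
have inw : (Num.sqrt n%:R)^-1 <= w n.
  rewrite -sqrtrV // ler_wsqrtr // -[leLHS]mul1r ler_pM2r ?invr_gt0 //.
  by rewrite ler1n.
have gen z : z * (2 / eta) * th <= 1 -> z * th <= eta / 2.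
  by rewrite mulrAC -[2 / eta]invf_div ler_pdivrMr ?divr_gt0 // mul1r.
have {}t3 := gen _ t3.
have [ineq loss] := nullity_numeric K0 C40 c30 m0 c00 e00 lam0 w0 v0 th0 h1 sR nR sn0
  (sqr_sqrtr (ltW nR)) (sqr_sqrtr (ltW (divr_gt0 sR nR))) inw De Nv (le_trans kb h1) wv wl t1 t2 t3.
have Sb : forall (x : 'cV[R]_(s n)) i, norm2 x <= 2 * radius n (s n) K ->
    `|(lsubmx (X n) *m x) i 0| <= b.
  apply: lsubmx_entry_bound => //; apply: le_trans kb _.
  by rewrite -invf_div -div1r ler_pdivlMr ?divr_gt0 ?mulr_gt0 // mulrC.
have h0 : 0 < e0 * lam n by rewrite mulr_gt0.
have L0 : 0 < 4 * lp by rewrite mulr_gt0.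
(* [2 * q + 1 <= p ^ 2] once [p >= 2]. The factor 4 instead of 2 makes the root equal to twice
   [sqrt (ln p)]. *)
have q2 : ln (2 * q n + 1)%:R <= 4 * lp.
  have p2 : (1 < s n + q n)%N.
    rewrite ltnNge; apply/negP => h; have e1 : (s n + q n)%N = 1%N.
      by apply/eqP; rewrite eqn_leq h addn_gt0 s0.
    by move: lp1; rewrite /lp e1 ln1; lra.
  have h : (2 * q n + 1 <= (s n + q n) * (s n + q n))%N.
    apply: (@leq_trans (2 * (s n + q n))%N); last by rewrite leq_mul2r p2 orbT.
    by rewrite mulnDr addnC leq_add2r muln_gt0 s0.
  have p0 : (0 < s n + q n)%N by rewrite addn_gt0 s0.
  apply: (@le_trans _ _ (ln ((s n + q n) * (s n + q n))%:R)).
    by rewrite ler_ln ?posrE ?ltr0n ?muln_gt0 ?p0 ?addn1 // -addn1 ler_nat.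
  by rewrite natrM lnM ?posrE ?ltr0n // -/lp; lra.
have [A [mA pA hA]] := minimizer_event n0 (s0 n) tau01 (@indep n) (@Ptau n) (@Xcol n)
  m0 c00 c10 c20 (@fb n) (@FE n) Aform K0 b0 b1 bm Sb h0 lam0 L0 q2 ineq a2 bmn.
exists A; split=> //.
  apply: le_trans pA; rewrite lerD2l lerN2.
  have -> : Num.sqrt (4 * lp) = 2 * v n.
    by rewrite sqrtrM // (_ : 4 = 2 ^+ 2) ?sqrtr_sqr ?ger0_norm //; ring.
  by rewrite KE; lra.
move=> om Aom.
have [br gm] := hA om (bor om) Aom (bor_min rg om).
have rK : radius n (s n) K = K * w n by [].
have rlam : radius n (s n) K <= lam n.
  rewrite rK; apply: (@le_trans _ _ (K * (2 * (th * lam n)))); first by rewrite ler_pM2l.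
  have -> : K * (2 * (th * lam n)) = (2 * K) * th * lam n by ring.
  by rewrite ler_piMl // ltW.
split.
- apply: le_trans br _; rewrite rK.
  have -> : (s n)%:R * ln n%:R / n%:R = ln n%:R * ((s n)%:R / n%:R) :> R by ring.
  have lnn : 0 <= ln n%:R :> R by rewrite ln_ge0 // ler1n.
  rewrite (sqrtrM _ lnn) ler_pM2r //; apply: le_trans thn.
  by rewrite -div1r ler_pdivlMr //; have := mulr_gt0 K0 th0; lra.
- move=> j; apply: (@le_lt_trans _ _ (lam n)).
    apply: le_trans rlam; apply: le_trans br.
    by have := entry_le_norm2 (bor om - beta1 n) j; rewrite mxE [X in _ + X]mxE.
  apply: lt_le_trans (bmn j); rewrite -[ltLHS]mul1r ltr_pM2r //.
  by have := a2; lra.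
move=> bi hbi; apply: gm; apply: le_trans hbi _.
have -> : (s n)%:R * lp / n%:R = (s n)%:R / n%:R * lp by ring.
rewrite sqrtrM ?divr_ge0 //.
apply: (@le_trans _ _ (C * (th * lam n))); first by rewrite ler_pM2l.
by rewrite mulrA ler_piMl // ltW.
Unshelve. all: by end_near. Qed.

Local Notation oracle_stat cc om := (((cc)^T *m invsqrtmx ((Zmx (X _) (f _))^T *m Zmx (X _) (f _))
  *m invmx (Vmx (X _) (f _)) *m (bor om - beta1 _)) 0 0).

Lemma near_clt (cc : forall n, 'cV[R]_(s n)) (x eta : R) : 0 < eta ->
  (forall n, measurable_vector (@bor n)) -> (forall n, (cc n)^T *m cc n = 1%:M) ->
  (fun n => max_fZ (X n) (f n) * (s n)%:R `^ (7 / 2) * ln (s n)%:R : R) @ \oo --> (0 : R) ->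
  \forall n \near \oo, `|fine (P n [set om | oracle_stat (cc n) om <= x]) -
    ncdf (Num.sqrt (tau * (1 - tau))) x| <= eta.
Proof.
move=> eta0 mbor cc1 fZ; set sg := Num.sqrt _.
have sg0 : 0 < sg by have /andP [? ?] := tau01; rewrite sqrtr_gt0 mulr_gt0 // subr_gt0.
have pk0 := ncdf_pk0 sg0; set pk := normal_peak sg in pk0.
have eta3 : 0 < eta / 3 by rewrite divr_gt0.
(* The tolerance is split in three: the shift by [kp], the normal approximation, and the exceptional
   event, whose third is halved between [K] and [g]. *)
pose kp := eta / 3 / pk.
have kp0 : 0 < kp by rewrite divr_gt0.
have [dl1 dl10 hdl1] := clt_bernoulli (x + kp) tau01 eta3.
have [dl2 dl20 hdl2] := clt_bernoulli (x - kp) tau01 eta3.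
have [K K0 KE] : exists2 K, 0 < K & 512 / (c0 * K) = eta / 6.
  exists (6 * 512 / (c0 * eta)); first by rewrite divr_gt0 ?mulr_gt0 ?ltr0n.
  by field; rewrite !gt_eqF.
(* Makes the linearization error equal to [kp]; the second [t] is reserved for the cubic term. *)
have [t t0 tE] : exists2 t, 0 < t & M * (4 * (t + t)) = kp ^+ 2.
  exists (kp ^+ 2 / (8 * M)); first by apply: divr_gt0; [exact: exprn_gt0|exact: mulr_gt0].
  by field; rewrite gt_eqF.
pose U := 6 * M + 20 * c3.
have U0 : 0 < U by have := c30; have := M0; rewrite /U; lra.
have [g g0 gE] : exists2 g, 0 < g & 16 * K * g / t = eta / 6.
  exists (eta * t / (6 * 16 * K)); first by rewrite divr_gt0 ?mulr_gt0.
  by field; rewrite !gt_eqF.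
pose B := Num.sqrt M / (2 * K * Num.sqrt c0).
have [e /andP [e0 e1] /= /and5P [t1 t2 t3 t4 /andP [t5 _]]] := small_scale
  [:: c3 / (m / 4); c3 * (4 * K ^+ 2 / (m * c0)) / t; U / g ^+ 2; B / dl1; B / dl2].
have conv z z' : 0 < z' -> z / z' * e <= 1 -> z * e <= z'.
  by move=> z0; rewrite mulrAC ler_pdivrMr // mul1r.
have m4 : 0 < m / 4 by rewrite divr_gt0.
have {}t1 := conv _ _ m4 t1.
have {}t2 := conv _ _ t0 t2; have {}t3 := conv _ _ (exprn_gt0 2 g0) t3.
have {}t4 := conv _ _ dl10 t4; have {}t5 := conv _ _ dl20 t5.
have smc : 0 < Num.sqrt (m * c0) by rewrite sqrtr_gt0 mulr_gt0.
pose th := e / (2 * K).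
have th0 : 0 < th by rewrite divr_gt0 // mulr_gt0.
have e'0 : 0 < e * Num.sqrt (m * c0) / (8 * K) by rewrite divr_gt0 // mulr_gt0.
move/cvgrPdist_le : fZ => /(_ _ e'0) fZ.
near=> n.
have rg : regular th n by near: n; exact: near_regular.
have [n0 _ _ Aform [_ _ _ _ [kb _]]] := rg.
have sR : 0 < (s n)%:R :> R by rewrite ltr0n.
have s1 : 1 <= (s n)%:R :> R by rewrite ler1n.
have ss : 0 < (s n)%:R ^+ 2 :> R by rewrite exprn_gt0.
have ss1 : 1 <= (s n)%:R ^+ 2 :> R by rewrite exprn_ege1.
(* The remainder fluctuates by a multiple of [s * sqrt b]; with this [b] it becomes a multiple of
   [sqrt e], free of [s]. *)
pose b := e / (s n)%:R ^+ 2.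
have b0 : 0 < b by rewrite divr_gt0.
have be : b <= e by rewrite ler_pdivrMr // ler_peMr // ltW.
have b1 : b <= 1 by exact: le_trans e1.
have bm : c3 * b <= m / 4 by apply: le_trans t1; rewrite ler_pM2l.
have Sb : forall (z : 'cV[R]_(s n)) i, norm2 z <= 2 * radius n (s n) K ->
    `|(lsubmx (X n) *m z) i 0| <= b.
  (* For [s n = 1] the factor [ln (s n)] makes [fZ] void, but then Condition 2
     alone bounds the entries of [S z] by [b]. *)
  have [s2|] := ltnP 1 (s n); last first.
    move=> h; have e' : s n = 1%N by apply/eqP; rewrite eqn_leq h s0.
    apply: lsubmx_entry_bound => //; apply: le_trans kb _.
    by rewrite /b e' expr1n divr1.
  have fm i : m <= f n i 0 by case/andP: (fb i).
  apply: (max_fZ_bound n0 K0 m0 c00 fm Aform).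
  have : `|0 - max_fZ (X n) (f n) * (s n)%:R `^ (7 / 2) * ln (s n)%:R| <=
    e * Num.sqrt (m * c0) / (8 * K) by near: n.
  set mZ := max_fZ _ _; have mZ0 : 0 <= mZ by rewrite /mZ /max_fZ; apply: bigmax_ge_id.
  rewrite sub0r normrN => /(le_trans (ler_norm _)) h.
  have p7 : (s n)%:R `^ (7 / 2) = (s n)%:R ^+ 3 * Num.sqrt (s n)%:R :> R.
    rewrite -powR12_sqrt ?ler0n // -powR_mulrn ?ler0n // -powRD.
      by congr (_ `^ _); lra.
    by apply/implyP => _; rewrite gt_eqF.
  rewrite p7 in h; rewrite /b.
  have q1 : (s n)%:R ^+ 2 <= (s n)%:R ^+ 3 * (4 * ln (s n)%:R) :> R.
    rewrite [X in _ <= X * _]exprSr -mulrA ler_peMr ?(ltW ss) //.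
    have := ln_nat_ge R s2; nra.
  set k := Num.sqrt (s n)%:R in h *.
  have k0 : 0 <= k by exact: sqrtr_ge0.
  rewrite [leRHS]mulrAC ler_pdivlMr //.
  move: h; rewrite ler_pdivlMr ?mulr_gt0 // => h; apply: le_trans h.
  have -> : mZ * (2 * K * k) * (s n)%:R ^+ 2 = mZ * (2 * K * k) * ((s n)%:R ^+ 2) by [].
  have -> : mZ * ((s n)%:R ^+ 3 * k) * ln (s n)%:R * (8 * K) =
    mZ * (2 * K * k) * ((s n)%:R ^+ 3 * (4 * ln (s n)%:R)) by ring.
  by rewrite ler_wpM2l // !mulr_ge0 // ltW.
have [al [al1 al2 [A [mA pA hA]]]] := clt_event n0 (s0 n) (@indep n) (@Ptau n) (@Xcol n)
  m0 c00 c10 c20 (@fb n) (@FE n) Aform K0 b0 b1 bm Sb (beta1 n) (cc1 n) t0.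
have bB : b * Num.sqrt M / (2 * K * Num.sqrt c0) = B * b by rewrite /B; ring.
have B0 : 0 <= B by rewrite divr_ge0 ?sqrtr_ge0 // !mulr_ge0 ?sqrtr_ge0 // ltW.
have Be : B * b <= B * e by rewrite ler_wpM2l.
have hz z : z = x + kp \/ z = x - kp -> `|Ex (bern tau (n := n))
     (fun b => (\sum_i al i * (tau - (b i)%:R) <= z)%R%:R) - ncdf sg z| <= eta / 3.
  case=> ->.
    apply: hdl1 => // i; apply: le_trans (al2 i) _; rewrite bB.
    exact: le_trans t4.
  apply: hdl2 => // i; apply: le_trans (al2 i) _; rewrite bB.
  exact: le_trans t5.
have mY : measurable_fun setT (fun om => oracle_stat (cc n) om).
  apply: (@measurable_mulmx _ _ _ _ _ _ (fun om => bor om - beta1 n)) => j.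
  rewrite (_ : (fun om => _) = (fun om => bor om j 0 - beta1 n j 0)).
    by apply: measurable_funB; [exact: mbor|exact: measurable_cst].
  by apply/funext => om; rewrite mxE [X in _ + X]mxE.
have pA' : 1 - eta / 3 <= fine (P n A).
  apply: le_trans pA; rewrite lerD2l lerN2 KE.
  suff : 16 * K * (s n)%:R * Num.sqrt (U * b) / t <= eta / 6 by rewrite /U; lra.
  rewrite -gE ler_pM2r ?invr_gt0 // -mulrA ler_pM2l ?mulr_gt0 //.
  have -> : (s n)%:R * Num.sqrt (U * b) = Num.sqrt (U * e).
    rewrite -[X in X * _](ger0_norm (ltW sR)) -sqrtr_sqr -sqrtrM ?sqr_ge0 //.
    by congr Num.sqrt; rewrite /b; field; rewrite gt_eqF.
  by rewrite -[leRHS](gtr0_norm g0) -sqrtr_sqr ler_wsqrtr.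
have YA om : A om -> `|oracle_stat (cc n) om - \sum_i al i * (tau - (eps n i om <= 0)%R%:R)| <= kp.
  move=> Aom; apply: le_trans (hA om (bor om) Aom (bor_min rg om)) _.
  rewrite -[leRHS](gtr0_norm kp0) -sqrtr_sqr ler_wsqrtr // -tE.
  rewrite ler_pM2l // ler_pM2l // lerD2l; apply: le_trans t2.
  have -> : c3 * b * (4 * (K ^+ 2 * (s n)%:R) / (m * c0)) =
      c3 * (4 * K ^+ 2 / (m * c0)) * (b * (s n)%:R) by ring.
  rewrite ler_wpM2l //.
    apply: mulr_ge0; first exact: ltW.
    by rewrite divr_ge0 ?(ltW (mulr_gt0 m0 c00)) //; apply: mulr_ge0; rewrite ?sqr_ge0.
  rewrite /b mulrAC ler_pdivrMr // ler_pM2l // expr2 ler_peMr // ltW.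
apply: le_trans (clt_cdf_bound sg0 (@indep n) (@Ptau n) mY mA pA' (ltW kp0) YA hz) _.
have -> : normal_peak sg * kp = eta / 3 by rewrite /kp -/pk; field; rewrite gt_eqF.
lra.
Unshelve. all: by end_near. Qed.

End Asymptotics.

Lemma sgr_near (R : realType) (x z : R) : `|x - z| < `|z| -> Num.sg x = Num.sg z.
Proof.
case: (sgrP z) => [->|z0|z0].
- by rewrite ltNge normr_ge0.
- by rewrite ltr_norml => /andP [h _]; apply: gtr0_sg; lra.
- by rewrite ltr_norml => /andP [_ h]; apply: ltr0_sg; lra.
Qed.

Theorem corollary1 (R : realType)
  (d : nat -> measure_display) (T : forall n, measurableType (d n))
  (P : forall n, probability (T n) R)
  (tau a : R) (s q : nat -> nat)
  (X : forall n, 'M[R]_(n, s n + q n))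
  (beta1 : forall n, 'cV[R]_(s n))
  (eps : forall n, 'I_n -> {RV (P n) >-> R})
  (f : forall n, 'I_n -> R -> R)
  (lam lam_ini : nat -> R)
  (bini : forall n, T n -> 'cV[R]_(s n + q n)) :
  let p := fun n => (s n + q n)%N in
  let beta := fun n => col_mx (beta1 n) 0 : 'cV[R]_(s n + q n) in
  let y := fun n w => response (X n) (beta n) (fun i => eps n i) w in
  let Lhat := fun n w => arlasso_obj tau (X n) (y n w) (lam n)
                           (scad_weights a (lam n) (bini n w)) in
  0 < tau < 1 ->
  2 < a ->
  (forall n, (0 < s n)%N) ->
  (fun n => (s n)%:R : R) =o_\oo (fun n => n%:R : R) ->
  (forall n (j : 'I_(s n + q n)), norm2 (col j (X n)) = Num.sqrt n%:R) ->
  (forall n (j : 'I_(s n)), beta1 n j 0 != 0) ->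
  (forall n, mutually_independent (eps n)) ->
  (forall n i, has_density (eps n i) (f n i)) ->
  (forall n i, P n [set w | eps n i w <= 0] = tau%:E) ->
  (forall n, 0 <= lam n) ->
  (forall n, 0 <= lam_ini n) ->
  (forall n, measurable_vector (bini n)) ->
  (forall n w, global_minimizer
                 (rlasso_obj tau (X n) (y n w) (lam_ini n)) (bini n w)) ->
  lam =Theta_\oo (fun n => Num.sqrt
     ((s n)%:R * ln (p n)%:R * ln (ln n%:R) / n%:R) : R) ->
  (fun n => ln (p n)%:R : R) =o_\oo (fun n => Num.sqrt n%:R : R) ->
  (\forall n \near \oo, forall j : 'I_(s n), 2 * a * lam n <= `|beta1 n j 0|) ->
  (fun n => max_entry (X n)) =o_\oo (fun n =>
     n%:R `^ (1 / 4) * (s n)%:R `^ (- (1 / 2)) * ln n%:R `^ (- (3 / 2))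
     * ln (p n)%:R `^ (1 / 2) : R) ->
  (exists C4 : R, 0 < C4 /\ \forall n \near \oo,
     norm2inf (n%:R^-1 *: QHS (X n) (f n)) <
     C4 * Num.sqrt (ln (p n)%:R * ln (ln n%:R) / ln n%:R)) ->
  condition1 f (fun n i => distr_fun (eps n i)) ->
  condition2 X f ->
  (exists C2 : R, 0 < C2 /\
     with_prob_to_one P (fun n => [set w |
       norm2 (bini n w - beta n) <=
       C2 * Num.sqrt ((s n)%:R * ln (p n)%:R / n%:R)])) ->
  exists (C : R) (bhat : forall n, T n -> 'cV[R]_(s n + q n)),
    [/\ 0 < C,
        (forall n, measurable_vector (bhat n)),
        with_prob_to_one P (fun n => [set w |
          [/\ global_minimizer (Lhat n w) (bhat n w),
              norm2 (usubmx (bhat n w) - beta1 n) <=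
                C * Num.sqrt ((s n)%:R * ln n%:R / n%:R),
              map_mx Num.sg (usubmx (bhat n w)) = map_mx Num.sg (beta1 n) &
              dsubmx (bhat n w) = 0]]) &
        (fun n => max_fZ (X n) (f n) * (s n)%:R `^ (7 / 2) * ln (s n)%:R : R)
          @ \oo --> (0 : R) ->
        forall c : forall n, 'cV[R]_(s n),
          (forall n, (c n)^T *m c n = 1%:M) ->
          cvg_in_distribution P
            (fun n w => ((c n)^T *m invsqrtmx ((Zmx (X n) (f n))^T *m Zmx (X n) (f n))
                          *m invmx (Vmx (X n) (f n))
                          *m (usubmx (bhat n w) - beta1 n)) 0 0)
            (normal_prob 0 (Num.sqrt (tau * (1 - tau))))].
Proof.
move=> p beta y Lhat tau01 a2 s0 _ Xcol _ indep _ Ptau lam_ge0 _ _ _ lamT _ bmin kapo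
  [C4 [C40 n2]] [c1 [c2 [c10 c20 [m [M [m0 fb']]] FE]]] [[c0 [c00 eig]] kap2]
  [C2 [C20 [Aini [mAi sAi pAi]]]].
have fb n i : m <= f n i 0 <= M by apply: fb'; rewrite normr0 ltW.
have [c cpos lamc'] := theta_ge lamT.
have lamc : \forall n \near \oo,
    c * Num.sqrt ((s n)%:R * ln (s n + q n)%:R * ln (ln n%:R) / n%:R) <= lam n.
  apply: filterS lamc' => n; rewrite (ger0_norm (lam_ge0 n)).
  by rewrite ger0_norm // sqrtr_ge0.
have lp_ge : \forall n \near \oo, 1 / 4 <= ln (s n + q n)%:R :> R.
  (* The columns have norm [sqrt n], so [max_entry >= 1], whereas its bound
     vanishes when [p n = 1]. *)
  near=> n.
  have n0 : (0 < n)%N by near: n; exact: nbhs_infty_gt.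
  have pn0 : (0 < s n + q n)%N by rewrite addn_gt0 s0.
  have k1 := max_entry_ge1 n0 (Xcol n (Ordinal pn0)).
  have [|p1] := ltnP 1 (s n + q n); first exact: ln_nat_ge.
  have p1' : (s n + q n)%N = 1%N by apply/eqP; rewrite eqn_leq p1.
  have : `|max_entry (X n)| <= 1 * `|n%:R `^ (1 / 4) * (s n)%:R `^ (- (1 / 2)) *
      ln n%:R `^ (- (3 / 2)) * ln (p n)%:R `^ (1 / 2)|.
    by near: n; exact: littleo_le.
  rewrite [ln (p n)%:R](_ : _ = 0); last by rewrite /p p1' ln1.
  rewrite powR0 ?mulr0 ?normr0 ?mulr0 // => h.
  by have := le_trans k1 (le_trans (ler_norm _) h); rewrite ler10.
have [bor [mbor bmn]] := oracle_choice a X beta1 eps f lam C4 tau01 c00.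
(* The constant 1 suffices because, whatever [K] a tolerance requires, eventually
   [K <= sqrt (ln n)]. *)
exists 1, (fun n w => col_mx (bor n w) 0); split=> //.
- move=> n j; have [k ->|k ->] := split_ordP j.
    rewrite (_ : (fun w => _) = (fun w => bor n w k 0)); first exact: mbor.
    by apply/funext => w; rewrite col_mxEu.
  rewrite (_ : (fun w => _) = cst 0) //.
  by apply/funext => w; rewrite col_mxEd mxE.
- apply: with_prob_to_oneI => eta eta0.
  have eta2 : 0 < eta / 2 by rewrite divr_gt0.
  have near1 := near_minimizer tau01 a2 s0 Xcol indep Ptau m0 c00 c10 c20 cpos C40
    fb FE eig kap2 lamc lp_ge bmin n2 bmn eta2 C20.
  move/fine_cvg : pAi => /cvgrPdist_le /(_ _ eta2) near2.
  apply: filterS2 near1 near2 => n [A [mA pA hA]] /(le_trans (ler_norm _)).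
  rewrite /= lerBlDr addrC -lerBlDr => pA2.
  (* The event on the initial estimator takes the other [eta / 2]. *)
  have [mI pI] := prob_setI mA (mAi n) pA pA2.
  exists (A `&` Aini n); split=> //; first by rewrite -splitr in pI.
  move=> om [/hA [h1 h2 h3] /sAi hi]; split.
  + exact: h3.
  + by rewrite col_mxKu mul1r.
  + rewrite col_mxKu; apply/matrixP => j k; rewrite !mxE ord1.
    by apply: sgr_near; exact: h2.
  + by rewrite col_mxKd.
move=> fZ cc cc1.
have bE n w : usubmx (col_mx (bor n w) (0 : 'cV[R]_(q n))) = bor n w by rewrite col_mxKu.
set Y := (Y in cvg_in_distribution _ Y _).
have mY n : measurable_fun setT (Y n).
  apply: (@measurable_mulmx _ _ _ _ _ _ (fun w => usubmx (col_mx (bor n w) (0 : 'cV[R]_(q n))) - beta1 n)) => j.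
  rewrite (_ : (fun w => _) = (fun w => bor n w j 0 - beta1 n j 0)).
    by apply: measurable_funB; [exact: mbor|exact: measurable_cst].
  by apply/funext => w; rewrite bE mxE [X in _ + X]mxE.
split=> // x _; set sg := Num.sqrt _.
have -> : normal_prob 0 sg `]-oo, x]%classic = (ncdf sg x)%:E.
  by rewrite /ncdf fineK // fin_num_measure.
apply: cvg_EFin.
  near=> n; rewrite fin_num_measure //.
  rewrite (_ : [set w | _] = [set: T n] `&` Y n @^-1` `]-oo, x]); first exact: mY.
  by apply/seteqP; split=> w /=; rewrite in_itv //= => -[].
apply/cvgrPdist_le => eta eta0.
have := near_clt tau01 s0 Xcol indep Ptau m0 c00 c10 c20 cpos C40
      fb FE eig kap2 lamc lp_ge bmin n2 bmn x eta0 mbor cc1 fZ.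
apply: filterS => n; rewrite distrC /= (_ : [set w | _] = [set w | Y n w <= x]) //.
by apply/seteqP; split=> w /=; rewrite /Y bE.
Unshelve. all: by end_near. Qed.
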